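(* Let $G$ be a $2$-connected partial $3$-tree. Then $\mathrm{lct}(G)=1$; that is, there is a vertex of $G$ that belongs to every longest cycle of $G$.
   Context: All graphs are finite and simple. A longest cycle of $G$ is a cycle of maximum length in $G$. $\mathrm{lct}(G)$ (the longest cycle transversal number) is the minimum size of a set of vertices of $G$ that meets every longest cycle of $G$. A $3$-tree is defined recursively: the complete graph $K_3$ is a $3$-tree, and any graph obtained from a $3$-tree by adding a new vertex adjacent to exactly the three vertices of an existing triangle is a $3$-tree. A partial $3$-tree is a subgraph of a $3$-tree; equivalently, a graph of treewidth at most $3$. *)

(* Defs.v *)
From mathcomp Require Import all_boot.

Set Implicit Arguments.
Unset Strict Implicit.
Unset Printing Implicit Defensive.

Record sgraph := SGraph {
  vertex :> finType;
  edge : rel vertex;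
  edge_sym : symmetric edge;
  edge_irr : irreflexive edge }.

Arguments edge {s}.

Definition induced_edge (G : sgraph) (A : {set G}) : rel G :=
  [rel x y | [&& x \in A, y \in A & edge x y]].

Definition connected_on (G : sgraph) (A : {set G}) : bool :=
  [forall x in A, forall y in A, connect (induced_edge A) x y].

(* More than [k] vertices, and connected after the removal of any set of fewer
   than [k] vertices; in particular, a 2-connected graph has at least three
   vertices. *)
Definition kconnected (k : nat) (G : sgraph) : bool :=
  (k < #|G|) && [forall S : {set G}, (#|S| < k) ==> connected_on (~: S)].

(* A cycle is given by the list of its vertices in cyclic order, so each cycle
   has one representation per starting point and orientation. *)
Definition is_cycle (G : sgraph) (c : seq G) : bool :=
  (2 < size c) && ucycleb edge c.

(* Cycles are duplicate-free, so quantifying over the finite type of lists of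
   length at most [#|G|] covers all of them: see [longest_cycleP] and
   [lc_transversalP]. *)
Definition longest_cycle (G : sgraph) (c : seq G) : bool :=
  is_cycle c && [forall d : {bseq #|G| of G}, is_cycle d ==> (size d <= size c)].

Definition lc_transversal (G : sgraph) (S : {set G}) : bool :=
  [forall c : {bseq #|G| of G}, longest_cycle c ==> [exists x in S, x \in c]].

Definition lct (G : sgraph) : nat :=
  #|[arg min_(S < [set: G] | lc_transversal S) #|S|]|.

Lemma is_cycle_size (G : sgraph) (c : seq G) : is_cycle c -> size c <= #|G|.
Proof. by case/and3P=> _ _ /card_uniqP <-; apply: max_card. Qed.

Lemma longest_cycleP (G : sgraph) (c : seq G) :
  reflect (is_cycle c /\ forall d : seq G, is_cycle d -> size d <= size c)
          (longest_cycle c).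
Proof.
apply: (iffP andP) => [[cc /forallP max_c]|[cc max_c]]; split=> //.
  by move=> d cd; apply: (implyP (max_c (Bseq (is_cycle_size cd)))).
by apply/forallP=> d; apply/implyP/max_c.
Qed.

Lemma lc_transversalP (G : sgraph) (S : {set G}) :
  reflect (forall c : seq G, longest_cycle c -> exists2 x, x \in S & x \in c)
          (lc_transversal S).
Proof.
apply: (iffP forallP) => [tS c lc|tS c].
  have /andP[cc _] := lc.
  exact/exists_inP/(implyP (tS (Bseq (is_cycle_size cc)))).
by apply/implyP=> /tS/exists_inP.
Qed.

Lemma lc_transversalT (G : sgraph) : lc_transversal [set: G].
Proof.
apply/lc_transversalP=> [[|x c]] /andP[/andP[//]].
by exists x; rewrite !inE ?eqxx.
Qed.

Lemma lctP (G : sgraph) :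
  (exists2 S : {set G}, lc_transversal S & #|S| = lct G) /\
  (forall S : {set G}, lc_transversal S -> lct G <= #|S|).
Proof.
rewrite /lct; case: arg_minnP => [|S tS minS]; first exact: lc_transversalT.
by split; first exists S.
Qed.

Definition isomorphic (G H : sgraph) : Prop :=
  exists2 f : G -> H, bijective f & forall x y : G, edge (f x) (f y) = edge x y.

(* Subgraph up to isomorphism: neither induced nor spanning in general. *)
Definition subgraph (G H : sgraph) : Prop :=
  exists2 f : G -> H, injective f & forall x y : G, edge x y -> edge (f x) (f y).

Section Complete.
Variable n : nat.
Definition complete_edge : rel 'I_n := [rel x y | x != y].
Lemma complete_sym : symmetric complete_edge.
Proof. by move=> x y; rewrite /complete_edge /= eq_sym. Qed.
Lemma complete_irr : irreflexive complete_edge.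
Proof. by move=> x; rewrite /complete_edge /= eqxx. Qed.
Definition complete : sgraph := SGraph complete_sym complete_irr.
End Complete.

(* The graph [G] plus one new vertex [None], whose neighbourhood is [N]. *)
Section AddVertex.
Variables (G : sgraph) (N : {set G}).
Definition add_vertex_edge : rel (option G) := fun u v =>
  match u, v with
  | Some x, Some y => edge x y
  | Some x, None | None, Some x => x \in N
  | None, None => false
  end.
Lemma add_vertex_sym : symmetric add_vertex_edge.
Proof. by case=> [x|] [y|] //=; apply: edge_sym. Qed.
Lemma add_vertex_irr : irreflexive add_vertex_edge.
Proof. by case=> [x|] //=; apply: edge_irr. Qed.
Definition add_vertex : sgraph := SGraph add_vertex_sym add_vertex_irr.
End AddVertex.

Inductive three_tree : sgraph -> Prop :=
| three_tree_K3 : three_tree (complete 3)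
| three_tree_add (G : sgraph) (a b c : G) :
    three_tree G -> edge a b -> edge b c -> edge a c ->
    three_tree (add_vertex [set a; b; c])
| three_tree_iso (G H : sgraph) :
    three_tree G -> isomorphic G H -> three_tree H.

Definition partial_three_tree (G : sgraph) : Prop :=
  exists2 H : sgraph, three_tree H & subgraph G H.

(* Main.v *)
Require Import Defs.
From mathcomp Require Import all_boot zify.

Set Implicit Arguments.
Unset Strict Implicit.
Unset Printing Implicit Defensive.

(* Suppose that no vertex of [G] lies on all longest cycles. Let [H] be a 3-tree
   containing [G]. For a triangle [S] of [H] and a union [D] of components of [H - S],
   call [(S, D)] good if every longest cycle meets [D], or if every longest cycle [C]
   with [#|C :&: S| <> 2] meets [D] and some longest cycle lies in [S :|: D]. For any
   [S], the pair of [S] and its complement is good; take a good pair with [#|D|]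
   minimal. If [D] splits into two such unions, neither is good with [S]. Otherwise some
   [d] in [D] is adjacent to all of [S], and the [K_4] formed by [S] and [d] has four
   sides: the complement of [S :|: D], and the parts of [D] behind the three other
   triangles, which by minimality are not good. In both cases there are longest cycles
   avoiding each vertex of the triangle or clique and each of the sides in a prescribed
   way. These vertices cut a cycle into arcs, each inside one side, so arcs with
   different labels are disjoint, and two arcs with the same label either are disjoint
   or cross, in which case they contain two arcs to a common end which together are
   longer than one of them. In all cases some recombination of the arcs is a cycle
   longer than the longest ones; this is a linear program for each of finitely many
   configurations, refuted by the certificates below. Finally, 2-connectivity is used
   only to know that two longest cycles share at least two vertices. *)

(** * Certificates *)

(* A labelled arc has two terminals as ends and carries the labels still possible for
   its interior; a pattern consists of the terminals on a cycle, in cyclic order, and the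
   arcs between them.  Labels are the sides of the set of terminals: interiors of arcs with
   different labels are disjoint. *)
Definition larc := (nat * nat * seq nat)%type.
Definition pattern := (seq nat * seq larc)%type.

(* [att d i l]: the terminal [i] may have neighbours with label [l]. *)
Record dom := Dom { nterm : nat; nlab : nat; att : nat -> nat -> bool }.

(* [Leaf ms mu nu] is a Farkas certificate: the recombined cycles [ms] contradict the
   maximality of the given cycles, weighted by [mu], and the inequalities obtained from
   crossings, weighted by [nu].  In [Cross i j t1 t2], the base arcs [i] and [j] are disjoint
   in [t1] and meet in [t2]. *)
Inductive ctree :=
| Leaf of seq (nat * seq nat) & seq nat & seq nat
| Cross of nat & nat & ctree & ctree.

Section CoreChecker.

(* A base arc with the index of the cycle that it comes from. *)
Definition barcs (fam : seq pattern) : seq (nat * larc) :=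
  flatten [seq [seq (ip.1, a) | a <- ip.2.2] | ip <- zip (iota 0 (size fam)) fam].

Definition dj0 (b : seq (nat * larc)) (i j : nat) : bool :=
  let: (ci, (_, _, li)) := nth (0, (0, 0, [::])) b i in
  let: (cj, (_, _, lj)) := nth (0, (0, 0, [::])) b j in
  (i != j) && ((ci == cj) || ~~ has (mem li) lj).

Definition own (b : seq (nat * larc)) (k : nat) : seq nat :=
  [seq i <- iota 0 (size b) | (nth (0, (0, 0, [::])) b i).1 == k].

(* Endpoints of an arc, and the base arcs whose union contains its interior. *)
Definition darc := (nat * nat * seq nat)%type.

(* The arcs [X = (p, q)] and [Y], with [s] an end of [Y]: if they meet, then [X] and [Y]
   contain arcs [(p, s)] and [(q, s)] of total length more than that of [X]. *)
Definition add_tripod (X Y s : nat) (AI : seq darc * seq (nat * seq nat)) :=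
  let: (A, J) := AI in
  let: (p, q, _) := nth (0, 0, [::]) A X in
  if (s == p) || (s == q) then AI
  else (A ++ [:: (p, s, [:: X; Y]); (q, s, [:: X; Y])],
        rcons J (X, [:: size A; (size A).+1])).

Definition add_tripods (X Y : nat) (AI : seq darc * seq (nat * seq nat)) :=
  let: (r, s, _) := nth (0, 0, [::]) AI.1 Y in
  add_tripod X Y s (add_tripod X Y r AI).

Fixpoint walk (A : seq darc) (u : nat) (ks : seq nat) : option (seq nat) :=
  match ks with
  | [::] => Some [::]
  | k :: ks' =>
      let: (i, j, _) := nth (0, 0, [::]) A k in
      if u == i then omap (cons j) (walk A j ks')
      else if u == j then omap (cons i) (walk A i ks') else None
  end.

Definition closed_from (A : seq darc) (ks : seq nat) (u : nat) : bool :=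
  if walk A u ks is Some vs then
    [&& 1 < size vs, uniq vs & last u vs == u]
  else false.

Definition good_combo (b : seq (nat * larc)) (D : seq (nat * nat)) (A : seq darc)
    (ks : seq nat) : bool :=
  let dj i j := [|| dj0 b i j, (i, j) \in D | (j, i) \in D] in
  let par k := (nth (0, 0, [::]) A k).2 in
  [&& all (fun k => k < size A) ks,
      pairwise (fun k l => all (fun i => all (dj i) (par l)) (par k)) ks
    & closed_from A ks (nth (0, 0, [::]) A (head 0 ks)).1.1
      || closed_from A ks (nth (0, 0, [::]) A (head 0 ks)).1.2].

Definition coef (v : nat) (l : seq (nat * seq nat)) : nat :=
  sumn [seq t.1 * count_mem v t.2 | t <- l].

Definition check_leaf (b : seq (nat * larc)) (ncyc : nat) (D : seq (nat * nat))
    (A : seq darc) (I : seq (nat * seq nat))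
    (ms : seq (nat * seq nat)) (mu nu : seq nat) : bool :=
  let lhs := ms ++ [seq (ni.1, [:: ni.2.1]) | ni <- zip nu I] in
  let rhs := [seq (mk.1, own b mk.2) | mk <- zip mu (iota 0 ncyc)]
             ++ [seq (ni.1, ni.2.2) | ni <- zip nu I] in
  let sm := sumn [seq t.1 | t <- ms] in
  [&& size mu <= ncyc, size nu <= size I,
      all (fun t => good_combo b D A t.2) ms,
      all (fun v => coef v rhs <= coef v lhs) (iota 0 (size A)),
      sm <= sumn mu
    & [|| sm < sumn mu, 0 < sumn nu
        | has (fun v => coef v rhs < coef v lhs) (iota 0 (size A))]].

Fixpoint check_ctree (b : seq (nat * larc)) (ncyc : nat) (D : seq (nat * nat))
    (A : seq darc) (I : seq (nat * seq nat)) (t : ctree) : bool :=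
  match t with
  | Leaf ms mu nu => check_leaf b ncyc D A I ms mu nu
  | Cross i j t1 t2 =>
      [&& i < size b, j < size b,
          check_ctree b ncyc ((i, j) :: D) A I t1
        & let: (A', I') := add_tripods j i (add_tripods i j (A, I)) in
          check_ctree b ncyc D A' I' t2]
  end.

Definition check_core (fam : seq pattern) (t : ctree) : bool :=
  let b := barcs fam in
  check_ctree b (size fam) [::]
    [seq (ia.2.2.1, [:: ia.1]) | ia <- zip (iota 0 (size b)) b] [::] t.

End CoreChecker.

(* Orders and label sets are encoded by small numbers: [k :: ds] is the k-th terminal
   order together with one bit mask per arc, over the labels allowed for that arc. *)
Section Codes.
Variables (d : dom) (orders : seq (seq nat)).

Definition allowed (i j : nat) : seq nat :=
  [seq l <- iota 0 (nlab d) | att d i l && att d j l].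

Fixpoint bits (n : nat) (l : seq nat) : seq nat :=
  if l is x :: l' then (if odd n then [:: x] else [::]) ++ bits n./2 l' else [::].

Definition ends (o : seq nat) : seq (nat * nat) := zip o (rot 1 o).

Definition unpack (code : seq nat) : pattern :=
  let o := nth [::] orders (head 0 code) in
  (o, [seq (en.1, bits en.2 (allowed en.1.1 en.1.2)) | en <- zip (ends o) (behead code)]).

Definition restricted (Q : pred nat) (o : seq nat) : pattern :=
  (o, [seq (e, [seq l <- allowed e.1 e.2 | Q l]) | e <- ends o]).

End Codes.

Definition perm2 := (seq nat * seq nat)%type.

Definition permp (pi : perm2) (p : pattern) : pattern :=
  ([seq nth 0 pi.1 i | i <- p.1],
   [seq (nth 0 pi.1 a.1.1, nth 0 pi.1 a.1.2, [seq nth 0 pi.2 l | l <- a.2]) | a <- p.2]).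

Definition arc_covers (a' a : larc) : bool :=
  ((a'.1 == a.1) || (a'.1 == (a.1.2, a.1.1))) && all (mem a'.2) a.2.

Definition covers (p' p : pattern) : bool :=
  [&& size p'.2 == size p.2, perm_eq p'.1 p.1 &
  has (fun n => all2 arc_covers p'.2 (rot n p.2) || all2 arc_covers p'.2 (rot n (rev p.2)))
    (iota 0 (size p.2))].

(* A state consists of patterns of longest cycles and of labels [l] such that no longest
   cycle is confined to the side [l].  An entry is a state, a branching and, for each child,
   a reason for its impossibility: [E] for an immediate violation, [C i k] for core [i] under
   the permutation [k], [N i k] for an earlier entry [i].  [R r] branches over the ways to
   meet the requirement [r], and [B c k] over the labels of arc [k] in pattern [c]. *)
Inductive ref := E | C of nat & nat | N of nat & nat.
Inductive branch := R of nat | B of nat & nat.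

Definition state := (seq pattern * seq nat)%type.
Definition entry := (seq (seq nat) * seq nat * branch * seq ref)%type.

Definition wf_pattern (d : dom) (p : pattern) : bool :=
  all (fun i => i < nterm d) p.1
  && all (fun a => [&& a.1.1 < nterm d, a.1.2 < nterm d & all (fun l => l < nlab d) a.2]) p.2.

Definition wf_state (d : dom) (st : state) : bool :=
  all (wf_pattern d) st.1 && all (fun f => f < nlab d) st.2.

Definition perm_ok (d : dom) (pi : perm2) : bool :=
  [&& perm_eq pi.1 (iota 0 (nterm d)), perm_eq pi.2 (iota 0 (nlab d)) &
   all (fun i => all (fun l => att d (nth 0 pi.1 i) (nth 0 pi.2 l) == att d i l)
                   (iota 0 (nlab d))) (iota 0 (nterm d))].

Section LemmaChecker.
Variables (d : dom) (viol1 : seq nat -> pattern -> bool)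
  (reqs : seq (seq (option pattern * seq nat)))
  (perms lperms : seq perm2) (cores : seq (seq pattern)) (unp : seq nat -> pattern).

Definition share_label (p q : pattern) : bool :=
  has (fun a => has (fun a' => has (mem a.2) a'.2) q.2) p.2.

Definition viol2 (p q : pattern) : bool :=
  (count (mem q.1) p.1 <= 1) && ~~ share_label p q.

Definition viol (st : state) : bool :=
  has (viol1 st.2) st.1 || has (fun p => has (viol2 p) st.1) st.1.

Definition embeds (pi : perm2) (g : seq pattern) (st : seq pattern) : bool :=
  all (fun p => has (covers (permp pi p)) st) g.

Definition check_ref (prev : seq state) (st : state) (r : ref) : bool :=
  match r with
  | E => viol st
  | C i k => [&& i < size cores, k < size perms &
              embeds (nth ([::], [::]) perms k) (nth [::] cores i) st.1]
  | N i k => let g := nth ([::], [::]) prev i in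
             let pi := nth ([::], [::]) lperms k in
             [&& i < size prev, k < size lperms, embeds pi g.1 st.1 &
                 all (fun f => nth 0 pi.2 f \in st.2) g.2]
  end.

Definition relabel (ps : seq pattern) (c k : nat) (l : nat) : seq pattern :=
  let p := nth ([::], [::]) ps c in
  let a := nth (0, 0, [::]) p.2 k in
  set_nth ([::], [::]) ps c (p.1, set_nth (0, 0, [::]) p.2 k (a.1, [:: l])).

Definition children (st : state) (b : branch) : seq state :=
  match b with
  | R r => [seq (if o.1 is Some p then rcons st.1 p else st.1, st.2 ++ o.2)
           | o <- nth [::] reqs r]
  | B c k => [seq (relabel st.1 c k l, st.2)
             | l <- (nth (0, 0, [::]) (nth ([::], [::]) st.1 c).2 k).2]
  end.

Definition branch_ok (st : state) (b : branch) : bool :=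
  match b with
  | R r => r < size reqs
  | B c k => (c < size st.1) && (k < size (nth ([::], [::]) st.1 c).2)
  end.

Fixpoint check_entries (prev : seq state) (es : seq entry) : bool :=
  if es is ((codes, fl), b, rs) :: es' then
    let st := ([seq unp c | c <- codes], fl) in
    [&& wf_state d st, branch_ok st b, all2 (check_ref prev) (children st b) rs
      & check_entries (rcons prev st) es']
  else has (fun st => (st.1 == [::]) && (st.2 == [::])) prev.

End LemmaChecker.

Definition singles (p : pattern) : seq pattern :=
  [seq (p.1, [seq (al.1.1, [:: al.2]) | al <- zip p.2 ls])
  | ls <- foldr (fun a r => [seq l :: ls | l <- a.2, ls <- r]) [:: [::]] p.2].

(* The last label [z] is the outside; [fl] lists labels [l] such that no longest cycle
   is confined to the side [l]. *)
Section Problem.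
Variables (d : dom) (orders : seq (seq nat)) (expand : pattern -> seq pattern).
Let z := (nlab d).-1.

Definition confined (l : nat) (p : pattern) : bool :=
  all (fun a => all (pred1 l) a.2) p.2 && all (fun i => att d i l) p.1.

Definition viol_side (fl : seq nat) (p : pattern) : bool :=
  has (fun l => confined l p && ((l == z) && (size p.1 != 2) || (l \in fl)))
    (iota 0 (nlab d)).

Definition side_reqs : seq (seq (option pattern * seq nat)) :=
  [seq flatten [seq [seq (Some p, [::]) | p <- expand (restricted d predT o)]
               | o <- orders & v \notin o] | v <- iota 0 (nterm d)]
  ++ [seq flatten [seq [seq (Some p, if count (fun i => att d i w) o == 2 then [:: w] else [::])
                       | p <- expand (restricted d (predC1 w) o)] | o <- orders]
     | w <- iota 0 z]
  ++ [:: (None, [:: z]) :: flatten [seq [seq (Some p, [::])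
                                        | p <- expand (restricted d (predC1 z) o)]
                                   | o <- orders]].

End Problem.

(* [tri] has the vertices of a separating triangle as terminals and two parts of the
   complement and the rest as labels; [tetra] has the vertices of a [K_4], and the label of
   a vertex is the terminal from which the other three terminals separate it. *)
Definition tri : dom := Dom 3 3 (fun _ _ => true).
Definition tri_orders : seq (seq nat) := [:: [:: 0; 1]; [:: 0; 2]; [:: 1; 2]; [:: 0; 1; 2]].
Definition tetra : dom := Dom 4 4 (fun i l => i != l).
Definition tetra_orders : seq (seq nat) :=
  [:: [:: 0; 1]; [:: 0; 2]; [:: 0; 3]; [:: 1; 2]; [:: 1; 3]; [:: 2; 3];
      [:: 0; 1; 2]; [:: 0; 1; 3]; [:: 0; 2; 3]; [:: 1; 2; 3];
      [:: 0; 1; 2; 3]; [:: 0; 1; 3; 2]; [:: 0; 2; 1; 3]].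
Definition perms3 : seq (seq nat) :=
  [:: [:: 0; 1; 2]; [:: 0; 2; 1]; [:: 1; 0; 2]; [:: 1; 2; 0]; [:: 2; 0; 1]; [:: 2; 1; 0]].
Definition tri_perms : seq perm2 :=
  [seq (p, q) | p <- perms3, q <- [:: [:: 0; 1; 2]; [:: 1; 0; 2]]].

Definition tetra_lperms : seq perm2 := [seq (rcons p 3, rcons p 3) | p <- perms3].
Definition tetra_perms : seq perm2 :=
  [seq (p, p) | p <- [seq i :: [seq (if j < i then j else j.+1) | j <- q] | i <- iota 0 4, q <- perms3]].
Definition tri_core_table : seq (seq (seq nat) * ctree) := [::
   ([:: [:: 3; 6; 6; 6]; [:: 1; 1; 1]; [:: 2; 1; 1]], Leaf [:: (1, [:: 0; 1; 3]); (1, [:: 0; 5; 2]); (1, [:: 0; 1; 4]); (1, [:: 0; 6; 2])] [:: 2; 1; 1] [::]);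
   ([:: [:: 3; 4; 6; 6]; [:: 1; 1; 2]; [:: 2; 1; 1]], Leaf [:: (1, [:: 0; 1; 3]); (1, [:: 0; 5; 2]); (1, [:: 0; 6; 4])] [:: 1; 1; 1] [::]);
   ([:: [:: 0; 1; 2]; [:: 3; 7; 4; 7]; [:: 1; 1; 2]], Leaf [:: (1, [:: 1; 3; 5]); (1, [:: 0; 3; 6])] [:: 1; 0; 1] [::]);
   ([:: [:: 0; 1; 2]; [:: 1; 1; 2]; [:: 2; 7; 4]], Leaf [:: (1, [:: 1; 5; 2]); (1, [:: 0; 5; 3])] [:: 1; 1] [::]);
   ([:: [:: 0; 5; 2]; [:: 3; 5; 5; 5]; [:: 3; 2; 2; 2]; [:: 1; 5; 2]], Leaf [:: (1, [:: 5; 6; 8]); (1, [:: 0; 6; 7]); (1, [:: 2; 3; 9]); (1, [:: 1; 3; 4])] [:: 1; 1; 1; 1] [::]);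
   ([:: [:: 0; 1; 4]; [:: 3; 2; 2; 6]; [:: 1; 5; 2]; [:: 2; 7; 1]], Leaf [:: (1, [:: 2; 3; 5]); (1, [:: 0; 3; 4]); (1, [:: 1; 8; 6])] [:: 1; 1; 1] [::]);
   ([:: [:: 0; 3; 4]; [:: 3; 6; 4; 4]; [:: 1; 1; 2]; [:: 2; 7; 1]], Leaf [:: (1, [:: 2; 3; 5]); (1, [:: 0; 3; 4]); (1, [:: 1; 8; 6])] [:: 1; 1; 1] [::]);
   ([:: [:: 3; 2; 6; 6]; [:: 1; 1; 4]; [:: 2; 1; 1]], Leaf [:: (1, [:: 0; 1; 3]); (1, [:: 0; 5; 2]); (1, [:: 0; 6; 4])] [:: 1; 1; 1] [::]);
   ([:: [:: 0; 1; 4]; [:: 3; 7; 2; 7]; [:: 1; 1; 4]], Leaf [:: (1, [:: 1; 3; 5]); (1, [:: 0; 3; 6])] [:: 1; 0; 1] [::]);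
   ([:: [:: 0; 1; 4]; [:: 1; 1; 4]; [:: 2; 7; 2]], Leaf [:: (1, [:: 1; 5; 2]); (1, [:: 0; 5; 3])] [:: 1; 1] [::]);
   ([:: [:: 0; 2; 4]; [:: 1; 1; 4]; [:: 2; 1; 2]], Leaf [:: (1, [:: 1; 5; 2]); (1, [:: 0; 4; 3])] [:: 1; 1] [::]);
   ([:: [:: 0; 4; 4]; [:: 3; 3; 3; 2]; [:: 2; 1; 4]], Leaf [:: (1, [:: 1; 5; 4]); (1, [:: 0; 3; 4]); (1, [:: 2; 6; 4])] [:: 1; 1; 1] [::]);
   ([:: [:: 0; 4; 4]; [:: 3; 1; 3; 3]; [:: 1; 2; 4]; [:: 2; 7; 4]], Leaf [:: (1, [:: 2; 8; 5]); (1, [:: 0; 3; 4]); (1, [:: 2; 3; 6]); (1, [:: 1; 3; 4])] [:: 1; 2; 1] [::]);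
   ([:: [:: 0; 4; 4]; [:: 3; 3; 3; 3]; [:: 1; 4; 4]], Leaf [:: (1, [:: 2; 3; 5]); (1, [:: 0; 3; 4]); (1, [:: 2; 3; 6]); (1, [:: 1; 3; 4])] [:: 1; 2; 1] [::])].

Definition tri_entries : seq entry := [::
   ([:: [:: 2; 1; 1]; [:: 1; 1; 1]], [::], R 3, [:: E; E; E; E; E; E; E; E; E; E; E; E; C 0 0; C 0 0; C 0 0; C 0 0; C 0 0; C 0 0; C 0 0; E]);
   ([:: [:: 1; 1; 2]; [:: 0; 1; 2]; [:: 3; 2; 2; 2]], [::], R 4, [:: E; E; E; E; E; E; E; E; E; E; E; E; C 4 0; C 4 0; C 2 0; C 2 0; C 4 0; C 4 0; C 2 0; E]);
   ([:: [:: 2; 1; 1]; [:: 1; 1; 2]; [:: 0; 1; 2]], [::], R 3, [:: E; E; E; E; E; E; E; E; E; E; E; E; N 1 0; C 1 2; C 2 0; C 1 2; C 1 0; C 1 0; C 1 0; E]);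
   ([:: [:: 2; 1; 1]; [:: 1; 1; 2]; [:: 0; 1; 4]], [::], R 3, [:: E; E; E; E; E; E; E; E; E; E; E; E; C 5 0; C 5 0; C 7 2; C 6 0; C 1 0; C 1 0; C 1 0; E]);
   ([:: [:: 2; 1; 1]; [:: 1; 1; 2]], [::], R 2, [:: N 0 2; N 2 0; N 3 0; N 2 0; E; E; N 3 0; E; E]);
   ([:: [:: 2; 1; 1]; [:: 1; 1; 4]; [:: 0; 1; 4]], [::], R 3, [:: E; E; E; E; E; E; E; E; E; E; E; E; C 7 0; C 7 0; C 7 0; C 7 0; C 7 2; C 8 0; C 7 2; E]);
   ([:: [:: 2; 1; 1]; [:: 1; 1; 4]], [::], R 2, [:: N 0 2; N 3 2; N 5 0; N 3 2; E; E; N 5 0; E; E]);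
   ([:: [:: 2; 1; 1]], [::], R 1, [:: N 0 0; N 4 0; N 6 0; N 4 0; E; E; N 6 0; E; E]);
   ([:: [:: 2; 1; 2]; [:: 1; 1; 2]; [:: 0; 1; 2]], [::], R 3, [:: N 2 9; C 3 8; C 3 8; E; N 2 5; C 3 4; C 3 4; E; N 2 1; C 3 0; C 3 0; E; N 1 0; C 2 4; C 2 0; C 2 0; C 2 8; C 2 4; C 2 0; E]);
   ([:: [:: 2; 1; 2]; [:: 1; 1; 2]], [::], R 2, [:: N 2 8; N 8 0; C 3 8; N 8 0; N 2 9; C 3 8; C 3 8; C 3 8; E]);
   ([:: [:: 2; 1; 2]; [:: 1; 1; 4]], [::], R 2, [:: N 3 8; N 9 2; C 9 0; N 9 2; E; C 10 0; C 9 0; C 10 0; E]);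
   ([:: [:: 2; 1; 2]], [::], R 1, [:: N 4 4; N 9 0; N 10 0; N 9 0; N 4 5; N 10 1; N 10 0; N 10 1; E]);
   ([:: [:: 2; 1; 4]; [:: 1; 1; 4]; [:: 0; 1; 4]], [:: 2], R 3, [:: E; C 9 8; C 9 8; E; E; C 9 4; C 9 4; E; E; C 9 0; C 9 0; E; C 8 0; C 8 0; C 8 4; C 8 8; C 8 0; C 8 0; C 8 4; E]);
   ([:: [:: 2; 1; 4]; [:: 1; 1; 4]; [:: 0; 1; 4]; [:: 3; 1; 1; 1]], [::], R 3, [:: E; E; E; E; E; E; E; E; E; E; E; E; C 4 1; C 4 1; C 4 1; C 4 1; C 4 1; C 4 1; C 4 1; E]);
   ([:: [:: 2; 1; 4]; [:: 1; 1; 4]; [:: 0; 1; 4]], [::], R 5, [:: N 12 0; N 5 8; N 10 8; N 10 8; E; N 5 4; N 10 4; N 10 4; E; N 5 0; N 10 0; N 10 0; E; N 13 0; C 8 4; C 8 0; C 8 0; C 8 8; C 8 4; C 8 0; C 8 0]);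
   ([:: [:: 2; 1; 4]; [:: 1; 1; 4]; [:: 0; 4; 4]; [:: 3; 1; 1; 1]], [::], R 3, [:: E; E; E; E; E; E; E; E; E; E; E; E; C 4 9; C 4 9; C 4 9; C 4 9; C 4 9; C 4 9; C 4 9; E]);
   ([:: [:: 2; 1; 4]; [:: 1; 1; 4]; [:: 0; 4; 4]], [::], R 5, [:: E; N 5 8; N 10 8; N 10 8; E; E; E; E; E; E; E; E; E; N 15 0; C 11 0; C 11 4; C 11 0; C 8 8; C 8 8; C 8 8; C 8 8]);
   ([:: [:: 2; 1; 4]; [:: 1; 1; 4]], [::], R 2, [:: N 5 8; N 10 8; N 14 0; N 10 8; E; C 9 8; N 14 0; C 9 8; N 16 0]);
   ([:: [:: 2; 1; 4]; [:: 1; 2; 4]; [:: 0; 4; 4]], [::], R 5, [:: E; E; N 10 8; N 10 8; E; E; E; E; E; E; E; E; E; C 11 5; C 11 0; C 12 0; C 11 0; C 11 5; C 11 0; C 12 5; C 11 0]);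
   ([:: [:: 2; 1; 4]; [:: 1; 2; 4]], [::], R 2, [:: E; N 10 8; N 17 2; N 10 8; E; N 17 7; N 17 2; N 17 7; N 18 0]);
   ([:: [:: 2; 1; 4]; [:: 1; 4; 4]; [:: 0; 4; 4]], [::], R 5, [:: E; E; E; E; E; E; E; E; E; E; E; E; E; C 13 0; C 11 0; C 13 0; C 11 0; C 11 2; C 11 0; C 11 2; C 11 0]);
   ([:: [:: 2; 1; 4]; [:: 1; 4; 4]], [::], R 2, [:: E; E; N 16 2; E; E; N 18 2; N 16 2; N 18 2; N 20 0]);
   ([:: [:: 2; 1; 4]], [::], R 1, [:: N 6 4; N 10 4; N 17 0; N 10 4; E; N 19 0; N 17 0; N 19 0; N 21 0]);
   ([:: [:: 2; 4; 4]; [:: 1; 4; 4]], [::], R 5, [:: E; E; E; E; E; E; E; E; E; E; E; E; E; C 13 8; C 13 8; C 13 8; C 13 8; C 13 8; C 13 8; C 13 8; C 13 8]);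
   ([:: [:: 2; 4; 4]], [::], R 1, [:: E; E; N 21 4; E; E; N 21 5; N 21 4; N 21 5; N 23 0]);
   ([::], [::], R 0, [:: N 7 0; N 11 0; N 22 0; N 11 0; N 7 1; N 22 1; N 22 0; N 22 1; N 24 0])].

Definition tetra_core_table : seq (seq (seq nat) * ctree) := [::
   ([:: [:: 0; 1; 2]; [:: 6; 3; 1; 3]; [:: 8; 3; 2; 3]], Leaf [:: (1, [:: 1; 3; 6; 7]); (1, [:: 0; 3; 5])] [:: 1; 0; 1] [::]);
   ([:: [:: 0; 1; 2]; [:: 6; 3; 1; 3]; [:: 8; 3; 1; 3]], Cross 3 6 (Leaf [:: (1, [:: 1; 3; 6; 7]); (1, [:: 0; 3; 5])] [:: 1; 0; 1] [::]) (Leaf [:: (1, [:: 0; 10; 5]); (1, [:: 1; 11; 7])] [:: 1; 0; 1] [:: 0; 1]));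
   ([:: [:: 0; 1; 3]; [:: 1; 1; 3]; [:: 3; 1; 3]], Leaf [:: (1, [:: 0; 5; 2]); (1, [:: 0; 4; 3])] [:: 0; 1; 1] [::]);
   ([:: [:: 6; 1; 3; 3]; [:: 8; 3; 3; 1]; [:: 9; 2; 1; 1]], Leaf [:: (1, [:: 0; 8; 7; 3]); (1, [:: 0; 6; 4; 5])] [:: 0; 1; 1] [::]);
   ([:: [:: 0; 1; 2]; [:: 8; 1; 3; 3]; [:: 9; 3; 1; 3]], Leaf [:: (1, [:: 1; 7; 6; 2]); (1, [:: 0; 5; 2])] [:: 1; 0; 1] [::]);
   ([:: [:: 6; 1; 1; 2]; [:: 7; 2; 2; 3]; [:: 8; 3; 2; 3]], Leaf [:: (1, [:: 3; 1; 7; 8]); (1, [:: 2; 1; 4; 5]); (1, [:: 0; 1; 6])] [:: 1; 1; 1] [::]);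
   ([:: [:: 6; 1; 3; 2]; [:: 7; 3; 2; 3]; [:: 8; 3; 3; 1]], Cross 0 4 (Leaf [:: (1, [:: 2; 1; 4; 8]); (1, [:: 0; 4; 7; 6])] [:: 1; 0; 1] [::]) (Leaf [:: (1, [:: 2; 1; 10; 8]); (1, [:: 6; 7; 9])] [:: 1; 0; 1] [:: 1]));
   ([:: [:: 6; 1; 1; 3]; [:: 7; 3; 1; 3]; [:: 8; 3; 2; 2]], Cross 1 4 (Leaf [:: (1, [:: 2; 1; 4; 8]); (1, [:: 0; 4; 7; 6])] [:: 1; 0; 1] [::]) (Leaf [:: (1, [:: 0; 9; 7; 6]); (1, [:: 2; 10; 8])] [:: 1; 0; 1] [:: 1]));
   ([:: [:: 0; 1; 3]; [:: 1; 1; 3]; [:: 9; 1; 3; 3]], Leaf [:: (1, [:: 1; 4; 2]); (1, [:: 0; 4; 3])] [:: 1; 1] [::]);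
   ([:: [:: 6; 1; 3; 3]; [:: 8; 1; 1; 1]; [:: 8; 3; 3; 3]; [:: 9; 3; 3; 2]], Cross 0 11 (Leaf [:: (1, [:: 3; 1; 11; 5]); (1, [:: 0; 11; 4; 2])] [:: 1; 1] [::]) (Leaf [:: (1, [:: 3; 1; 13; 5]); (1, [:: 2; 4; 12])] [:: 1; 1] [:: 1]));
   ([:: [:: 0; 1; 2]; [:: 8; 1; 3; 3]; [:: 9; 2; 3; 3]], Cross 1 5 (Leaf [:: (1, [:: 1; 5; 3; 4]); (1, [:: 0; 5; 2])] [:: 1; 1] [::]) (Leaf [:: (1, [:: 0; 8; 2]); (1, [:: 9; 3; 4])] [:: 1; 1] [:: 1]));
   ([:: [:: 0; 1; 3]; [:: 1; 1; 2]; [:: 9; 3; 3; 1]], Leaf [:: (1, [:: 0; 4; 2]); (1, [:: 0; 6; 5; 3])] [:: 0; 1; 1] [::]);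
   ([:: [:: 6; 1; 1; 2]; [:: 7; 2; 2; 3]; [:: 8; 3; 1; 3]], Cross 1 7 (Leaf [:: (1, [:: 3; 1; 7; 8]); (1, [:: 2; 1; 4; 5]); (1, [:: 0; 1; 6])] [:: 1; 1; 1] [::]) (Leaf [:: (1, [:: 2; 11; 4; 5]); (1, [:: 0; 1; 6]); (1, [:: 3; 12; 8])] [:: 1; 1; 1] [:: 0; 1]));
   ([:: [:: 6; 1; 3; 3]; [:: 8; 2; 3; 1]; [:: 9; 2; 3; 1]], Leaf [:: (1, [:: 0; 8; 7; 3]); (1, [:: 0; 6; 4; 5])] [:: 0; 1; 1] [::]);
   ([:: [:: 0; 1; 3]; [:: 8; 2; 3; 1]; [:: 9; 2; 3; 1]], Leaf [:: (1, [:: 0; 7; 6; 2]); (1, [:: 0; 5; 3; 4])] [:: 0; 1; 1] [::]);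
   ([:: [:: 6; 1; 3; 2]; [:: 10; 3; 3; 3; 1]; [:: 9; 3; 1; 2]], Leaf [:: (1, [:: 0; 7; 8; 6]); (1, [:: 2; 1; 9; 6])] [:: 1; 0; 1] [::]);
   ([:: [:: 6; 1; 1; 3]; [:: 7; 3; 1; 2]; [:: 11; 1; 2; 2; 3]; [:: 8; 3; 1; 3]], Leaf [:: (1, [:: 3; 1; 8; 5]); (1, [:: 0; 4; 8; 9]); (1, [:: 6; 7; 11; 2])] [:: 1; 1; 1] [::]);
   ([:: [:: 0; 1; 3]; [:: 12; 3; 3; 1; 1]; [:: 8; 3; 2; 2]], Leaf [:: (1, [:: 0; 4; 7; 6]); (1, [:: 2; 3; 4; 8]); (1, [:: 1; 4; 5])] [:: 1; 1; 1] [::]);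
   ([:: [:: 6; 3; 3; 2]; [:: 10; 3; 2; 2; 1]; [:: 9; 1; 1; 3]], Leaf [:: (1, [:: 2; 7; 9; 6]); (1, [:: 3; 4; 8; 6]); (1, [:: 0; 1; 5; 6])] [:: 1; 1; 1] [::]);
   ([:: [:: 6; 3; 3; 2]; [:: 7; 1; 3; 2]; [:: 11; 2; 1; 2; 3]], Leaf [:: (1, [:: 3; 1; 8; 5]); (1, [:: 0; 7; 8; 2]); (1, [:: 6; 4; 8; 9])] [:: 1; 1; 1] [::]);
   ([:: [:: 0; 1; 3]; [:: 10; 2; 1; 3; 1]; [:: 8; 3; 2; 3]], Leaf [:: (1, [:: 0; 3; 6]); (1, [:: 1; 3; 4; 5]); (1, [:: 2; 3; 7; 8])] [:: 1; 1; 1] [::]);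
   ([:: [:: 6; 1; 1; 3]; [:: 11; 3; 2; 3; 3]; [:: 8; 3; 1; 1]], Cross 0 4 (Leaf [:: (1, [:: 7; 1; 4; 9]); (1, [:: 0; 4; 8; 2])] [:: 1; 0; 1] [::]) (Leaf [:: (1, [:: 7; 1; 11; 9]); (1, [:: 2; 8; 10])] [:: 1; 0; 1] [:: 1]));
   ([:: [:: 6; 1; 1; 3]; [:: 11; 3; 1; 3; 3]; [:: 8; 3; 2; 2]], Cross 1 4 (Leaf [:: (1, [:: 0; 4; 8; 7]); (1, [:: 2; 1; 4; 9])] [:: 1; 0; 1] [::]) (Leaf [:: (1, [:: 0; 10; 8; 7]); (1, [:: 2; 11; 9])] [:: 1; 0; 1] [:: 1]));
   ([:: [:: 0; 1; 1]; [:: 6; 2; 1; 3]; [:: 8; 3; 2; 3]], Leaf [:: (1, [:: 2; 3; 6; 7]); (1, [:: 0; 3; 4]); (1, [:: 1; 3; 5])] [:: 1; 1; 1] [::]);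
   ([:: [:: 0; 1; 1]; [:: 10; 2; 3; 3; 1]; [:: 9; 3; 1; 3]], Leaf [:: (1, [:: 0; 3; 4; 5]); (1, [:: 1; 6; 7; 5]); (1, [:: 2; 8; 5])] [:: 1; 1; 1] [::]);
   ([:: [:: 0; 1; 3]; [:: 7; 2; 1; 1]; [:: 8; 3; 2; 3]], Leaf [:: (1, [:: 0; 3; 6; 5]); (1, [:: 2; 3; 7]); (1, [:: 1; 3; 4])] [:: 1; 1; 1] [::]);
   ([:: [:: 0; 1; 2]; [:: 10; 3; 1; 3; 3]; [:: 8; 3; 2; 3]], Leaf [:: (1, [:: 0; 3; 6]); (1, [:: 1; 3; 7; 8])] [:: 1; 0; 1] [::]);
   ([:: [:: 6; 1; 3; 3]; [:: 10; 2; 2; 2; 1]; [:: 8; 2; 3; 3]; [:: 9; 3; 3; 2]], Cross 0 12 (Leaf [:: (1, [:: 0; 12; 11; 7]); (1, [:: 0; 10; 5; 6]); (1, [:: 3; 4; 8; 9])] [:: 0; 1; 1; 1] [::]) (Leaf [:: (1, [:: 16; 10; 5; 6]); (1, [:: 3; 4; 11; 15])] [:: 0; 1; 0; 1] [:: 0; 1]));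
   ([:: [:: 0; 1; 1]; [:: 12; 3; 2; 1; 1]; [:: 8; 1; 1; 3]], Leaf [:: (1, [:: 6; 3; 4; 8]); (1, [:: 0; 3; 2]); (1, [:: 1; 3; 7; 5])] [:: 1; 1; 1] [::]);
   ([:: [:: 0; 1; 1]; [:: 6; 2; 1; 2]; [:: 9; 2; 3; 3]], Cross 4 5 (Leaf [:: (1, [:: 2; 7; 6; 4]); (1, [:: 0; 3; 4]); (1, [:: 1; 5; 4])] [:: 1; 1; 1] [::]) (Leaf [:: (1, [:: 2; 7; 6; 4]); (1, [:: 0; 3; 11]); (1, [:: 1; 10])] [:: 1; 1; 1] [:: 0; 1]));
   ([:: [:: 6; 1; 3; 3]; [:: 10; 2; 3; 1; 1]; [:: 7; 1; 2; 2]; [:: 8; 3; 3; 3]], Leaf [:: (1, [:: 7; 8; 11; 10]); (1, [:: 7; 4; 5; 9]); (1, [:: 0; 4; 5; 6]); (1, [:: 3; 4; 5; 12]); (1, [:: 2; 1; 8; 9])] [:: 1; 1; 2; 1] [::]);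
   ([:: [:: 6; 1; 3; 3]; [:: 12; 3; 2; 2; 2]; [:: 9; 3; 3; 1]], Cross 0 6 (Leaf [:: (1, [:: 0; 7; 8; 6]); (1, [:: 3; 4; 9; 6]); (1, [:: 2; 1; 5; 6])] [:: 1; 1; 1] [::]) (Leaf [:: (1, [:: 2; 1; 5; 6]); (1, [:: 3; 4; 9; 10]); (1, [:: 7; 8; 11])] [:: 1; 1; 1] [:: 1]));
   ([:: [:: 0; 1; 1]; [:: 10; 2; 2; 3; 1]; [:: 8; 2; 3; 3]], Cross 3 6 (Leaf [:: (1, [:: 0; 3; 4; 5]); (1, [:: 1; 3; 6]); (1, [:: 2; 3; 7; 8])] [:: 1; 1; 1] [::]) (Leaf [:: (1, [:: 0; 12; 4; 5]); (1, [:: 2; 3; 7; 8]); (1, [:: 1; 11])] [:: 1; 1; 1] [:: 0; 1]));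
   ([:: [:: 0; 1; 2]; [:: 10; 1; 1; 3; 3]; [:: 1; 3; 3]], Leaf [:: (1, [:: 2; 3; 6]); (1, [:: 0; 3; 7]); (1, [:: 1; 3; 4; 5])] [:: 1; 1; 1] [::]);
   ([:: [:: 6; 1; 3; 3]; [:: 8; 3; 3; 1]; [:: 9; 3; 1; 2]], Cross 0 8 (Leaf [:: (1, [:: 0; 8; 4; 3]); (1, [:: 0; 6; 7; 5])] [:: 0; 1; 1] [::]) (Leaf [:: (1, [:: 12; 6; 7; 5]); (1, [:: 3; 4; 11])] [:: 0; 1; 1] [:: 0; 1]));
   ([:: [:: 0; 1; 1]; [:: 6; 2; 1; 3]; [:: 8; 3; 1; 3]], Cross 3 6 (Leaf [:: (1, [:: 2; 3; 6; 7]); (1, [:: 0; 3; 4]); (1, [:: 1; 3; 5])] [:: 1; 1; 1] [::]) (Leaf [:: (1, [:: 0; 10; 4]); (1, [:: 0; 3; 5]); (1, [:: 1; 10; 5]); (1, [:: 1; 3; 4]); (2, [:: 2; 11; 7])] [:: 2; 2; 2] [:: 0; 2]));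
   ([:: [:: 6; 1; 3; 3]; [:: 10; 2; 2; 3; 1]; [:: 7; 2; 2; 2]; [:: 8; 2; 3; 3]], Cross 0 8 (Leaf [:: (1, [:: 0; 8; 5; 10]); (1, [:: 3; 4; 11; 12]); (1, [:: 2; 1; 8; 9]); (1, [:: 7; 8; 6])] [:: 1; 1; 1; 1] [::]) (Leaf [:: (1, [:: 2; 1; 8; 9]); (1, [:: 3; 4; 5; 13]); (1, [:: 7; 14; 6])] [:: 1; 1; 1] [:: 1]));
   ([:: [:: 0; 1; 3]; [:: 12; 3; 2; 1; 1]; [:: 9; 3; 2; 3]], Cross 5 7 (Leaf [:: (1, [:: 0; 6; 7; 5]); (1, [:: 2; 3; 8; 5]); (1, [:: 1; 4; 5])] [:: 1; 1; 1] [::]) (Leaf [:: (1, [:: 0; 6; 11]); (1, [:: 1; 4; 12]); (1, [:: 2; 3; 8; 5])] [:: 1; 1; 1] [:: 0; 1]));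
   ([:: [:: 0; 1; 3]; [:: 10; 2; 1; 3; 1]; [:: 8; 3; 1; 3]], Cross 3 7 (Leaf [:: (1, [:: 0; 3; 6]); (1, [:: 1; 3; 4; 5]); (1, [:: 2; 3; 7; 8])] [:: 1; 1; 1] [::]) (Leaf [:: (1, [:: 0; 11; 6]); (1, [:: 1; 3; 4; 5]); (1, [:: 2; 12; 8])] [:: 1; 1; 1] [:: 0; 1]));
   ([:: [:: 0; 1; 1]; [:: 10; 2; 3; 3; 1]; [:: 9; 3; 2; 3]], Cross 5 7 (Leaf [:: (1, [:: 0; 3; 4; 5]); (1, [:: 1; 6; 7; 5]); (1, [:: 2; 8; 5])] [:: 1; 1; 1] [::]) (Leaf [:: (1, [:: 0; 3; 4; 5]); (1, [:: 1; 6; 11]); (1, [:: 2; 8; 12])] [:: 1; 1; 1] [:: 0; 1]));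
   ([:: [:: 0; 1; 3]; [:: 7; 2; 1; 1]; [:: 8; 3; 1; 3]], Cross 3 6 (Leaf [:: (1, [:: 0; 3; 6; 5]); (1, [:: 2; 3; 7]); (1, [:: 1; 3; 4])] [:: 1; 1; 1] [::]) (Leaf [:: (1, [:: 0; 10; 5]); (1, [:: 1; 3; 4]); (1, [:: 2; 11; 7])] [:: 1; 1; 1] [:: 0; 1]));
   ([:: [:: 0; 1; 2]; [:: 10; 3; 1; 3; 3]; [:: 8; 3; 1; 3]], Cross 3 7 (Leaf [:: (1, [:: 0; 3; 6]); (1, [:: 1; 3; 7; 8])] [:: 1; 0; 1] [::]) (Leaf [:: (1, [:: 0; 11; 6]); (1, [:: 1; 12; 8])] [:: 1; 0; 1] [:: 0; 1]));
   ([:: [:: 0; 1; 3]; [:: 1; 1; 2]; [:: 9; 3; 3; 2]], Cross 0 6 (Leaf [:: (1, [:: 0; 4; 2]); (1, [:: 0; 6; 5; 3])] [:: 0; 1; 1] [::]) (Leaf [:: (1, [:: 10; 4; 2]); (1, [:: 3; 5; 9])] [:: 0; 1; 1] [:: 0; 1]));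
   ([:: [:: 6; 1; 1; 1]; [:: 7; 3; 1; 1]; [:: 8; 3; 1; 2]; [:: 9; 2; 3; 3]], Leaf [:: (1, [:: 2; 9; 4; 8]); (1, [:: 0; 9; 7; 5]); (1, [:: 3; 1; 2]); (1, [:: 0; 1; 6])] [:: 2; 1; 1] [::]);
   ([:: [:: 0; 1; 3]; [:: 12; 1; 2; 1; 1]; [:: 8; 3; 1; 3]], Cross 4 7 (Leaf [:: (1, [:: 0; 3; 7; 5]); (1, [:: 1; 4; 7; 2])] [:: 1; 1] [::]) (Leaf [:: (1, [:: 0; 3; 10; 5]); (1, [:: 1; 9; 2])] [:: 1; 1] [:: 1]));
   ([:: [:: 0; 1; 1]; [:: 10; 2; 3; 3; 1]; [:: 4; 3; 3]], Leaf [:: (1, [:: 0; 3; 4; 5]); (1, [:: 2; 6; 5]); (1, [:: 1; 3; 4; 5]); (1, [:: 2; 7; 5])] [:: 1; 2; 1] [::]);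
   ([:: [:: 0; 1; 1]; [:: 10; 2; 3; 3; 1]; [:: 2; 2; 2]], Leaf [:: (1, [:: 2; 3; 4; 6]); (1, [:: 0; 3; 4; 5]); (1, [:: 2; 3; 4; 7]); (1, [:: 1; 3; 4; 5])] [:: 1; 2; 1] [::]);
   ([:: [:: 0; 3; 3]; [:: 6; 1; 1; 1]; [:: 1; 3; 3]], Leaf [:: (1, [:: 2; 3; 5]); (1, [:: 0; 3; 4]); (1, [:: 2; 3; 6]); (1, [:: 1; 3; 4])] [:: 1; 2; 1] [::]);
   ([:: [:: 0; 1; 1]; [:: 10; 2; 3; 2; 1]; [:: 2; 1; 2]], Cross 4 6 (Leaf [:: (1, [:: 1; 3; 4; 6]); (1, [:: 0; 3; 4; 5]); (1, [:: 2; 3; 4; 7])] [:: 1; 1; 1] [::]) (Leaf [:: (1, [:: 2; 3; 11; 7]); (1, [:: 0; 3; 10]); (1, [:: 1; 3; 4; 5])] [:: 1; 1; 1] [:: 0; 1]));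
   ([:: [:: 0; 1; 1]; [:: 10; 2; 3; 1; 1]; [:: 2; 3; 3]], Leaf [:: (1, [:: 2; 3; 4; 6]); (1, [:: 0; 3; 4; 5]); (1, [:: 2; 3; 4; 7]); (1, [:: 1; 3; 4; 5])] [:: 1; 2; 1] [::]);
   ([:: [:: 6; 3; 3; 3]; [:: 7; 1; 2; 2]; [:: 8; 3; 2; 1]], Leaf [:: (1, [:: 3; 4; 7; 6]); (1, [:: 2; 1; 4; 5]); (1, [:: 0; 1; 7; 8])] [:: 1; 1; 1] [::]);
   ([:: [:: 6; 1; 1; 1]; [:: 6; 2; 2; 2]; [:: 7; 3; 3; 3]; [:: 8; 3; 3; 3]], Leaf [:: (1, [:: 5; 4; 7; 8]); (1, [:: 3; 4; 10; 11]); (1, [:: 0; 1; 9]); (1, [:: 6; 1; 2])] [:: 1; 1; 1; 1] [::]);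
   ([:: [:: 6; 1; 1; 1]; [:: 10; 2; 2; 3; 1]; [:: 7; 3; 3; 2]; [:: 8; 3; 3; 3]], Leaf [:: (1, [:: 0; 4; 5; 6]); (1, [:: 0; 1; 10]); (1, [:: 7; 1; 2]); (1, [:: 2; 4; 8; 9]); (1, [:: 3; 4; 11; 12])] [:: 2; 1; 1; 1] [::]);
   ([:: [:: 6; 1; 3; 3]; [:: 10; 3; 2; 2; 2]; [:: 9; 1; 3; 1]], Cross 0 6 (Leaf [:: (1, [:: 2; 7; 9; 6]); (1, [:: 3; 4; 8; 6]); (1, [:: 0; 1; 5; 6])] [:: 1; 1; 1] [::]) (Leaf [:: (1, [:: 2; 7; 9; 10]); (1, [:: 3; 4; 8; 6]); (1, [:: 1; 5; 11])] [:: 1; 1; 1] [:: 1]));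
   ([:: [:: 0; 3; 3]; [:: 10; 1; 1; 3; 1]; [:: 1; 3; 3]], Leaf [:: (1, [:: 0; 3; 4; 5]); (1, [:: 2; 3; 6]); (1, [:: 1; 3; 4; 5]); (1, [:: 2; 3; 7])] [:: 1; 2; 1] [::]);
   ([:: [:: 0; 1; 3]; [:: 12; 1; 3; 1; 1]; [:: 9; 3; 2; 3]], Cross 5 7 (Leaf [:: (1, [:: 0; 3; 7; 5]); (1, [:: 2; 6; 8; 5]); (1, [:: 1; 4; 5])] [:: 1; 1; 1] [::]) (Leaf [:: (1, [:: 2; 6; 8; 5]); (1, [:: 1; 4; 12]); (1, [:: 0; 3; 11])] [:: 1; 1; 1] [:: 0; 1]));
   ([:: [:: 0; 1; 1]; [:: 6; 2; 2; 2]; [:: 8; 2; 3; 2]], Cross 3 5 (Leaf [:: (1, [:: 2; 3; 6; 7]); (1, [:: 0; 3; 4]); (1, [:: 1; 3; 5])] [:: 1; 1; 1] [::]) (Cross 0 7 (Leaf [:: (1, [:: 0; 11; 6; 7]); (1, [:: 1; 10])] [:: 1; 0; 1] [:: 0; 1]) (Leaf [:: (1, [:: 2; 13; 6; 4]); (1, [:: 2; 3; 6; 12]); (1, [:: 1; 3; 4])] [:: 1; 2] [:: 0; 0; 1])))].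

Definition tetra_entries : seq entry := [::
   ([:: [:: 3; 1; 1]; [:: 5; 1; 3]; [:: 11; 1; 2; 2; 1]], [::], B 1 1, [:: C 45 22; C 33 17]);
   ([:: [:: 3; 1; 1]; [:: 5; 2; 3]; [:: 11; 1; 2; 2; 1]], [::], B 1 1, [:: N 0 0; E]);
   ([:: [:: 3; 1; 1]; [:: 5; 3; 3]; [:: 11; 1; 2; 2; 1]], [::], B 1 0, [:: N 0 0; N 1 0]);
   ([:: [:: 3; 1; 1]; [:: 5; 3; 3]; [:: 11; 1; 2; 2; 3]], [::], B 2 3, [:: N 2 0; C 54 17]);
   ([:: [:: 3; 1; 1]; [:: 5; 3; 3]; [:: 4; 3; 3]; [:: 11; 3; 2; 2; 3]], [::], B 3 0, [:: N 3 0; C 54 11]);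
   ([:: [:: 3; 1; 1]; [:: 5; 3; 3]; [:: 4; 3; 3]], [::], R 4, [:: E; E; E; E; E; E; E; E; E; C 47 9; C 45 14; N 4 0; C 45 8]);
   ([:: [:: 3; 1; 1]; [:: 5; 3; 3]; [:: 7; 3; 1; 1]; [:: 11; 3; 2; 2; 3]], [::], B 3 0, [:: N 3 0; C 37 14]);
   ([:: [:: 3; 1; 1]; [:: 5; 3; 3]; [:: 7; 3; 1; 1]], [::], R 4, [:: E; E; E; E; E; E; E; E; E; C 40 8; C 39 14; N 6 0; C 45 8]);
   ([:: [:: 3; 1; 1]; [:: 5; 3; 3]; [:: 7; 3; 1; 2]], [::], R 4, [:: E; E; E; E; E; E; E; E; E; C 25 8; C 24 14; C 17 8; C 45 8]);
   ([:: [:: 3; 1; 1]; [:: 5; 3; 3]; [:: 7; 3; 1; 3]], [::], B 2 2, [:: N 7 0; N 8 0]);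
   ([:: [:: 3; 1; 1]; [:: 5; 3; 3]; [:: 7; 3; 3; 3]], [::], B 2 1, [:: N 9 0; E]);
   ([:: [:: 3; 1; 1]; [:: 5; 3; 3]], [::], R 2, [:: E; E; N 5 0; N 10 0]);
   ([:: [:: 3; 1; 1]; [:: 8; 3; 1; 3]; [:: 9; 2; 2; 2]], [::], B 1 2, [:: C 25 14; C 40 14]);
   ([:: [:: 3; 1; 1]; [:: 7; 3; 1; 3]; [:: 10; 3; 2; 2; 3]], [::], B 1 2, [:: C 39 14; C 24 14]);
   ([:: [:: 3; 1; 1]; [:: 8; 3; 1; 2]; [:: 7; 3; 1; 1]; [:: 11; 3; 2; 2; 3]], [::], B 3 0, [:: C 55 8; C 37 14]);
   ([:: [:: 3; 1; 1]; [:: 8; 3; 1; 2]; [:: 7; 3; 1; 3]; [:: 11; 3; 2; 2; 3]], [::], B 2 2, [:: N 14 0; C 17 8]);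
   ([:: [:: 3; 1; 1]; [:: 8; 3; 1; 3]; [:: 7; 3; 1; 3]; [:: 11; 3; 2; 2; 3]], [::], B 1 2, [:: C 17 14; N 15 0]);
   ([:: [:: 3; 1; 1]; [:: 8; 3; 1; 3]; [:: 7; 3; 1; 3]], [::], R 4, [:: E; E; E; E; E; E; E; E; E; N 12 0; N 13 0; N 16 0; N 13 1]);
   ([:: [:: 3; 1; 1]; [:: 8; 3; 1; 3]; [:: 7; 3; 3; 3]], [::], B 2 1, [:: N 17 0; E]);
   ([:: [:: 3; 1; 1]; [:: 8; 3; 1; 3]], [::], R 2, [:: E; E; N 9 1; N 18 0]);
   ([:: [:: 3; 1; 1]; [:: 8; 3; 3; 3]], [::], B 1 1, [:: N 19 0; E]);
   ([:: [:: 3; 1; 1]], [::], R 1, [:: E; E; N 11 0; N 20 0]);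
   ([:: [:: 3; 1; 2]; [:: 1; 1; 2]; [:: 0; 2; 2]], [::], R 7, [:: E; E; E; E; E; E; E; C 47 0; C 8 12; E; E; C 33 14; C 33 12; C 33 2]);
   ([:: [:: 3; 1; 2]; [:: 1; 1; 2]; [:: 0; 2; 3]], [::], B 2 1, [:: C 2 0; N 22 0]);
   ([:: [:: 3; 1; 2]; [:: 1; 1; 2]; [:: 0; 3; 3]], [::], B 2 0, [:: C 2 0; N 23 0]);
   ([:: [:: 3; 1; 2]; [:: 1; 1; 2]; [:: 7; 3; 3; 3]], [::], B 2 1, [:: C 42 14; C 11 14]);
   ([:: [:: 3; 1; 2]; [:: 1; 1; 2]], [::], R 2, [:: N 24 0; E; E; N 25 0]);
   ([:: [:: 3; 1; 2]; [:: 1; 1; 3]], [::], B 1 1, [:: E; N 26 0]);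
   ([:: [:: 3; 1; 2]; [:: 8; 1; 1; 2]; [:: 0; 2; 3]], [::], B 2 1, [:: N 25 1; E]);
   ([:: [:: 3; 1; 2]; [:: 8; 1; 1; 2]; [:: 0; 3; 3]], [::], B 2 0, [:: N 27 1; N 28 0]);
   ([:: [:: 3; 1; 2]; [:: 8; 1; 1; 3]; [:: 0; 3; 3]], [::], B 1 2, [:: E; N 29 0]);
   ([:: [:: 3; 1; 2]; [:: 1; 2; 2]; [:: 8; 1; 1; 3]; [:: 7; 3; 3; 3]], [::], B 3 0, [:: E; C 10 14]);
   ([:: [:: 3; 1; 2]; [:: 1; 2; 2]; [:: 8; 1; 1; 3]], [::], R 2, [:: N 30 0; E; E; N 31 0]);
   ([:: [:: 3; 1; 2]; [:: 1; 2; 2]; [:: 8; 1; 3; 3]], [::], B 2 1, [:: N 32 0; E]);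
   ([:: [:: 3; 1; 2]; [:: 1; 2; 2]; [:: 12; 1; 1; 3; 3]], [::], B 2 2, [:: C 48 13; C 49 13]);
   ([:: [:: 3; 1; 2]; [:: 1; 2; 2]], [::], R 7, [:: E; E; E; E; E; E; E; C 47 12; E; N 33 0; E; C 33 14; C 45 3; N 34 0]);
   ([:: [:: 3; 1; 2]; [:: 1; 2; 3]], [::], B 1 1, [:: N 26 0; N 35 0]);
   ([:: [:: 3; 1; 2]; [:: 1; 3; 3]], [::], B 1 0, [:: N 27 0; N 36 0]);
   ([:: [:: 3; 1; 2]; [:: 5; 1; 1]; [:: 10; 3; 2; 2; 3]], [::], B 2 0, [:: C 49 16; C 48 16]);
   ([:: [:: 3; 1; 2]; [:: 5; 1; 1]], [::], R 4, [:: E; E; E; E; E; E; E; E; E; C 47 15; N 38 0; C 45 22; C 33 15]);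
   ([:: [:: 3; 1; 2]; [:: 5; 1; 2]; [:: 4; 1; 3]], [::], B 2 1, [:: N 39 1; C 2 9]);
   ([:: [:: 3; 1; 2]; [:: 5; 1; 2]; [:: 4; 3; 3]], [::], B 2 0, [:: N 40 0; C 2 9]);
   ([:: [:: 3; 1; 2]; [:: 5; 1; 2]; [:: 7; 3; 3; 3]], [::], B 2 0, [:: C 11 15; C 42 15]);
   ([:: [:: 3; 1; 2]; [:: 5; 1; 2]], [::], R 2, [:: E; E; N 41 0; N 42 0]);
   ([:: [:: 3; 1; 2]; [:: 5; 1; 3]], [::], B 1 1, [:: N 39 0; N 43 0]);
   ([:: [:: 3; 1; 2]; [:: 5; 2; 3]], [::], B 1 1, [:: N 43 0; E]);
   ([:: [:: 3; 1; 2]; [:: 5; 3; 3]], [::], B 1 0, [:: N 44 0; N 45 0]);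
   ([:: [:: 3; 1; 2]; [:: 8; 1; 1; 3]; [:: 7; 1; 3; 3]], [::], B 2 1, [:: C 14 9; E]);
   ([:: [:: 3; 1; 2]; [:: 8; 1; 1; 3]; [:: 7; 3; 3; 3]], [::], B 2 0, [:: N 47 0; C 10 14]);
   ([:: [:: 3; 1; 2]; [:: 8; 1; 3; 3]; [:: 7; 3; 3; 3]], [::], B 1 1, [:: N 48 0; E]);
   ([:: [:: 7; 2; 1; 3]; [:: 3; 2; 2]; [:: 9; 1; 1; 3]], [:: 0], B 2 2, [:: E; C 29 15]);
   ([:: [:: 8; 2; 1; 1]; [:: 7; 2; 1; 3]; [:: 3; 2; 2]; [:: 9; 1; 3; 3]], [:: 0], B 3 1, [:: N 50 0; C 12 22]);
   ([:: [:: 7; 2; 1; 3]; [:: 3; 2; 2]; [:: 12; 1; 1; 3; 3]], [::], B 0 2, [:: C 39 15; C 24 15]);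
   ([:: [:: 3; 1; 2]; [:: 8; 2; 1; 1]; [:: 7; 2; 1; 3]; [:: 3; 2; 2]], [:: 0], R 7, [:: E; E; E; E; E; E; E; C 0 14; E; E; N 51 0; N 52 1; C 17 15; N 52 0]);
   ([:: [:: 8; 2; 1; 1]; [:: 7; 2; 1; 3]; [:: 6; 2; 2; 3]], [::], B 2 2, [:: C 9 10; E]);
   ([:: [:: 3; 1; 2]; [:: 8; 2; 1; 1]; [:: 7; 2; 1; 3]; [:: 6; 3; 2; 3]], [::], B 3 0, [:: C 0 14; N 54 0]);
   ([:: [:: 3; 1; 2]; [:: 7; 2; 1; 3]; [:: 10; 3; 2; 2; 3]], [::], B 1 2, [:: C 41 9; C 26 9]);
   ([:: [:: 3; 1; 2]; [:: 8; 2; 1; 1]; [:: 7; 2; 1; 3]], [::], R 4, [:: N 37 1; N 37 0; E; N 53 0; E; E; N 55 0; C 4 9; C 10 15; C 0 15; N 56 0; C 17 14; N 56 1]);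
   ([:: [:: 3; 1; 2]; [:: 7; 2; 1; 1]; [:: 3; 2; 2]; [:: 9; 1; 3; 3]], [:: 0], B 3 1, [:: N 50 0; C 1 9]);
   ([:: [:: 3; 1; 2]; [:: 8; 2; 1; 2]; [:: 7; 2; 1; 1]; [:: 11; 1; 3; 3; 1]], [::], B 3 1, [:: C 37 15; C 55 9]);
   ([:: [:: 3; 1; 2]; [:: 8; 2; 1; 2]; [:: 7; 2; 1; 1]; [:: 3; 2; 2]], [:: 0], R 7, [:: E; E; E; E; E; E; E; C 1 8; E; E; N 58 0; N 52 1; N 59 0; N 52 0]);
   ([:: [:: 3; 1; 2]; [:: 7; 2; 1; 1]; [:: 6; 2; 2; 3]], [::], B 2 2, [:: C 1 8; E]);
   ([:: [:: 3; 1; 2]; [:: 8; 2; 1; 2]; [:: 7; 2; 1; 1]; [:: 6; 3; 2; 3]], [::], B 3 0, [:: C 1 14; N 61 0]);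
   ([:: [:: 3; 1; 2]; [:: 8; 2; 1; 2]; [:: 7; 2; 1; 1]; [:: 11; 3; 2; 2; 3]], [::], B 3 0, [:: C 55 8; C 37 14]);
   ([:: [:: 3; 1; 2]; [:: 8; 2; 1; 2]; [:: 7; 2; 1; 1]], [::], R 4, [:: N 37 1; N 37 0; E; N 60 0; E; E; N 62 0; C 10 9; C 10 15; C 1 9; N 56 0; N 63 0; N 56 1]);
   ([:: [:: 3; 1; 2]; [:: 8; 2; 1; 2]; [:: 7; 2; 1; 3]], [::], B 2 2, [:: N 64 0; N 57 1]);
   ([:: [:: 3; 1; 2]; [:: 8; 2; 1; 3]; [:: 7; 2; 1; 3]], [::], B 1 2, [:: N 57 0; N 65 0]);
   ([:: [:: 3; 1; 2]; [:: 8; 2; 1; 3]; [:: 7; 2; 3; 3]], [::], B 2 1, [:: N 66 0; C 10 9]);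
   ([:: [:: 3; 1; 2]; [:: 8; 2; 2; 3]; [:: 7; 2; 3; 3]], [::], B 2 1, [:: N 67 1; C 14 8]);
   ([:: [:: 3; 1; 2]; [:: 8; 2; 3; 3]; [:: 7; 2; 3; 3]], [::], B 1 1, [:: N 67 0; N 68 0]);
   ([:: [:: 3; 1; 2]; [:: 8; 2; 3; 3]; [:: 7; 3; 3; 3]], [::], B 2 0, [:: N 49 1; N 69 0]);
   ([:: [:: 3; 1; 2]; [:: 8; 3; 3; 3]; [:: 7; 3; 3; 3]], [::], B 1 0, [:: N 49 0; N 70 0]);
   ([:: [:: 3; 1; 2]; [:: 8; 3; 3; 3]], [::], R 2, [:: N 37 1; E; N 46 1; N 71 0]);
   ([:: [:: 3; 1; 2]], [::], R 1, [:: N 37 0; E; N 46 0; N 72 0]);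
   ([:: [:: 3; 1; 3]], [::], B 0 1, [:: N 21 0; N 73 0]);
   ([:: [:: 3; 2; 2]; [:: 1; 2; 2]], [::], R 7, [:: E; E; E; E; E; E; E; C 47 12; E; E; E; C 45 9; C 45 3; C 46 13]);
   ([:: [:: 3; 2; 2]; [:: 1; 2; 3]], [::], B 1 1, [:: N 35 2; N 75 0]);
   ([:: [:: 3; 2; 2]; [:: 1; 3; 3]], [::], B 1 0, [:: N 74 2; N 76 0]);
   ([:: [:: 3; 2; 2]; [:: 8; 2; 3; 3]; [:: 6; 1; 1; 1]], [::], B 1 2, [:: C 25 15; C 40 15]);
   ([:: [:: 3; 2; 2]; [:: 7; 2; 1; 3]; [:: 9; 1; 1; 3]], [::], B 2 2, [:: C 56 9; C 29 15]);
   ([:: [:: 3; 2; 2]; [:: 7; 2; 1; 3]; [:: 9; 1; 2; 3]], [::], B 1 2, [:: C 35 9; C 23 9]);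
   ([:: [:: 3; 2; 2]; [:: 7; 2; 1; 3]; [:: 9; 1; 3; 3]], [::], B 2 1, [:: N 79 0; N 80 0]);
   ([:: [:: 3; 2; 2]; [:: 8; 2; 3; 3]; [:: 7; 2; 3; 3]; [:: 9; 1; 3; 3]], [::], B 1 1, [:: N 81 1; C 34 7]);
   ([:: [:: 3; 2; 2]; [:: 8; 2; 3; 3]; [:: 10; 1; 1; 3; 3]], [::], B 1 2, [:: C 24 9; C 39 9]);
   ([:: [:: 3; 2; 2]; [:: 8; 2; 3; 2]; [:: 7; 2; 3; 1]; [:: 11; 1; 3; 3; 1]], [::], B 3 1, [:: C 37 15; C 55 9]);
   ([:: [:: 3; 2; 2]; [:: 8; 2; 3; 2]; [:: 7; 2; 3; 3]; [:: 11; 1; 3; 3; 1]], [::], B 2 2, [:: N 84 0; C 17 9]);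
   ([:: [:: 3; 2; 2]; [:: 8; 2; 3; 3]; [:: 7; 2; 3; 3]; [:: 11; 1; 3; 3; 1]], [::], B 1 2, [:: C 17 15; N 85 0]);
   ([:: [:: 3; 2; 2]; [:: 8; 2; 3; 3]; [:: 7; 2; 3; 3]], [::], R 7, [:: E; E; E; E; N 20 0; E; E; N 78 0; E; E; N 82 0; N 83 0; N 86 0; N 83 1]);
   ([:: [:: 3; 2; 2]; [:: 8; 2; 3; 3]; [:: 7; 3; 3; 3]], [::], B 2 0, [:: E; N 87 0]);
   ([:: [:: 3; 2; 2]; [:: 8; 2; 3; 3]], [::], R 2, [:: N 77 1; E; E; N 88 0]);
   ([:: [:: 3; 2; 2]; [:: 8; 3; 3; 3]], [::], B 1 0, [:: E; N 89 0]);
   ([:: [:: 3; 2; 2]], [::], R 1, [:: N 77 0; E; E; N 90 0]);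
   ([:: [:: 3; 2; 3]], [::], B 0 1, [:: N 73 0; N 91 0]);
   ([:: [:: 3; 3; 3]], [::], B 0 0, [:: N 74 0; N 92 0]);
   ([:: [:: 4; 1; 1]; [:: 6; 1; 1; 3]; [:: 9; 2; 2; 2]], [::], B 1 2, [:: C 40 10; C 25 10]);
   ([:: [:: 4; 1; 1]; [:: 6; 1; 1; 1]; [:: 10; 2; 2; 2; 3]], [::], B 2 3, [:: C 55 20; C 44 10]);
   ([:: [:: 4; 1; 1]; [:: 6; 1; 1; 1]; [:: 10; 3; 2; 2; 3]], [::], B 2 0, [:: C 37 20; N 95 0]);
   ([:: [:: 4; 1; 1]; [:: 6; 1; 1; 3]; [:: 10; 3; 2; 2; 3]], [::], B 1 2, [:: N 96 0; C 17 10]);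
   ([:: [:: 4; 1; 1]; [:: 6; 1; 1; 3]; [:: 11; 3; 2; 2; 3]], [::], B 1 2, [:: C 39 20; C 24 20]);
   ([:: [:: 4; 1; 1]; [:: 6; 1; 1; 3]; [:: 12; 3; 2; 2; 1]], [::], B 1 2, [:: C 38 10; C 20 10]);
   ([:: [:: 4; 1; 1]; [:: 6; 1; 1; 3]; [:: 12; 3; 2; 2; 3]], [::], B 2 3, [:: N 99 0; C 32 10]);
   ([:: [:: 4; 1; 1]; [:: 6; 1; 1; 3]], [::], R 4, [:: E; E; E; E; E; E; E; E; E; N 94 0; N 97 0; N 98 0; N 100 0]);
   ([:: [:: 4; 1; 1]; [:: 6; 1; 3; 3]], [::], B 1 1, [:: N 101 0; E]);
   ([:: [:: 4; 1; 2]; [:: 6; 1; 1; 3]; [:: 2; 1; 3]], [::], B 1 2, [:: C 42 18; C 11 18]);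
   ([:: [:: 4; 1; 2]; [:: 6; 1; 1; 3]; [:: 2; 2; 2]], [::], R 6, [:: E; E; E; E; E; E; E; C 40 5; E; E; C 45 5; C 33 20; C 39 19]);
   ([:: [:: 4; 1; 2]; [:: 6; 1; 1; 3]; [:: 2; 2; 3]], [::], B 2 1, [:: N 103 0; N 104 0]);
   ([:: [:: 4; 1; 2]; [:: 6; 1; 1; 3]; [:: 2; 3; 3]], [::], B 2 0, [:: N 103 0; N 105 0]);
   ([:: [:: 6; 1; 1; 1]; [:: 8; 3; 1; 2]; [:: 7; 1; 2; 2]; [:: 10; 2; 3; 3; 1]], [::], B 3 1, [:: C 30 5; C 52 0]);
   ([:: [:: 4; 1; 2]; [:: 6; 1; 1; 3]; [:: 8; 3; 1; 2]; [:: 7; 1; 2; 2]; [:: 10; 2; 3; 3; 1]], [::], B 1 2, [:: N 107 0; C 17 11]);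
   ([:: [:: 4; 1; 2]; [:: 8; 3; 1; 2]; [:: 11; 2; 1; 3; 3]], [::], B 1 0, [:: C 26 20; C 41 20]);
   ([:: [:: 4; 1; 2]; [:: 6; 1; 1; 3]; [:: 12; 3; 3; 1; 1]], [::], B 1 2, [:: C 41 10; C 26 10]);
   ([:: [:: 4; 1; 2]; [:: 6; 1; 1; 3]; [:: 8; 3; 1; 2]; [:: 7; 1; 2; 2]], [::], R 6, [:: E; E; E; E; E; E; E; C 51 1; E; E; N 108 0; N 109 0; N 110 0]);
   ([:: [:: 4; 1; 2]; [:: 6; 1; 1; 3]; [:: 8; 3; 1; 2]; [:: 7; 1; 2; 3]], [::], B 3 2, [:: C 9 8; N 111 0]);
   ([:: [:: 4; 1; 2]; [:: 8; 3; 1; 2]; [:: 7; 2; 2; 3]], [::], B 1 0, [:: C 0 20; C 1 20]);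
   ([:: [:: 4; 1; 2]; [:: 6; 1; 1; 3]; [:: 8; 3; 1; 2]; [:: 7; 3; 2; 3]], [::], B 3 0, [:: N 112 0; N 113 0]);
   ([:: [:: 4; 1; 2]; [:: 6; 1; 1; 3]; [:: 9; 2; 2; 2]], [::], B 1 2, [:: C 1 11; C 0 11]);
   ([:: [:: 4; 1; 2]; [:: 6; 1; 1; 1]; [:: 8; 2; 1; 2]; [:: 10; 3; 2; 2; 3]], [::], B 3 0, [:: C 37 20; C 55 10]);
   ([:: [:: 4; 1; 2]; [:: 6; 1; 1; 1]; [:: 8; 3; 1; 2]; [:: 10; 3; 2; 2; 3]], [::], B 2 0, [:: C 17 20; N 116 0]);
   ([:: [:: 4; 1; 2]; [:: 6; 1; 1; 3]; [:: 8; 3; 1; 2]; [:: 10; 3; 2; 2; 3]], [::], B 1 2, [:: N 117 0; C 17 10]);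
   ([:: [:: 4; 1; 2]; [:: 6; 1; 1; 3]; [:: 8; 3; 1; 2]], [::], R 4, [:: N 93 4; E; N 106 0; E; N 101 5; E; C 10 11; N 114 0; C 10 21; N 115 0; N 118 0; N 110 5; N 109 5]);
   ([:: [:: 4; 1; 2]; [:: 6; 1; 1; 3]; [:: 8; 3; 1; 3]], [::], B 2 2, [:: C 10 20; N 119 0]);
   ([:: [:: 4; 1; 2]; [:: 6; 1; 1; 3]; [:: 8; 3; 3; 3]], [::], B 2 1, [:: N 120 0; C 10 21]);
   ([:: [:: 4; 1; 2]; [:: 6; 1; 1; 3]], [::], R 1, [:: E; N 106 0; N 106 5; N 121 0]);
   ([:: [:: 4; 1; 2]; [:: 6; 1; 2; 3]; [:: 2; 1; 3]], [::], B 1 2, [:: C 42 18; C 11 18]);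
   ([:: [:: 4; 1; 2]; [:: 6; 1; 2; 3]; [:: 2; 2; 2]], [::], R 6, [:: E; E; E; E; E; E; E; C 25 5; E; E; C 45 5; C 17 5; C 24 19]);
   ([:: [:: 4; 1; 2]; [:: 6; 1; 2; 3]; [:: 2; 2; 3]], [::], B 2 1, [:: N 123 0; N 124 0]);
   ([:: [:: 4; 1; 2]; [:: 6; 1; 2; 3]; [:: 2; 3; 3]], [::], B 2 0, [:: N 123 0; N 125 0]);
   ([:: [:: 4; 1; 2]; [:: 6; 1; 2; 1]; [:: 5; 1; 3]], [::], B 2 1, [:: E; C 8 21]);
   ([:: [:: 4; 1; 2]; [:: 6; 1; 2; 1]; [:: 5; 3; 3]], [::], B 2 0, [:: N 127 0; C 8 21]);
   ([:: [:: 4; 1; 2]; [:: 6; 1; 2; 3]; [:: 5; 3; 3]], [::], B 1 2, [:: N 128 0; E]);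
   ([:: [:: 4; 1; 2]; [:: 6; 1; 2; 3]; [:: 8; 2; 2; 3]], [::], B 2 2, [:: E; C 14 10]);
   ([:: [:: 4; 1; 2]; [:: 6; 1; 2; 3]; [:: 8; 2; 3; 3]], [::], B 2 1, [:: C 10 11; N 130 0]);
   ([:: [:: 4; 1; 2]; [:: 6; 1; 2; 3]; [:: 8; 3; 3; 3]], [::], B 2 0, [:: C 4 11; N 131 0]);
   ([:: [:: 4; 1; 2]; [:: 6; 1; 2; 3]], [::], R 1, [:: E; N 126 0; N 129 0; N 132 0]);
   ([:: [:: 4; 1; 2]; [:: 6; 1; 3; 3]], [::], B 1 1, [:: N 122 0; N 133 0]);
   ([:: [:: 4; 1; 3]; [:: 6; 1; 3; 3]], [::], B 0 1, [:: N 102 0; N 134 0]);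
   ([:: [:: 4; 2; 2]; [:: 6; 1; 2; 2]; [:: 2; 2; 3]], [::], R 6, [:: E; E; E; E; E; E; E; C 25 5; E; E; C 17 11; C 17 5; C 24 21]);
   ([:: [:: 4; 2; 2]; [:: 6; 1; 2; 3]; [:: 2; 2; 3]], [::], B 1 2, [:: N 135 4; N 136 0]);
   ([:: [:: 4; 2; 2]; [:: 6; 1; 2; 3]; [:: 2; 3; 3]], [::], B 2 0, [:: N 135 2; N 137 0]);
   ([:: [:: 4; 2; 2]; [:: 6; 1; 2; 3]; [:: 7; 2; 1; 1]], [::], B 1 2, [:: C 40 11; C 25 11]);
   ([:: [:: 4; 2; 2]; [:: 6; 1; 2; 1]; [:: 10; 2; 3; 3; 1]], [::], B 2 2, [:: C 28 11; C 55 21]);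
   ([:: [:: 4; 2; 2]; [:: 6; 1; 2; 3]; [:: 10; 2; 3; 3; 1]], [::], B 1 2, [:: N 140 0; C 17 11]);
   ([:: [:: 4; 2; 2]; [:: 8; 3; 3; 2]; [:: 11; 2; 1; 3; 3]], [::], B 1 0, [:: C 24 11; C 39 11]);
   ([:: [:: 4; 2; 2]; [:: 6; 1; 2; 3]; [:: 12; 3; 3; 1; 1]], [::], B 1 2, [:: C 39 21; C 24 21]);
   ([:: [:: 4; 2; 2]; [:: 6; 1; 2; 3]; [:: 8; 3; 3; 2]], [::], R 6, [:: E; E; E; E; E; E; E; N 139 0; E; E; N 141 0; N 142 0; N 143 0]);
   ([:: [:: 4; 2; 2]; [:: 6; 1; 2; 3]; [:: 8; 3; 3; 3]], [::], B 2 2, [:: E; N 144 0]);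
   ([:: [:: 4; 2; 2]; [:: 6; 1; 2; 3]], [::], R 1, [:: E; N 138 0; E; N 145 0]);
   ([:: [:: 4; 2; 2]; [:: 6; 1; 3; 3]], [::], B 1 1, [:: N 101 5; N 146 0]);
   ([:: [:: 4; 2; 3]; [:: 6; 1; 3; 3]], [::], B 0 1, [:: N 134 0; N 147 0]);
   ([:: [:: 4; 3; 3]; [:: 6; 1; 3; 3]], [::], B 0 0, [:: N 135 0; N 148 0]);
   ([:: [:: 4; 3; 3]; [:: 6; 2; 3; 3]], [::], B 1 1, [:: N 149 5; E]);
   ([:: [:: 4; 3; 3]; [:: 6; 3; 3; 3]], [::], B 1 0, [:: N 149 0; N 150 0]);
   ([:: [:: 4; 3; 3]], [::], R 3, [:: N 93 4; E; N 93 0; N 151 0]);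
   ([:: [:: 8; 1; 1; 3]; [:: 7; 3; 1; 3]; [:: 10; 3; 2; 2; 3]], [::], B 1 0, [:: C 15 16; C 21 1]);
   ([:: [:: 9; 1; 1; 1]; [:: 8; 1; 1; 3]; [:: 11; 1; 2; 2; 3]], [::], B 1 2, [:: C 18 3; C 31 5]);
   ([:: [:: 9; 1; 1; 1]; [:: 8; 1; 1; 3]; [:: 11; 3; 2; 2; 3]], [::], B 2 0, [:: N 154 0; C 19 16]);
   ([:: [:: 8; 1; 1; 3]; [:: 7; 3; 1; 3]; [:: 12; 3; 2; 2; 3]], [::], B 1 0, [:: N 153 1; C 22 20]);
   ([:: [:: 9; 1; 1; 1]; [:: 8; 1; 1; 3]; [:: 7; 3; 1; 3]; [:: 6; 3; 1; 3]], [::], R 4, [:: E; E; E; E; E; E; E; E; E; C 51 9; N 153 0; N 155 0; N 156 0]);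
   ([:: [:: 9; 1; 1; 1]; [:: 8; 1; 1; 3]; [:: 7; 3; 2; 3]; [:: 6; 3; 1; 3]], [::], B 2 2, [:: C 6 18; C 50 8]);
   ([:: [:: 9; 1; 1; 1]; [:: 8; 1; 1; 3]; [:: 7; 3; 3; 3]; [:: 6; 3; 1; 3]], [::], B 2 1, [:: N 157 0; N 158 0]);
   ([:: [:: 9; 1; 1; 1]; [:: 8; 1; 1; 3]; [:: 7; 3; 3; 3]; [:: 6; 3; 3; 3]], [::], B 3 1, [:: N 159 0; C 6 16]);
   ([:: [:: 9; 1; 1; 1]; [:: 8; 1; 3; 3]; [:: 7; 3; 3; 3]; [:: 6; 3; 3; 3]], [::], B 1 1, [:: N 160 0; C 50 20]);
   ([:: [:: 9; 1; 1; 1]; [:: 8; 2; 1; 3]; [:: 6; 3; 3; 3]; [:: 10; 3; 2; 2; 3]], [::], B 3 0, [:: C 30 16; C 31 3]);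
   ([:: [:: 9; 1; 1; 1]; [:: 8; 2; 1; 3]; [:: 11; 1; 2; 2; 3]], [::], B 1 2, [:: C 18 3; C 31 5]);
   ([:: [:: 9; 1; 1; 1]; [:: 8; 2; 1; 3]; [:: 11; 3; 2; 2; 3]], [::], B 2 0, [:: N 163 0; C 53 3]);
   ([:: [:: 9; 1; 1; 1]; [:: 8; 2; 1; 3]; [:: 7; 2; 1; 3]; [:: 6; 3; 3; 3]], [::], R 4, [:: E; E; E; E; E; E; E; E; E; C 51 9; N 162 0; N 164 0; N 162 1]);
   ([:: [:: 9; 1; 1; 1]; [:: 8; 2; 1; 3]; [:: 7; 2; 3; 3]; [:: 6; 3; 3; 3]], [::], B 2 1, [:: N 165 0; C 34 13]);
   ([:: [:: 9; 1; 1; 1]; [:: 8; 2; 3; 3]; [:: 7; 2; 3; 3]; [:: 6; 3; 3; 3]], [::], B 1 1, [:: N 166 0; C 34 7]);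
   ([:: [:: 9; 1; 1; 1]; [:: 8; 2; 3; 3]; [:: 7; 3; 3; 3]; [:: 6; 3; 3; 3]], [::], B 2 0, [:: N 161 1; N 167 0]);
   ([:: [:: 9; 1; 1; 1]; [:: 8; 3; 3; 3]; [:: 7; 3; 3; 3]; [:: 6; 3; 3; 3]], [::], B 1 0, [:: N 161 0; N 168 0]);
   ([:: [:: 9; 1; 1; 2]; [:: 7; 1; 3; 1]; [:: 6; 1; 3; 3]], [::], B 2 2, [:: C 7 6; C 3 4]);
   ([:: [:: 9; 1; 1; 2]; [:: 8; 3; 1; 2]; [:: 6; 1; 1; 1]; [:: 7; 3; 2; 2]], [::], B 3 0, [:: N 157 4; C 3 12]);
   ([:: [:: 9; 1; 1; 2]; [:: 8; 3; 1; 2]; [:: 6; 1; 1; 1]; [:: 7; 3; 2; 3]], [::], B 3 2, [:: C 7 2; N 171 0]);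
   ([:: [:: 9; 1; 1; 2]; [:: 8; 3; 1; 2]; [:: 7; 1; 1; 2]; [:: 6; 1; 1; 1]], [::], R 4, [:: N 93 4; E; N 149 2; E; N 101 5; E; C 6 10; N 172 0; C 6 20; C 7 8; N 156 1; C 21 2; N 153 1]);
   ([:: [:: 9; 1; 1; 2]; [:: 8; 3; 1; 2]; [:: 6; 1; 1; 2]; [:: 7; 1; 2; 3]], [::], B 3 2, [:: N 170 0; N 157 4]);
   ([:: [:: 9; 1; 1; 2]; [:: 8; 3; 1; 2]; [:: 6; 1; 1; 2]; [:: 7; 3; 2; 3]], [::], B 3 0, [:: N 174 0; C 6 7]);
   ([:: [:: 9; 1; 1; 2]; [:: 8; 3; 1; 2]; [:: 7; 1; 1; 2]; [:: 6; 1; 1; 2]], [::], R 4, [:: N 93 4; E; N 149 2; E; N 101 5; E; C 6 10; N 175 0; C 6 20; C 3 17; N 156 1; C 15 20; N 153 1]);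
   ([:: [:: 9; 1; 1; 2]; [:: 8; 3; 1; 2]; [:: 7; 1; 1; 2]; [:: 6; 1; 1; 3]], [::], B 3 2, [:: N 173 0; N 176 0]);
   ([:: [:: 9; 1; 1; 2]; [:: 8; 3; 1; 2]; [:: 7; 1; 1; 2]; [:: 6; 1; 3; 3]], [::], B 3 1, [:: N 177 0; C 6 10]);
   ([:: [:: 9; 1; 1; 2]; [:: 8; 3; 3; 2]; [:: 7; 1; 1; 2]; [:: 6; 1; 3; 3]], [::], B 1 1, [:: N 178 0; C 6 20]);
   ([:: [:: 9; 1; 1; 2]; [:: 8; 3; 3; 2]; [:: 7; 1; 3; 2]; [:: 6; 1; 3; 3]], [::], B 2 1, [:: N 179 0; N 157 4]);
   ([:: [:: 9; 1; 1; 2]; [:: 8; 3; 3; 2]; [:: 7; 1; 3; 3]; [:: 6; 1; 3; 3]], [::], B 2 2, [:: N 170 0; N 180 0]);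
   ([:: [:: 9; 1; 1; 2]; [:: 8; 3; 3; 2]; [:: 7; 1; 3; 3]; [:: 6; 3; 3; 3]], [::], B 3 0, [:: N 181 0; C 34 5]);
   ([:: [:: 9; 1; 1; 2]; [:: 8; 3; 3; 3]; [:: 7; 1; 3; 3]; [:: 6; 3; 3; 3]], [::], B 1 2, [:: C 6 21; N 182 0]);
   ([:: [:: 9; 1; 1; 2]; [:: 8; 3; 3; 3]; [:: 7; 2; 3; 3]], [::], B 1 0, [:: C 3 1; C 9 13]);
   ([:: [:: 9; 1; 1; 2]; [:: 8; 3; 3; 3]; [:: 7; 3; 3; 3]; [:: 6; 3; 3; 3]], [::], B 2 0, [:: N 183 0; N 184 0]);
   ([:: [:: 9; 1; 1; 3]; [:: 8; 3; 3; 3]; [:: 7; 3; 3; 3]; [:: 6; 3; 3; 3]], [::], B 0 2, [:: N 169 0; N 185 0]);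
   ([:: [:: 9; 1; 2; 2]; [:: 8; 2; 1; 1]; [:: 7; 3; 3; 3]], [::], B 2 0, [:: C 5 22; C 12 22]);
   ([:: [:: 9; 1; 2; 2]; [:: 8; 2; 2; 1]; [:: 6; 3; 3; 1]], [::], B 2 0, [:: C 9 21; C 6 13]);
   ([:: [:: 9; 1; 2; 2]; [:: 8; 2; 3; 1]; [:: 7; 3; 3; 3]; [:: 6; 3; 3; 1]], [::], B 1 1, [:: N 187 0; N 188 0]);
   ([:: [:: 9; 1; 2; 2]; [:: 8; 2; 3; 1]; [:: 7; 3; 3; 3]; [:: 6; 3; 3; 3]], [::], B 3 2, [:: N 189 0; C 6 17]);
   ([:: [:: 9; 1; 2; 2]; [:: 8; 3; 3; 1]; [:: 7; 3; 3; 3]; [:: 6; 3; 3; 3]], [::], B 1 0, [:: N 186 3; N 190 0]);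
   ([:: [:: 9; 1; 2; 2]; [:: 8; 1; 1; 2]; [:: 7; 1; 1; 1]; [:: 6; 1; 1; 1]; [:: 11; 1; 2; 2; 3]], [::], B 4 3, [:: C 27 20; C 15 17]);
   ([:: [:: 9; 1; 2; 2]; [:: 8; 1; 1; 2]; [:: 7; 1; 1; 1]; [:: 6; 1; 1; 1]; [:: 11; 3; 2; 2; 3]], [::], B 4 0, [:: N 192 0; C 15 11]);
   ([:: [:: 9; 1; 2; 2]; [:: 8; 1; 1; 2]; [:: 7; 1; 1; 1]; [:: 6; 1; 1; 1]], [::], R 4, [:: N 93 4; N 93 2; N 149 2; E; N 101 5; N 101 3; C 34 10; N 191 3; N 191 5; C 13 9; N 153 0; N 193 0; N 153 1]);
   ([:: [:: 9; 1; 2; 2]; [:: 8; 1; 1; 2]; [:: 7; 1; 1; 1]; [:: 6; 1; 3; 1]], [::], B 3 1, [:: N 194 0; C 7 4]);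
   ([:: [:: 9; 1; 2; 2]; [:: 8; 1; 1; 2]; [:: 7; 1; 3; 1]; [:: 6; 1; 3; 1]], [::], B 2 1, [:: N 195 0; N 170 4]);
   ([:: [:: 9; 1; 2; 2]; [:: 8; 1; 1; 2]; [:: 7; 3; 3; 1]; [:: 6; 1; 3; 1]], [::], B 2 0, [:: N 196 0; C 13 1]);
   ([:: [:: 9; 1; 2; 2]; [:: 8; 1; 3; 2]; [:: 7; 3; 3; 1]; [:: 6; 1; 3; 1]], [::], B 1 1, [:: N 197 0; N 185 2]);
   ([:: [:: 9; 1; 2; 2]; [:: 8; 2; 3; 2]; [:: 7; 3; 3; 1]], [::], B 2 0, [:: C 13 3; C 7 18]);
   ([:: [:: 9; 1; 2; 2]; [:: 8; 3; 3; 2]; [:: 7; 3; 3; 1]; [:: 6; 1; 3; 1]], [::], B 1 0, [:: N 198 0; N 199 0]);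
   ([:: [:: 9; 1; 2; 2]; [:: 8; 3; 3; 2]; [:: 7; 3; 3; 1]; [:: 6; 1; 3; 3]], [::], B 3 2, [:: N 200 0; C 7 11]);
   ([:: [:: 9; 1; 2; 2]; [:: 8; 3; 3; 2]; [:: 7; 3; 3; 1]; [:: 6; 3; 3; 3]], [::], B 3 0, [:: N 201 0; C 34 5]);
   ([:: [:: 9; 1; 2; 2]; [:: 8; 3; 3; 2]; [:: 7; 3; 3; 3]; [:: 6; 3; 3; 3]], [::], B 2 2, [:: N 202 0; N 191 1]);
   ([:: [:: 9; 1; 2; 2]; [:: 8; 3; 3; 3]; [:: 7; 3; 3; 3]; [:: 6; 3; 3; 3]], [::], B 1 2, [:: N 191 0; N 203 0]);
   ([:: [:: 9; 1; 2; 3]; [:: 8; 3; 3; 3]; [:: 7; 3; 3; 3]; [:: 6; 3; 3; 3]], [::], B 0 2, [:: N 185 1; N 204 0]);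
   ([:: [:: 9; 1; 3; 3]; [:: 8; 3; 3; 3]; [:: 7; 3; 3; 3]; [:: 6; 3; 3; 3]], [::], B 0 1, [:: N 186 0; N 205 0]);
   ([:: [:: 9; 2; 1; 3]; [:: 7; 2; 3; 3]; [:: 6; 3; 3; 1]], [::], B 1 2, [:: C 7 7; C 13 2]);
   ([:: [:: 9; 2; 1; 2]; [:: 8; 2; 3; 2]; [:: 7; 2; 3; 2]; [:: 6; 2; 3; 3]], [::], B 3 2, [:: N 207 0; N 54 4]);
   ([:: [:: 8; 2; 3; 2]; [:: 7; 2; 3; 2]; [:: 6; 1; 3; 2]; [:: 9; 3; 3; 1]], [::], B 3 0, [:: N 186 1; N 207 1]);
   ([:: [:: 9; 2; 1; 2]; [:: 8; 2; 3; 2]; [:: 7; 2; 1; 2]; [:: 6; 1; 1; 2]; [:: 11; 2; 1; 3; 2]], [::], B 4 2, [:: C 27 6; C 15 20]);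
   ([:: [:: 9; 2; 1; 2]; [:: 8; 2; 3; 2]; [:: 7; 2; 1; 2]; [:: 6; 1; 3; 2]; [:: 11; 2; 1; 3; 2]], [::], B 3 1, [:: N 210 0; C 16 13]);
   ([:: [:: 9; 2; 1; 2]; [:: 8; 2; 3; 2]; [:: 7; 2; 3; 2]; [:: 6; 1; 3; 2]; [:: 11; 2; 1; 3; 2]], [::], B 2 1, [:: N 211 0; C 36 6]);
   ([:: [:: 9; 2; 1; 2]; [:: 8; 2; 3; 2]; [:: 7; 2; 3; 2]; [:: 6; 1; 3; 2]; [:: 11; 2; 1; 3; 3]], [::], B 4 3, [:: C 15 1; N 212 0]);
   ([:: [:: 9; 2; 1; 2]; [:: 8; 2; 3; 2]; [:: 7; 2; 3; 2]; [:: 6; 1; 3; 2]], [::], R 6, [:: N 87 4; N 93 2; E; N 93 0; N 102 0; N 150 1; N 208 0; C 13 4; C 34 0; N 209 0; C 15 0; N 213 0; C 15 21]);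
   ([:: [:: 9; 2; 1; 2]; [:: 8; 2; 3; 2]; [:: 7; 2; 3; 3]; [:: 6; 1; 3; 2]], [::], B 2 2, [:: C 13 4; N 214 0]);
   ([:: [:: 9; 2; 1; 2]; [:: 8; 2; 3; 3]; [:: 7; 2; 3; 3]; [:: 6; 1; 3; 2]], [::], B 1 2, [:: N 207 3; N 215 0]);
   ([:: [:: 9; 2; 1; 3]; [:: 8; 2; 3; 3]; [:: 7; 2; 3; 3]; [:: 6; 1; 3; 2]], [::], B 0 2, [:: N 207 1; N 216 0]);
   ([:: [:: 9; 2; 1; 1]; [:: 8; 2; 1; 2]; [:: 6; 2; 2; 3]], [::], B 2 2, [:: C 3 19; E]);
   ([:: [:: 9; 2; 1; 1]; [:: 8; 2; 1; 2]; [:: 6; 3; 2; 3]], [::], B 2 0, [:: N 207 1; N 218 0]);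
   ([:: [:: 9; 2; 1; 1]; [:: 8; 2; 1; 2]; [:: 7; 2; 1; 1]; [:: 6; 2; 1; 2]], [::], R 4, [:: N 93 4; N 93 2; E; N 87 0; E; E; N 219 0; N 209 5; N 209 3; C 7 10; C 21 4; C 22 10; C 21 5]);
   ([:: [:: 9; 2; 1; 1]; [:: 8; 2; 1; 2]; [:: 7; 2; 1; 3]; [:: 6; 2; 1; 2]], [::], B 2 2, [:: N 220 0; N 214 5]);
   ([:: [:: 9; 2; 1; 1]; [:: 8; 2; 1; 2]; [:: 7; 2; 3; 3]; [:: 6; 2; 1; 2]], [::], B 2 1, [:: N 221 0; N 207 4]);
   ([:: [:: 9; 2; 1; 3]; [:: 8; 2; 1; 2]; [:: 7; 2; 3; 3]; [:: 6; 2; 1; 2]], [::], B 0 2, [:: N 222 0; N 54 4]);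
   ([:: [:: 9; 2; 1; 3]; [:: 8; 2; 1; 3]; [:: 7; 2; 3; 3]; [:: 6; 2; 1; 2]], [::], B 1 2, [:: N 216 3; N 223 0]);
   ([:: [:: 9; 2; 1; 3]; [:: 8; 2; 3; 3]; [:: 7; 2; 3; 3]; [:: 6; 2; 1; 2]], [::], B 1 1, [:: N 224 0; N 207 2]);
   ([:: [:: 9; 2; 1; 3]; [:: 8; 2; 3; 3]; [:: 7; 2; 3; 3]; [:: 6; 2; 3; 2]], [::], B 3 1, [:: N 225 0; E]);
   ([:: [:: 9; 2; 1; 3]; [:: 8; 2; 3; 3]; [:: 7; 2; 3; 3]; [:: 6; 3; 3; 2]], [::], B 3 0, [:: N 217 0; N 226 0]);
   ([:: [:: 9; 2; 1; 3]; [:: 8; 2; 3; 3]; [:: 7; 2; 3; 3]; [:: 6; 3; 3; 3]], [::], B 3 2, [:: N 207 0; N 227 0]);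
   ([:: [:: 9; 2; 2; 2]; [:: 8; 2; 1; 2]; [:: 6; 2; 2; 3]], [::], B 2 2, [:: C 7 17; E]);
   ([:: [:: 9; 2; 2; 2]; [:: 8; 2; 1; 2]; [:: 6; 2; 3; 3]], [::], B 2 1, [:: C 7 16; N 229 0]);
   ([:: [:: 9; 2; 2; 2]; [:: 8; 2; 1; 2]; [:: 7; 2; 1; 1]; [:: 6; 3; 3; 3]], [::], B 3 0, [:: C 43 18; N 230 0]);
   ([:: [:: 9; 2; 2; 2]; [:: 8; 2; 1; 2]; [:: 7; 2; 1; 3]; [:: 6; 3; 3; 3]], [::], B 2 2, [:: N 231 0; N 228 5]);
   ([:: [:: 9; 2; 2; 2]; [:: 8; 2; 1; 2]; [:: 7; 2; 3; 3]; [:: 6; 3; 3; 3]], [::], B 2 1, [:: N 232 0; N 228 4]);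
   ([:: [:: 9; 2; 2; 2]; [:: 8; 2; 1; 3]; [:: 7; 2; 3; 3]; [:: 6; 3; 3; 3]], [::], B 1 2, [:: N 228 3; N 233 0]);
   ([:: [:: 9; 2; 2; 2]; [:: 8; 2; 3; 3]; [:: 7; 2; 3; 3]; [:: 6; 3; 3; 3]], [::], B 1 1, [:: N 234 0; N 228 2]);
   ([:: [:: 9; 2; 2; 3]; [:: 8; 2; 3; 3]; [:: 7; 2; 3; 3]; [:: 6; 3; 3; 3]], [::], B 0 2, [:: N 228 1; N 235 0]);
   ([:: [:: 9; 2; 3; 3]; [:: 8; 2; 3; 3]; [:: 7; 2; 3; 3]; [:: 6; 3; 3; 3]], [::], B 0 1, [:: N 228 0; N 236 0]);
   ([:: [:: 9; 2; 3; 3]; [:: 8; 2; 3; 3]; [:: 7; 3; 3; 3]; [:: 6; 3; 3; 3]], [::], B 2 0, [:: N 206 4; N 237 0]);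
   ([:: [:: 9; 2; 3; 3]; [:: 8; 3; 3; 3]; [:: 7; 3; 3; 3]; [:: 6; 3; 3; 3]], [::], B 1 0, [:: N 206 2; N 238 0]);
   ([:: [:: 9; 3; 3; 3]; [:: 8; 3; 3; 3]; [:: 7; 3; 3; 3]; [:: 6; 3; 3; 3]], [::], B 0 0, [:: N 206 0; N 239 0]);
   ([:: [:: 9; 3; 3; 3]; [:: 8; 3; 3; 3]; [:: 7; 3; 3; 3]], [::], R 3, [:: N 93 4; N 93 2; N 93 0; N 240 0]);
   ([:: [:: 9; 3; 3; 3]; [:: 8; 3; 3; 3]], [::], R 2, [:: N 93 4; N 152 2; N 152 0; N 241 0]);
   ([:: [:: 9; 3; 3; 3]], [::], R 1, [:: N 93 2; N 152 2; N 152 1; N 242 0]);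
   ([::], [::], R 0, [:: N 93 0; N 152 0; N 152 1; N 243 0])].
Definition cores_of d orders (t : seq (seq (seq nat) * ctree)) : seq (seq pattern) :=
  [seq [seq unpack d orders c | c <- f.1] | f <- t].

Fixpoint words (n k : nat) : seq (seq nat) :=
  if k is k'.+1 then [seq i :: w | i <- iota 0 n, w <- words n k'] else [:: [::]].

Definition orders_ok (d : dom) (orders : seq (seq nat)) (Q : pred nat) : bool :=
  all (fun k => all (fun o => uniq o ==>
         has (fun o' => covers (restricted d Q o') (restricted d Q o)) orders)
       (words (nterm d) k)) (iota 2 (nterm d).-1)
  && all (fun i => all (fun j => (i == j) || has Q (allowed d i j)) (iota 0 (nterm d)))
       (iota 0 (nterm d)).

Definition check_all d orders expand perms lperms (tbl : seq (seq (seq nat) * ctree))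
    (es : seq entry) : bool :=
  let cores := cores_of d orders tbl in
  [&& orders_ok d orders predT, all (fun l => orders_ok d orders (predC1 l)) (iota 0 (nlab d)),
      all (perm_ok d) perms, all (perm_ok d) lperms,
      all (fun pi => nth 0 pi.2 (nlab d).-1 == (nlab d).-1) lperms,
      all (all (wf_pattern d)) cores,
      all (fun f => check_core [seq unpack d orders c | c <- f.1] f.2) tbl
    & check_entries d (viol_side d) (side_reqs d orders expand) perms lperms cores
        (unpack d orders) [::] es].

Lemma tri_checked :
  check_all tri tri_orders singles tri_perms tri_perms tri_core_table tri_entries.
Proof. by vm_compute. Qed.

Lemma tetra_checked :
  check_all tetra tetra_orders (fun p => [:: p]) tetra_perms tetra_lperms tetra_core_table
    tetra_entries.
Proof. by vm_compute. Qed.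

(** * Recombination of arcs *)

Section Arcs.
Variables (V : eqType) (e : rel V) (L : nat).
Hypotheses (e_sym : symmetric e)
  (L_max : forall c : seq V, 2 < size c -> uniq c -> cycle e c -> size c <= L)
  (L_gt1 : 1 < L).
Variables (off : pred V) (x : nat -> V).

Definition apath (i : nat) (s : seq V) (j : nat) : bool :=
  [&& path e (x i) (rcons s (x j)), uniq s & all off s].

Definition uarc (i : nat) (s : seq V) (j : nat) : Prop :=
  exists2 s', perm_eq s' s & apath i s' j.

Lemma apath_rev i s j : apath i s j -> apath j (rev s) i.
Proof.
case/and3P=> p_s us os; apply/and3P; split; rewrite ?rev_uniq ?all_rev //.
have := p_s; rewrite -rev_path last_rcons belast_rcons rev_cons.
by rewrite (@eq_path _ (fun z => e^~ z) e) // => a b; rewrite e_sym.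
Qed.

Lemma uarc_sym i s j : uarc i s j -> uarc j s i.
Proof. by case=> s' ps /apath_rev a; exists (rev s') => //; rewrite perm_rev. Qed.

Lemma uarc_uniq i s j : uarc i s j -> uniq s.
Proof. by case=> s' ps /and3P[_ us _]; rewrite -(perm_uniq ps). Qed.

Lemma uarc_off i s j : uarc i s j -> all off s.
Proof. by case=> s' ps /and3P[_ _ os]; rewrite -(perm_all _ ps). Qed.

(* A closed walk through distinct terminals along disjoint arcs is a cycle. *)
Lemma closed_walk_le (u : nat) (st : seq (seq V * nat)) :
  1 < size st -> uniq [seq x t.2 | t <- st] -> all (fun t => ~~ off (x t.2)) st ->
  last u [seq t.2 | t <- st] = u ->
  (forall k, k < size st ->
     apath (nth u (u :: [seq t.2 | t <- st]) k) (nth ([::], 0) st k).1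
           (nth ([::], 0) st k).2) ->
  uniq (flatten [seq t.1 | t <- st]) ->
  sumn [seq (size t.1).+1 | t <- st] <= L.
Proof.
move=> st_gt1 ux offx lastu arcs ufl.
pose c := flatten [seq rcons t.1 (x t.2) | t <- st].
have szc : size c = sumn [seq (size t.1).+1 | t <- st].
  rewrite /c size_flatten /shape -map_comp; congr sumn; apply: eq_map => t /=.
  by rewrite size_rcons.
have permc : perm_eq c ([seq x t.2 | t <- st] ++ flatten [seq t.1 | t <- st]).
  rewrite /c; elim: (st) => //= t r IH; rewrite cat_rcons.
  rewrite -cat1s perm_catCA /= perm_cons perm_sym perm_catCA perm_cat2l perm_sym.
  exact: IH.
have uc : uniq c.
  rewrite (perm_uniq permc) cat_uniq ux ufl andbT.
  apply/hasPn => v /flattenP[s /mapP[t tin ->]] vt; apply/mapP => -[t' t'in vE].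
  have [k kst tk] : exists2 k, k < size st & nth ([::], 0) st k = t.
    by exists (index t st); rewrite ?index_mem ?nth_index.
  have /and3P[_ _ /allP/(_ v)] := arcs k kst; rewrite tk vt => /(_ isT).
  by rewrite vE (negPf (allP offx _ t'in)).
have pc : path e (x u) c && (last (x u) c == x u).
  have : path e (x u) c && (last (x u) c == x (last u [seq t.2 | t <- st])).
    rewrite /c; elim: (st) (u) arcs {st_gt1 ux offx lastu ufl c szc permc uc} => [|t r IH] v arcs /=.
      by rewrite eqxx.
    have /and3P[p0 _ _] := arcs 0 isT.
    rewrite cat_path p0 last_cat last_rcons /=; apply: IH => k kr.
    have := arcs k.+1 kr => /=.
    by rewrite (set_nth_default v) //= size_map; apply: leqW.
  by rewrite lastu.
have cyc : cycle e c.
  case/andP: pc; case/lastP: (c) => // q y; rewrite last_rcons => pq /eqP yE.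
  by rewrite -rot1_cons rot_cycle /= {1}yE.
rewrite -szc; have [le|gt] := leqP (size c) 2; first exact: leq_trans le L_gt1.
exact: L_max.
Qed.

(* Walking along Y from the end s until X is met for the first time. *)
Lemma tripod_arcs p X q r Y s :
  uarc p X q -> uarc r Y s -> has (mem X) Y ->
  exists A1 A2, [/\ uarc p A1 s, uarc q A2 s, {subset A1 <= X ++ Y},
    {subset A2 <= X ++ Y} & (size X).+1 < (size A1).+1 + (size A2).+1].
Proof.
case=> X' pX aX [Y' pY /apath_rev aY] hXY.
have {}hXY : has (mem X') (rev Y').
  case/hasP: hXY => v vY vX; apply/hasP; exists v.
    by rewrite mem_rev (perm_mem pY).
  by rewrite /= (perm_mem pX); apply: vX.
have szX : size X = size X' by rewrite (perm_size pX).
have memX : X' =i X by apply: perm_mem.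
have memY : rev Y' =i Y by move=> v; rewrite mem_rev; apply: perm_mem.
case/split_find: hXY memY aY => z b1 b2 zX b1X memY aY.
move: zX; rewrite inE /= => /splitPr zX.
case: zX aX szX memX b1X => a1 a2 aX szX memX b1X.
have b1n : {in b1, forall v, v \notin a1 ++ z :: a2}.
  by move=> v vb; apply: (hasPn b1X).
case/and3P: aX; rewrite rcons_cat rcons_cons cat_path /= => /and3P[pa1 ez pa2].
rewrite all_cat cat_uniq /= => /and3P[ua1 /norP[za1 ha] /andP[za2 ua2]] /and3P[oa1 oz oa2].
case/and3P: aY; rewrite rcons_cat cat_path => /andP[pb1 _].
rewrite cat_uniq all_cat rcons_uniq all_rcons => /andP[/andP[zb1 ub1] _] /andP[/andP[_ ob1] _].
have pb : path e z (rcons (rev b1) (x s)).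
  have := pb1; rewrite -rev_path last_rcons belast_rcons rev_cons.
  by rewrite (@eq_path _ (fun w => e^~ w) e) // => a b; rewrite e_sym.
have pa : path e z (rcons (rev a1) (x p)).
  have : path e (x p) (rcons a1 z) by rewrite rcons_path pa1.
  rewrite -rev_path last_rcons belast_rcons rev_cons.
  by rewrite (@eq_path _ (fun w => e^~ w) e) // => a b; rewrite e_sym.
have pa2r : path e (x q) (rcons (rev a2) z).
  have := pa2; rewrite -rev_path last_rcons belast_rcons rev_cons.
  by rewrite (@eq_path _ (fun w => e^~ w) e) // => a b; rewrite e_sym.
exists (a1 ++ z :: rev b1), (rev a2 ++ z :: rev b1); split.
- exists (a1 ++ z :: rev b1) => //; apply/and3P; split.
  + by rewrite rcons_cat rcons_cons cat_path /= pa1 ez pb.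
  + rewrite cat_uniq /= rev_uniq mem_rev ua1 zb1 ub1 !andbT negb_or za1 /=.
    apply/hasPn => v; rewrite mem_rev => /b1n; rewrite mem_cat negb_or.
    by case/andP.
  + by rewrite all_cat /= all_rev oa1 oz ob1.
- exists (rev a2 ++ z :: rev b1) => //; apply/and3P; split.
  + by rewrite rcons_cat rcons_cons -cat_rcons cat_path pa2r last_rcons.
  + rewrite cat_uniq /= !rev_uniq !mem_rev ua2 zb1 ub1 !andbT negb_or za2 /=.
    apply/hasPn => v; rewrite mem_rev => /b1n; rewrite mem_cat inE !negb_or mem_rev.
    by case/and3P.
  + by rewrite all_cat /= !all_rev oa2 oz ob1.
- move=> v; rewrite !mem_cat inE mem_rev -memX -memY !mem_cat !inE !mem_rcons !inE.
  by case/or3P=> ->; rewrite ?orbT.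
- move=> v; rewrite !mem_cat inE !mem_rev -memX -memY !mem_cat !inE !mem_rcons !inE.
  by case/or3P=> ->; rewrite ?orbT.
- by rewrite szX !size_cat /= !size_rev; clear; lia.
Qed.

End Arcs.

(** * Soundness of the certificates *)

Definition wt (V : eqType) (S : seq (seq V)) (k : nat) : nat := (size (nth [::] S k)).+1.

Definition eval (w : nat -> nat) (l : seq (nat * seq nat)) : nat :=
  sumn [seq t.1 * sumn [seq w k | k <- t.2] | t <- l].

Lemma sumn_count (w : nat -> nat) n ks : all (fun k => k < n) ks ->
  sumn [seq w k | k <- ks] = \sum_(v < n) count_mem (v : nat) ks * w v.
Proof.
elim: ks => [_|k ks IH /= /andP[kn /IH ->]]; first by rewrite big1.
rewrite (bigD1 (Ordinal kn)) //= [in RHS](bigD1 (Ordinal kn)) //= eqxx mulnDl mul1n.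
rewrite -addnA; congr (_ + (_ + _)); apply: eq_bigr => v /eqP vk.
by case: eqP => // kv; case: vk; apply: val_inj.
Qed.

Lemma eval_coef (w : nat -> nat) n l : all (fun t => all (fun k => k < n) t.2) l ->
  eval w l = \sum_(v < n) coef v l * w v.
Proof.
rewrite /eval /coef; elim: l => [_|[m ks] l IH /= /andP[kn /IH ->]].
  by rewrite big1.
rewrite (sumn_count _ kn) big_distrr -big_split /=; apply: eq_bigr => v _.
by rewrite mulnDl mulnA.
Qed.

Lemma eval_le (w : nat -> nat) n l1 l2 :
  all (fun t => all (fun k => k < n) t.2) l1 -> all (fun t => all (fun k => k < n) t.2) l2 ->
  all (fun v => coef v l1 <= coef v l2) (iota 0 n) -> eval w l1 <= eval w l2.
Proof.
move=> h1 h2 /allP h; rewrite (eval_coef w h1) (eval_coef w h2); apply: leq_sum => v _.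
by rewrite leq_mul2r h ?orbT // mem_iota /=.
Qed.

Lemma eval_lt (w : nat -> nat) n l1 l2 : (forall v, 0 < w v) ->
  all (fun t => all (fun k => k < n) t.2) l1 -> all (fun t => all (fun k => k < n) t.2) l2 ->
  all (fun v => coef v l1 <= coef v l2) (iota 0 n) ->
  has (fun v => coef v l1 < coef v l2) (iota 0 n) -> eval w l1 < eval w l2.
Proof.
move=> w0 h1 h2 /allP h /hasP[v]; rewrite mem_iota /= add0n => vn lt.
rewrite (eval_coef w h1) (eval_coef w h2) (bigD1 (Ordinal vn)) //=.
rewrite [in X in _ < X](bigD1 (Ordinal vn)) //= -addSn leq_add //; first by rewrite ltn_pmul2r.
apply: leq_sum => u _; by rewrite leq_mul2r h ?orbT // mem_iota /=.
Qed.

Lemma eval_cat w l1 l2 : eval w (l1 ++ l2) = eval w l1 + eval w l2.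
Proof. by rewrite /eval map_cat sumn_cat. Qed.

Lemma eval_const w l K : (forall t, t \in l -> sumn [seq w k | k <- t.2] = K) ->
  eval w l = sumn [seq t.1 | t <- l] * K.
Proof.
rewrite /eval; elim: l => //= t l IH h; rewrite h ?mem_head // IH ?mulnDl // => u ul.
by rewrite h // inE ul orbT.
Qed.

Lemma eval_bound w l K : (forall t, t \in l -> sumn [seq w k | k <- t.2] <= K) ->
  eval w l <= sumn [seq t.1 | t <- l] * K.
Proof.
rewrite /eval; elim: l => //= t l IH h; rewrite mulnDl leq_add //.
  by rewrite leq_mul2l h ?mem_head ?orbT.
by rewrite IH // => u ul; rewrite h // inE ul orbT.
Qed.

Lemma mem_zip2 (S T : eqType) (s : seq S) (t : seq T) a b :
  (a, b) \in zip s t -> a \in s /\ b \in t.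
Proof.
elim: s t => [|y s IH] [|z t] //=; rewrite !inE => /orP[/eqP[-> ->]|/IH[-> ->]].
  by rewrite !eqxx.
by rewrite !orbT.
Qed.

Local Arguments add_tripod : simpl never.
Local Arguments add_tripods : simpl never.

Section CoreSound.
Variables (V : eqType) (e : rel V) (L : nat).
Hypotheses (e_sym : symmetric e)
  (L_max : forall c : seq V, 2 < size c -> uniq c -> cycle e c -> size c <= L)
  (L_gt1 : 1 < L).
Variables (off : pred V) (x : nat -> V) (nt : nat).
Hypothesis x_inj : {in gtn nt &, injective x}.
Hypothesis x_off : forall i, i < nt -> ~~ off (x i).

Let dis (s t : seq V) := ~~ has (mem s) t.

Lemma walk_steps (A : seq darc) (S : seq (seq V)) u ks vs :
  (forall k, k < size A -> let: (i, j, _) := nth (0, 0, [::]) A k in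
     [/\ uarc e off x i (nth [::] S k) j, i < nt & j < nt]) ->
  all (fun k => k < size A) ks -> walk A u ks = Some vs ->
  exists st : seq (seq V * nat), [/\ [seq t.2 | t <- st] = vs,
    all (fun v => v < nt) vs,
    forall k, k < size st -> apath e off x (nth u (u :: vs) k)
      (nth ([::], 0) st k).1 (nth ([::], 0) st k).2,
    [seq size t.1 | t <- st] = [seq size (nth [::] S k) | k <- ks]
    & perm_eq (flatten [seq t.1 | t <- st]) (flatten [seq nth [::] S k | k <- ks])].
Proof.
move=> arcs; elim: ks u vs => [|k ks IH] u vs /=; first by move=> _ [<-]; exists [::].
case/andP=> kA ksA; have := arcs k kA.
case: (nth _ A k) => -[i j] _ [a i_lt j_lt].
have step w w' : w' < nt -> uarc e off x w (nth [::] S k) w' -> u = w ->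
    omap (cons w') (walk A w' ks) = Some vs ->
    exists st : seq (seq V * nat), [/\ [seq t.2 | t <- st] = vs,
      all (fun v => v < nt) vs,
      forall k, k < size st -> apath e off x (nth u (u :: vs) k)
        (nth ([::], 0) st k).1 (nth ([::], 0) st k).2,
      [seq size t.1 | t <- st] = size (nth [::] S k) :: [seq size (nth [::] S k) | k <- ks]
      & perm_eq (flatten [seq t.1 | t <- st])
          (nth [::] S k ++ flatten [seq nth [::] S k | k <- ks])].
  move=> w'nt [s ps ap] uw; case E: (walk A w' ks) => [ws|] //= [vsE].
  have [st [st2 allv stp sts stf]] := IH _ _ ksA E.
  exists ((s, w') :: st); split; rewrite /= -?vsE /= ?w'nt ?st2 ?sts ?(perm_size ps) //.
    case=> [|m] mst /=; first by rewrite uw.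
    have := stp m mst; rewrite -st2 (set_nth_default u w') // /= size_map; exact: leqW.
  exact: perm_cat.
case: eqP => [ui|_]; first exact: (step i j).
by case: eqP => [uj|_] //; apply: (step j i) => //; apply: uarc_sym.
Qed.

Lemma combo_le (A : seq darc) (S : seq (seq V)) u ks :
  (forall k, k < size A -> let: (i, j, _) := nth (0, 0, [::]) A k in
     [/\ uarc e off x i (nth [::] S k) j, i < nt & j < nt]) ->
  all (fun k => k < size A) ks -> closed_from A ks u ->
  pairwise (fun k l => dis (nth [::] S k) (nth [::] S l)) ks ->
  sumn [seq wt S k | k <- ks] <= L.
Proof.
move=> arcs ksA; rewrite /closed_from; case E: (walk A u ks) => [vs|] //.
case/and3P=> vs_gt1 uvs /eqP lastu disj.
have [st [st2 allv stp sts stf]] := walk_steps arcs ksA E.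
have -> : [seq wt S k | k <- ks] = [seq (size t.1).+1 | t <- st].
  rewrite /wt (map_comp succn (fun t => size t.1)) sts -map_comp; exact: eq_map.
have xv : {in vs &, injective x}.
  by move=> a b /(allP allv) ant /(allP allv) bnt; apply: x_inj.
apply: (closed_walk_le L_max L_gt1 (x := x) (off := off) (u := u)).
- by rewrite -(size_map (fun t => t.2)) st2.
- by rewrite (map_comp x (fun t => t.2)) st2 map_inj_in_uniq.
- rewrite -[all _ _]/(all (preim (fun t : seq V * nat => t.2) (fun v => ~~ off (x v))) st).
  by rewrite -all_map st2; apply/allP => v /(allP allv)/x_off.
- by rewrite st2.
- by rewrite st2.
rewrite (perm_uniq stf); move: arcs ksA disj {E stf sts}.
elim: ks => //= k ks IH arcs /andP[kA ksA] /andP[dk dks].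
rewrite cat_uniq IH // andbT.
have := arcs k kA; case: (nth _ A k) => -[i j] _ [a _ _]; rewrite (uarc_uniq a) /=.
apply/hasPn => v /flattenP[s /mapP[l lks ->]] vl; apply/negP => vk.
by have /hasP := allP dk l lks; apply; exists v.
Qed.

Variables (b : seq (nat * larc)) (ncyc : nat) (S0 : seq (seq V)).
Hypothesis own_len : forall k, k < ncyc -> sumn [seq wt S0 i | i <- own b k] = L.
Hypothesis dj0_dis : forall i j, i < size b -> j < size b -> dj0 b i j ->
  dis (nth [::] S0 i) (nth [::] S0 j).

Record inv (D : seq (nat * nat)) (A : seq darc) (I : seq (nat * seq nat))
    (S : seq (seq V)) : Prop := Inv {
  inv_size : size S = size A;
  inv_b : size b <= size A;
  inv_S : forall i, i < size b -> nth [::] S i = nth [::] S0 i;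
  inv_arc : forall k, k < size A -> let: (i, j, _) := nth (0, 0, [::]) A k in
    [/\ uarc e off x i (nth [::] S k) j, i < nt & j < nt];
  inv_par : forall k, k < size A -> {subset nth [::] S k
    <= flatten [seq nth [::] S0 i | i <- (nth (0, 0, [::]) A k).2]}
    /\ all (fun i => i < size b) (nth (0, 0, [::]) A k).2;
  inv_D : forall i j, (i, j) \in D -> dis (nth [::] S0 i) (nth [::] S0 j);
  inv_I : forall t, t \in I -> [/\ t.1 < size A, all (fun k => k < size A) t.2
    & wt S t.1 < sumn [seq wt S k | k <- t.2]] }.

Lemma dis_sym s t : dis s t = dis t s.
Proof. by rewrite /dis has_sym. Qed.

Lemma good_combo_le D A I S ks : inv D A I S -> good_combo b D A ks ->
  sumn [seq wt S k | k <- ks] <= L.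
Proof.
move=> iv /and3P[ksA pw cl].
have disj : pairwise (fun k l => dis (nth [::] S k) (nth [::] S l)) ks.
  apply: (sub_in_pairwise (P := fun k => k < size A)) pw => // k l kA lA /allP h.
  have [sk bk] := inv_par iv kA; have [sl bl] := inv_par iv lA.
  apply/hasPn => v /sl /flattenP[s /mapP[j jl ->]] vj; apply/negP.
  move=> /sk /flattenP[t /mapP[i ik ->]] vi.
  suff /hasPn/(_ v vj) : dis (nth [::] S0 i) (nth [::] S0 j) by rewrite /= vi.
  case/or3P: (allP (h i ik) j jl).
  - by apply: dj0_dis; [apply: (allP bk) | apply: (allP bl)].
  - by move=> h'; apply: (inv_D iv h').
  - by move=> h'; rewrite dis_sym; apply: (inv_D iv h').
by case/orP: cl => cl; apply: combo_le (inv_arc iv) ksA cl disj.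
Qed.

Lemma leaf_sound D A I S ms mu nu :
  inv D A I S -> check_leaf b ncyc D A I ms mu nu -> False.
Proof.
move=> iv /and5P[smu snu /allP combos cf /andP[le strict]].
set zI := zip nu I in cf strict.
have zIin ni : ni \in zI -> ni.2 \in I by case: ni => n t /mem_zip2[].
set rhs := _ ++ _ in cf strict; set lhs := _ ++ _ in cf strict.
have ltA : all (fun t => all (fun k => k < size A) t.2) lhs.
  rewrite all_cat; apply/andP; split; first by apply/allP => t tm; have /and3P[] := combos t tm.
  by apply/allP => _ /mapP[ni /zIin/(inv_I iv)[h _ _] ->] /=; rewrite h.
have own_lt k : all (fun i => i < size b) (own b k).
  by apply/allP => i; rewrite mem_filter mem_iota => /and3P[].
have rtA : all (fun t => all (fun k => k < size A) t.2) rhs.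
  rewrite all_cat; apply/andP; split.
    apply/allP => _ /mapP[mk _ ->] /=; apply: sub_all (own_lt _) => i ib.
    exact: leq_trans ib (inv_b iv).
  by apply/allP => _ /mapP[ni /zIin/(inv_I iv)[_ h _] ->].
have e1 : eval (wt S) ms <= sumn [seq t.1 | t <- ms] * L.
  by apply: eval_bound => t tm; apply: good_combo_le iv (combos t tm).
have e2 : eval (wt S) [seq (mk.1, own b mk.2) | mk <- zip mu (iota 0 ncyc)] = sumn mu * L.
  rewrite (eval_const (K := L)) => [|_ /mapP[[m k] /mem_zip2[_ kn] ->] /=].
    by rewrite -map_comp -[in RHS](@unzip1_zip _ _ mu (iota 0 ncyc)) // size_iota.
  rewrite mem_iota in kn; rewrite -(own_len kn); congr sumn; apply/eq_in_map => i io.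
  by rewrite /wt (inv_S iv) // (allP (own_lt k)).
have e3 : eval (wt S) [seq (ni.1, [:: ni.2.1]) | ni <- zI] + sumn [seq ni.1 | ni <- zI]
    <= eval (wt S) [seq (ni.1, ni.2.2) | ni <- zI].
  rewrite /eval -!map_comp; elim: (zI) zIin => //= ni z IH h.
  have /(inv_I iv)[_ _ lt] := h ni (mem_head _ _).
  have {}IH : _ := IH (fun u (uz : u \in z) => h u (@mem_behead _ (ni :: z) u uz)).
  rewrite addn0 addnACA leq_add // -mulnSr leq_mul2l; apply/orP; right; exact: lt.
have e4 : sumn [seq ni.1 | ni <- zI] = sumn nu by rewrite [map _ _]unzip1_zip.
have le1 := eval_le (wt S) rtA ltA cf.
have lt1 := eval_lt (w := wt S) (fun=> ltn0Sn _) rtA ltA cf.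
rewrite !eval_cat e2 in le1 lt1.
have {}e1 := leq_trans e1 (leq_mul le (leqnn L)).
have lt2 : sumn [seq t.1 | t <- ms] < sumn mu -> eval (wt S) ms < sumn mu * L.
  move=> lt; apply: leq_ltn_trans (_ : sumn [seq t.1 | t <- ms] * L < _).
    by apply: eval_bound => t tm; apply: good_combo_le iv (combos t tm).
  by rewrite ltn_mul2r lt andbT ltnW.
rewrite e4 in e3; move: strict e1 e3 le1 lt1 lt2; clear.
case/or3P => [lt|lt|lt]; rewrite ?lt; move=> e1 e3 le1 lt1 lt2.
- by have := lt2 isT; lia.
- lia.
- by have := lt1 isT; lia.
Qed.

Lemma add_tripod_inv D A I S X Y r s : X < size b -> Y < size b -> s < nt ->
  ~~ dis (nth [::] S0 X) (nth [::] S0 Y) -> uarc e off x r (nth [::] S0 Y) s ->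
  inv D A I S ->
  exists S', let AI := add_tripod X Y s (A, I) in inv D AI.1 AI.2 S'.
Proof.
move=> Xb Yb snt meet aY iv; rewrite /add_tripod.
have XA := leq_trans Xb (inv_b iv).
have := inv_arc iv XA; case EX: (nth _ A X) => [[p q] l].
rewrite (inv_S iv Xb) => -[aX pnt qnt].
case: ifP => _; first by exists S.
have /negPn hXY := meet.
have [A1 [A2 [u1 u2 s1 s2 szA]]] := tripod_arcs e_sym aX aY hXY.
exists (S ++ [:: A1; A2]).
have SA := inv_size iv.
split => /=.
- by rewrite !size_cat SA.
- by rewrite size_cat; apply: leq_trans (inv_b iv) (leq_addr _ _).
- by move=> i ib; rewrite nth_cat SA (leq_trans ib (inv_b iv)) (inv_S iv).
- move=> k; rewrite size_cat /= !nth_cat SA; case: (ltnP k (size A)) => kA; first by move=> _; exact: (inv_arc iv kA).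
  move=> kle; have : k - size A < 2 by lia.
  by case: (k - size A) => [|[|]].
- move=> k; rewrite size_cat /= !nth_cat SA; case: (ltnP k (size A)) => kA; first by move=> _; exact: (inv_par iv kA).
  move=> kle; have : k - size A < 2 by lia.
  by case: (k - size A) => [|[|]] //= _; rewrite cats0 Xb Yb.
- exact: inv_D iv.
- move=> t; rewrite mem_rcons inE => /orP[/eqP-> /=|/(inv_I iv)[t1 t2 t3]].
    split; first by rewrite size_cat ltn_addr.
      by rewrite size_cat /= addn2 leqnn leqnSn.
    rewrite /wt !nth_cat SA XA ltnn subnn (ltnNge (size A).+1) leqnSn /= subSnn /=.
    by rewrite addn0 (inv_S iv Xb).
  rewrite size_cat; split; first by rewrite ltn_addr.
    by apply: sub_all t2 => k kA; rewrite ltn_addr.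
  rewrite /wt nth_cat SA t1; move: t3; congr (_ < _); congr sumn; apply/eq_in_map => k kt.
  by rewrite /wt nth_cat SA (allP t2 _ kt).
Qed.

Lemma add_tripods_inv D A I S X Y : X < size b -> Y < size b ->
  ~~ dis (nth [::] S0 X) (nth [::] S0 Y) -> inv D A I S ->
  exists S', let AI := add_tripods X Y (A, I) in inv D AI.1 AI.2 S'.
Proof.
move=> Xb Yb meet iv; rewrite /add_tripods /=.
have := inv_arc iv (leq_trans Yb (inv_b iv)); rewrite (inv_S iv Yb).
case: (nth _ A Y) => -[r s] _ [aY rnt snt].
have [S1 /= iv1] := add_tripod_inv Xb Yb rnt meet (uarc_sym e_sym aY) iv.
case: (add_tripod X Y r (A, I)) iv1 => A1 I1 /= iv1.
by have [S2 /= iv2] := add_tripod_inv Xb Yb snt meet aY iv1; exists S2.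
Qed.

Lemma ctree_sound t D A I S : inv D A I S -> check_ctree b ncyc D A I t -> False.
Proof.
elim: t D A I S => [ms mu nu|i j t1 IH1 t2 IH2] D A I S iv /=; first exact: leaf_sound iv.
case/and4P => ib jb c1; case: (boolP (dis (nth [::] S0 i) (nth [::] S0 j))) => [d|m].
  move=> _; apply: (IH1 _ _ _ S _ c1); case: iv => i1 i2 i3 i4 i5 i6 i7; split=> // k l.
  by rewrite inE => /orP[/eqP[-> ->]|/i6].
have [S1 /= iv1] := add_tripods_inv ib jb m iv.
case: (add_tripods i j (A, I)) iv1 => A1 I1 /= iv1.
have [|S2 /=] := add_tripods_inv jb ib _ iv1; first by rewrite dis_sym.
by case: (add_tripods j i (A1, I1)) => A2 I2 /= iv2; apply: IH2 iv2.
Qed.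

End CoreSound.

Record ctx (V : Type) := Ctx { trm : nat -> V; lbl : V -> nat }.

Lemma sumn_zip (T : Type) (V : eqType) (bs : seq T) (ss : seq (seq V)) :
  size bs = size ss ->
  sumn [seq (size t.2).+1 | t <- zip bs ss] = size ss + sumn (shape ss).
Proof.
elim: bs ss => [|b bs IH] [|s ss] //= [/IH ->].
by rewrite !addSn addnCA.
Qed.

Section Realize.
Variables (V : eqType) (e : rel V) (L : nat).
Hypotheses (e_sym : symmetric e)
  (L_max : forall c : seq V, 2 < size c -> uniq c -> cycle e c -> size c <= L)
  (L_gt1 : 1 < L).
Variables (long : seq V -> Prop) (d : dom).
Hypothesis longP : forall c, long c -> uniq c /\ size c = L.

Definition offt (X : ctx V) : pred V :=
  [pred v | v \notin [seq trm X i | i <- iota 0 (nterm d)]].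

Record valid (X : ctx V) : Prop := Valid {
  v_inj : {in gtn (nterm d) &, injective (trm X)};
  v_lab : forall v, offt X v -> lbl X v < nlab d;
  v_mono : forall u v, offt X u -> offt X v -> e u v -> lbl X u = lbl X v;
  v_att : forall i v, i < nterm d -> offt X v -> e (trm X i) v -> att d i (lbl X v) }.

Definition arc_real (X : ctx V) (a : larc) (s : seq V) : Prop :=
  [/\ a.1.1 < nterm d, a.1.2 < nterm d, uarc e (offt X) (trm X) a.1.1 s a.1.2
    & exists2 l, l \in a.2 & all (fun v => lbl X v == l) s].

Definition realizes (X : ctx V) (c : seq V) (p : pattern) : Prop :=
  [/\ size p.1 = size p.2, uniq p.1, all (fun i => i < nterm d) p.1
    & exists ss, [/\ size ss = size p.2,
        forall k, k < size p.2 -> arc_real X (nth (0, 0, [::]) p.2 k) (nth [::] ss k)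
      & perm_eq c ([seq trm X i | i <- p.1] ++ flatten ss)]].

Let dis (s t : seq V) := ~~ has (mem s) t.

Lemma offt_trm X i : i < nterm d -> ~~ offt X (trm X i).
Proof. by move=> id; rewrite /= negbK map_f // mem_iota. Qed.

Definition barcs_from n (fam : seq pattern) : seq (nat * larc) :=
  flatten [seq [seq (ip.1, a) | a <- ip.2.2] | ip <- zip (iota n (size fam)) fam].

Let b0 : nat * larc := (0, (0, 0, [::])).

Lemma uniq_flatten_dis (ss : seq (seq V)) i j : uniq (flatten ss) -> i < j ->
  dis (nth [::] ss i) (nth [::] ss j).
Proof.
elim: ss i j => [|s ss IH] [|i] [|j] //=; rewrite cat_uniq => /and3P[_ h u] ij.
  rewrite /dis; apply: contra h => /hasP[v vj vs]; apply/hasP; exists v => //.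
  have [jss|jss] := ltnP j (size ss); last by rewrite nth_default in vj.
  by apply/flattenP; exists (nth [::] ss j) => //; apply: mem_nth.
exact: IH.
Qed.

Lemma build X n fam :
  (forall p, p \in fam -> exists c, long c /\ realizes X c p) ->
  exists SS, let b := barcs_from n fam in [/\ size SS = size b,
    forall k, k < size b -> arc_real X (nth b0 b k).2 (nth [::] SS k)
                            /\ n <= (nth b0 b k).1,
    forall i j, i < size b -> j < size b -> i != j -> (nth b0 b i).1 = (nth b0 b j).1 ->
      dis (nth [::] SS i) (nth [::] SS j)
    & forall k, n <= k < n + size fam ->
      sumn [seq (size t.2).+1 | t <- zip b SS & t.1.1 == k] = L].
Proof.
elim: fam n => [|p fam IH] n h; first by exists [::]; split=> //= k; lia.
have [c [lc [szp up allp [ss [szs arcs pc]]]]] := h p (mem_head _ _).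
have [SS /= [szSS arcS disS lenS]] := IH n.+1 (fun q qf => h q (@mem_behead _ (p :: fam) q qf)).
have [uc szc] := longP lc.
exists (ss ++ SS); set b := barcs_from n (p :: fam).
have bE : b = [seq (n, a) | a <- p.2] ++ barcs_from n.+1 fam by [].
have szm : size [seq (n, a) | a <- p.2] = size p.2 by rewrite size_map.
have ufl : uniq (flatten ss).
  by move: uc; rewrite (perm_uniq pc) cat_uniq => /and3P[].
have nthb k : nth b0 b k = if k < size p.2 then (n, nth (0, 0, [::]) p.2 k)
                           else nth b0 (barcs_from n.+1 fam) (k - size p.2).
  by rewrite bE nth_cat szm; case: ltnP => // kp; rewrite (nth_map (0, 0, [::])).
have szb : size b = size p.2 + size (barcs_from n.+1 fam) by rewrite bE size_cat szm.
split.
- by rewrite szb size_cat szs szSS.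
- move=> k; rewrite szb nthb nth_cat szs; case: (ltnP k (size p.2)) => kp kb /=.
    by split; [apply: arcs|].
  have kb' : k - size p.2 < size (barcs_from n.+1 fam) by rewrite ltn_subLR.
  by have [ar ni] := arcS _ kb'; split=> //; apply: ltnW.
- move=> i j; rewrite szb !nthb !nth_cat szs.
  case: (ltnP i (size p.2)) => ip; case: (ltnP j (size p.2)) => jp /= ib jb ij.
  + move=> _; case: (ltngtP i j) ij => // ij _; first exact: uniq_flatten_dis.
    by rewrite /dis has_sym; apply: uniq_flatten_dis.
  + have [|_ +] := arcS (j - size p.2); first by rewrite ltn_subLR.
    by move=> + E; rewrite -E ltnn.
  + have [|_ +] := arcS (i - size p.2); first by rewrite ltn_subLR.
    by move=> + E; rewrite E ltnn.
  + apply: disS; rewrite ?ltn_subLR //; apply: contra ij => /eqP ij.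
    by rewrite -(subnK ip) -(subnK jp) ij.
- move=> k /= kn; rewrite bE zip_cat ?szm // filter_cat map_cat sumn_cat.
  have [kE|kE] := eqVneq k n.
    have -> : [seq t <- zip (barcs_from n.+1 fam) SS | t.1.1 == k] = [::].
      apply/eqP; rewrite -size_eq0 size_filter eqn0Ngt -has_count; apply/hasPn => -[b' s] bin.
      have /mem_zip2[b'in _] := bin; apply/eqP => /= b'k.
      have ib : index b' (barcs_from n.+1 fam) < size (barcs_from n.+1 fam) by rewrite index_mem.
      by have [_] := arcS _ ib; rewrite nth_index // b'k kE ltnn.
    have -> : [seq t <- zip [seq (n, a) | a <- p.2] ss | t.1.1 == k]
        = zip [seq (n, a) | a <- p.2] ss.
      apply/all_filterP/allP => -[b' s] /mem_zip2[/mapP[a _ ->] _].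
      by rewrite /= kE.
    rewrite addn0 -szc (perm_size pc) size_cat size_map size_flatten szp -szs.
    by apply: sumn_zip; rewrite szm szs.
  have -> : [seq t <- zip [seq (n, a) | a <- p.2] ss | t.1.1 == k] = [::].
    apply/eqP; rewrite -size_eq0 size_filter eqn0Ngt -has_count; apply/hasPn => -[b' s].
    by case/mem_zip2 => /mapP[a _ ->] _ /=; rewrite eq_sym.
  by rewrite /= add0n lenS //; lia.
Qed.

Lemma own_zip (b : seq (nat * larc)) (SS : seq (seq V)) k : size SS = size b ->
  sumn [seq wt SS i | i <- own b k] = sumn [seq (size t.2).+1 | t <- zip b SS & t.1.1 == k].
Proof.
move=> sz; have -> : zip b SS = [seq (nth b0 b i, nth [::] SS i) | i <- iota 0 (size b)].
  apply: (@eq_from_nth _ (b0, [::])) => [|i].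
    by rewrite size_map size_iota size_zip sz minnn.
  rewrite size_zip sz minnn => ib.
  by rewrite nth_zip // (nth_map 0) ?size_iota // nth_iota.
by rewrite filter_map -map_comp.
Qed.

Lemma core_sound X fam t : valid X -> check_core fam t ->
  (forall p, p \in fam -> exists c, long c /\ realizes X c p) -> False.
Proof.
move=> vX ch /(build 0) [SS]; rewrite -/(barcs fam) /=.
set b := barcs_from 0 fam => -[sz arcs disj len].
have bE : barcs fam = b by [].
pose A := [seq (ia.2.2.1, [:: ia.1]) | ia <- zip (iota 0 (size b)) b].
have szA : size A = size b by rewrite size_map size_zip size_iota minnn.
have nthA k : k < size b -> nth (0, 0, [::]) A k = ((nth b0 b k).2.1, [:: k]).
  move=> kb; rewrite (nth_map (0, b0)) ?size_zip ?size_iota ?minnn //.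
  by rewrite nth_zip ?size_iota // nth_iota.
apply: (@ctree_sound V e L e_sym L_max L_gt1 (offt X) (trm X) (nterm d) (v_inj vX)
  (@offt_trm X) b (size fam) SS _ _ t [::] A [::] SS _ ch).
- by move=> k kf; rewrite own_zip // len.
- move=> i j ib jb; rewrite /dj0 -/b0.
  have [ai _] := arcs i ib; have [aj _] := arcs j jb.
  case Ei: (nth b0 b i) ai => [ci [[i1 i2] li]] [_ _ _ [l lli /allP ali]].
  case Ej: (nth b0 b j) aj => [cj [[j1 j2] lj]] [_ _ _ [m mlj /allP amj]].
  case/andP => ij /orP[/eqP cij|nl]; first by apply: disj; rewrite ?Ei ?Ej.
  apply: contra nl => /hasP[v vj vi]; apply/hasP; exists m => //=.
  by rewrite -(eqP (amj v vj)) (eqP (ali v vi)).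
- split=> //; first by rewrite szA.
  + by rewrite szA.
  + move=> k; rewrite szA => kb; rewrite nthA //; have [ar _] := arcs k kb.
    case: ar; case: (nth b0 b k) => ck [[i j] l] /= i1 j1 u1 _.
    by apply: And3.
  + by move=> k; rewrite szA => kb; rewrite nthA //= cats0 kb; split.
Qed.

End Realize.

Definition pctx (V : Type) (pi : perm2) (X : ctx V) : ctx V :=
  Ctx (fun i => trm X (nth 0 pi.1 i)) (fun v => index (lbl X v) pi.2).

Section Transport.
Variables (V : eqType) (e : rel V) (d : dom).
Hypothesis e_sym : symmetric e.

Lemma arcs_zip (X : ctx V) (l : seq larc) (ss : seq (seq V)) : size ss = size l ->
  (forall k, k < size l -> arc_real e d X (nth (0, 0, [::]) l k) (nth [::] ss k)) <->
  (forall t, t \in zip l ss -> arc_real e d X t.1 t.2).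
Proof.
move=> sz; split=> [h t /(nthP ((0, 0, [::]), [::]))[k]|h k kl].
  by rewrite size_zip sz minnn => kl <-; rewrite nth_zip //; apply: h.
apply: (h (_, _)); rewrite -nth_zip //; apply: mem_nth.
by rewrite size_zip sz minnn.
Qed.

Lemma arc_covers_real X a' a s : arc_covers a' a -> arc_real e d X a s ->
  arc_real e d X a' s.
Proof.
case: a' a => [[i' j'] l'] [[i j] l] /andP[/= h /allP sub [/= i_lt j_lt u [l0 la ls]]].
have lab : exists2 l1, l1 \in l' & all (fun v => lbl X v == l1) s by exists l0; first apply: sub.
by case/orP: h => /eqP[-> ->]; split=> //; apply: uarc_sym.
Qed.

Lemma covers_realizes X c p' p : covers p' p -> realizes e d X c p -> realizes e d X c p'.
Proof.
case/and3P=> /eqP szp pp /hasP[n _ cov] [sz up ap [ss [szs /(arcs_zip _ szs) arcs pc]]].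
have szo := perm_size pp.
split; first by rewrite szo sz szp.
- by rewrite (perm_uniq pp).
- by rewrite (perm_all _ pp).
have key q ss' : size ss' = size q -> perm_eq ss ss' ->
    (forall t, t \in zip q ss' -> t \in zip p.2 ss) -> all2 arc_covers p'.2 q ->
    exists ss0, [/\ size ss0 = size p'.2,
      forall k, k < size p'.2 -> arc_real e d X (nth (0, 0, [::]) p'.2 k) (nth [::] ss0 k)
      & perm_eq c ([seq trm X i | i <- p'.1] ++ flatten ss0)].
  move=> szq ps sub; rewrite all2E => /andP[/eqP szpq /allP cv].
  exists ss'; split; first by rewrite szq.
    move=> k kp; have kq : k < size q by rewrite -szpq.
    apply: (@arc_covers_real _ _ (nth (0, 0, [::]) q k)).
      have := cv (nth (0, 0, [::]) p'.2 k, nth (0, 0, [::]) q k); apply.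
      by rewrite -nth_zip //; apply: mem_nth; rewrite size_zip -szpq minnn.
    apply: (arcs (_, _)); apply: sub; rewrite -nth_zip //; apply: mem_nth.
    by rewrite size_zip szq minnn.
  apply: perm_trans pc _; apply: perm_cat; last exact: perm_flatten.
  by rewrite perm_sym perm_map.
have zrot q qs : size q = size qs -> zip (rot n q) (rot n qs) = rot n (zip q qs).
  move=> E; rewrite /rot zip_cat ?size_drop ?E //.
  congr (_ ++ _); first by elim: (n) q qs {E} => [|m IH] [|? q] [|? qs] //=; case: drop.
  by elim: (n) q qs {E} => [|m IH] [|? q] [|? qs] //=; rewrite IH.
case/orP: cov => cov.
  apply: (key _ (rot n ss)) cov; rewrite ?size_rot //; first by rewrite perm_sym perm_rot.
  by move=> t; rewrite zrot // mem_rot.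
apply: (key _ (rot n (rev ss))) cov; rewrite ?size_rot ?size_rev //.
  by rewrite perm_sym perm_rot perm_rev.
by move=> t; rewrite zrot ?size_rev // mem_rot -rev_zip // mem_rev.
Qed.

Section Perm.
Variables (pi : perm2) (X : ctx V).
Hypothesis pi_ok : perm_ok d pi.

Lemma pi1_map : [seq nth 0 pi.1 i | i <- iota 0 (nterm d)] = pi.1.
Proof.
case/and3P: pi_ok => p1 _ _.
by rewrite -[in LHS](size_iota 0 (nterm d)) -(perm_size p1) map_nth_iota0 ?take_size.
Qed.

Lemma pctx_off : offt d (pctx pi X) =1 offt d X.
Proof.
move=> v /=; congr (~~ _); case/and3P: pi_ok => p1 _ _.
rewrite (_ : [seq _ | i <- _] = [seq trm X j | j <- [seq nth 0 pi.1 i | i <- iota 0 (nterm d)]]).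
  by rewrite pi1_map; apply: perm_mem; apply: perm_map.
by rewrite -map_comp.
Qed.

Lemma pi1_lt i : i < nterm d -> nth 0 pi.1 i < nterm d.
Proof.
case/and3P: pi_ok => p1 _ _ id.
have : nth 0 pi.1 i \in iota 0 (nterm d).
  by rewrite -(perm_mem p1) mem_nth // (perm_size p1) size_iota.
by rewrite mem_iota.
Qed.

Lemma pi2K l : l < nlab d -> nth 0 pi.2 (index l pi.2) = l.
Proof. by case/and3P: pi_ok => _ p2 _ ld; rewrite nth_index // (perm_mem p2) mem_iota. Qed.

Lemma pi2_lt l : l < nlab d -> index l pi.2 < nlab d.
Proof.
case/and3P: pi_ok => _ p2 _ ld; have := index_mem l pi.2.
by rewrite (perm_size p2) size_iota (perm_mem p2) mem_iota ld.
Qed.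

Lemma pi2I l : l < nlab d -> index (nth 0 pi.2 l) pi.2 = l.
Proof.
case/and3P: pi_ok => _ p2 _ ld; apply: index_uniq; rewrite ?(perm_size p2) ?size_iota //.
by rewrite (perm_uniq p2) iota_uniq.
Qed.

Lemma pctx_valid : valid e d X -> valid e d (pctx pi X).
Proof.
case=> inj lab mono att_ok; split.
- move=> i j id jd /= /(inj _ _ (pi1_lt id) (pi1_lt jd)) E.
  case/and3P: pi_ok => p1 _ _.
  apply/eqP; rewrite -(nth_uniq 0 (s := pi.1)) ?E ?(perm_size p1) ?size_iota //.
  by rewrite (perm_uniq p1) iota_uniq.
- by move=> v; rewrite pctx_off => /lab; apply: pi2_lt.
- by move=> u v; rewrite !pctx_off /= => ou ov /mono ->.
- move=> i v id; rewrite pctx_off => ov /= ev.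
  have := att_ok _ _ (pi1_lt id) ov ev.
  case/and3P: pi_ok => _ _ /allP/(_ i); rewrite mem_iota => /(_ id)/allP.
  move/(_ (index (lbl X v) pi.2)); rewrite mem_iota pi2_lt ?lab // => /(_ isT)/eqP <-.
  by rewrite pi2K ?lab.
Qed.

Lemma pctx_realizes c p : wf_pattern d p ->
  realizes e d X c (permp pi p) -> realizes e d (pctx pi X) c p.
Proof.
case/andP=> /allP wf1 /allP wf2 [sz up ap [ss [szs arcs pc]]].
rewrite !size_map in sz szs arcs.
split=> //; first exact: map_uniq up.
  by apply/allP.
exists ss; split=> //; last by rewrite /= map_comp.
move=> k kp; have := arcs k kp; rewrite (nth_map (0, 0, [::])) //.
have := wf2 _ (mem_nth (0, 0, [::]) kp).
case: (nth _ p.2 k) => -[i j] l /and3P[/= i_lt j_lt /allP lL] [/= _ _ [s ps ap'] [l' l'l ls]].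
split=> //=.
  exists s => //; case/and3P: ap' => pa us os; apply/and3P; split=> //.
  by rewrite (eq_all pctx_off).
case/mapP: l'l => m ml mE; exists m => //; apply/allP => v /(allP ls)/eqP -> /=.
by rewrite mE pi2I // lL.
Qed.

End Perm.
End Transport.

Section Table.
Variables (V : eqType) (e : rel V) (d : dom) (long : seq V -> Prop).
Hypotheses (e_sym : symmetric e)
  (long_share : forall c c', long c -> long c' -> 1 < count (mem c') c).
Variables (viol1 : seq nat -> pattern -> bool)
  (reqs : seq (seq (option pattern * seq nat)))
  (perms lperms : seq perm2) (cores : seq (seq pattern)) (unp : seq nat -> pattern).

Definition realized (X : ctx V) (p : pattern) : Prop :=
  exists c, long c /\ realizes e d X c p.

Variables (P : ctx V -> Prop) (Fl : ctx V -> nat -> Prop).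
Hypotheses (P_valid : forall X, P X -> valid e d X)
  (P_perm : forall X pi, P X -> pi \in lperms -> P (pctx pi X))
  (Fl_perm : forall X pi f, P X -> pi \in lperms -> f < nlab d ->
     Fl X (nth 0 pi.2 f) -> Fl (pctx pi X) f)
  (P_viol1 : forall X fl p, P X -> (forall f, f \in fl -> Fl X f) -> viol1 fl p ->
     ~ realized X p)
  (P_req : forall X r, P X -> r < size reqs ->
     exists2 o, o \in nth [::] reqs r & (forall f, f \in o.2 -> Fl X f)
       /\ (if o.1 is Some p then realized X p else True)).
Hypotheses (perms_ok : all (perm_ok d) perms) (lperms_ok : all (perm_ok d) lperms)
  (cores_wf : all (all (wf_pattern d)) cores)
  (cores_bad : forall g X, g \in cores -> valid e d X ->
     (forall p, p \in g -> realized X p) -> False).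

Definition holds (X : ctx V) (st : state) : Prop :=
  (forall p, p \in st.1 -> realized X p) /\ (forall f, f \in st.2 -> Fl X f).

Definition refuted (st : state) : Prop := forall X, P X -> ~ holds X st.

Lemma viol2_sound X p q : valid e d X -> viol2 p q -> realized X p -> realized X q -> False.
Proof.
move=> vX /andP[le nsh] [c [lc [szp up ap [ss [szs arcs pc]]]]].
move=> [c' [lc' [szq uq aq [ss' [szs' arcs' pc']]]]].
have := long_share lc lc'; rewrite (permP pc).
have intr (l : seq larc) (tt : seq (seq V)) v : size tt = size l ->
    (forall k, k < size l -> arc_real e d X (nth (0, 0, [::]) l k) (nth [::] tt k)) ->
    v \in flatten tt -> offt d X v /\ exists2 a, a \in l & lbl X v \in a.2.
  move=> sz ar /flattenP[s /(nthP [::])[k]]; rewrite sz => kl <- vs.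
  have [_ _ /uarc_off/allP of_ [m ml /allP lv]] := ar k kl.
  split; first exact: of_.
  by exists (nth (0, 0, [::]) l k); rewrite ?mem_nth // (eqP (lv v vs)).
have offT i : i < nterm d -> ~~ offt d X (trm X i) by apply: offt_trm.
rewrite count_cat [X in _ + X](_ : _ = 0) ?addn0.
  rewrite count_map ltnNge => /negP; apply; apply: leq_trans le.
  rewrite -!size_filter; apply: uniq_leq_size; first by rewrite filter_uniq.
  move=> i; rewrite !mem_filter => /andP[/= ic' ip]; rewrite ip andbT.
  have id := allP ap i ip.
  move: ic'; rewrite (perm_mem pc') mem_cat => /orP[/mapP[j jq E]|/intr].
    by rewrite (v_inj vX id (allP aq j jq) E).
  by case/(_ _ szs' arcs'); rewrite (negPf (offT i id)).
apply/eqP; rewrite eqn0Ngt -has_count; apply/hasPn => v /(intr _ _ _ szs arcs)[ov [a ap' va]].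
apply: contra nsh => /=; rewrite (perm_mem pc') mem_cat => /orP[/mapP[j jq E]|].
  by move: ov; rewrite E (negPf (offT j (allP aq j jq))).
move/(intr _ _ _ szs' arcs') => [_ [a' aq' va']].
by apply/hasP; exists a => //; apply/hasP; exists a' => //; apply/hasP; exists (lbl X v).
Qed.

Lemma embeds_realized X pi g st : pi \in perms \/ pi \in lperms ->
  all (wf_pattern d) g -> embeds pi g st -> P X ->
  (forall p, p \in st -> realized X p) -> forall p, p \in g -> realized (pctx pi X) p.
Proof.
move=> pin /allP wfg /allP emb pX h p pg.
have ok : perm_ok d pi by case: pin => [/(allP perms_ok)|/(allP lperms_ok)].
have /hasP[q qst cov] := emb p pg; have [c [lc rc]] := h q qst.
exists c; split=> //; apply: (pctx_realizes ok); first exact: wfg.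
exact: covers_realizes cov rc.
Qed.

Lemma check_ref_sound prev st r :
  (forall s, s \in prev -> refuted s /\ wf_state d s) ->
  check_ref viol1 perms lperms cores prev st r -> refuted st.
Proof.
move=> prevP; case: r => [|i k|i k] /=.
- move=> /orP[/hasP[p pst v1]|/hasP[p pst /hasP[q qst v2]]] X pX [hr hf].
    exact: P_viol1 pX hf v1 (hr p pst).
  exact: viol2_sound (P_valid pX) v2 (hr p pst) (hr q qst).
- case/and3P=> ic kp emb X pX [hr hf].
  have gin := mem_nth [::] ic; have pin := mem_nth ([::], [::]) kp.
  apply: (cores_bad gin (pctx_valid (allP perms_ok _ pin) (P_valid pX))).
  by apply: embeds_realized emb pX hr; [left | apply: (allP cores_wf)].
- case/and4P=> ip kp emb fl X pX [hr hf].
  have gin := mem_nth ([::], [::]) ip; have pin := mem_nth ([::], [::]) kp.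
  have [bad /andP[wf1 /allP wf2]] := prevP _ gin.
  apply: (bad _ (P_perm pX pin)); split.
    by apply: embeds_realized emb pX hr; [right | apply: wf1].
  move=> f ff; apply: Fl_perm => //; first exact: wf2.
  by apply: hf; apply: (allP fl).
Qed.

Lemma relabel_realized X ps c k : c < size ps -> k < size (nth ([::], [::]) ps c).2 ->
  (forall p, p \in ps -> realized X p) ->
  exists2 l, l \in (nth (0, 0, [::]) (nth ([::], [::]) ps c).2 k).2
    & forall p, p \in relabel ps c k l -> realized X p.
Proof.
move=> cps kp h; set p := nth _ ps c in kp *.
have [c0 [lc0 [szp up ap [ss [szs arcs pc]]]]] := h p (mem_nth _ cps).
have [i_lt j_lt ua [l la ls]] := arcs k kp.
exists l => // q /(nthP ([::], [::]))[m]; rewrite size_set_nth (maxn_idPr cps) => mps.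
rewrite nth_set_nth /=; case: eqP => [_ <-|_ <-]; last by apply: h; apply: mem_nth.
exists c0; split=> //; split=> //=; first by rewrite size_set_nth (maxn_idPr kp).
exists ss; split=> //; first by rewrite size_set_nth (maxn_idPr kp).
move=> n; rewrite size_set_nth (maxn_idPr kp) => np; rewrite nth_set_nth /=.
case: eqP => [->|_]; last exact: arcs.
by split=> //; exists l; rewrite ?mem_head.
Qed.

Lemma children_sound X st b : P X -> branch_ok reqs st b -> holds X st ->
  exists2 st', st' \in children reqs st b & holds X st'.
Proof.
case: b => [r|c k] pX /=.
  move=> rr [hr hf]; have [o oin [of_ op]] := P_req pX rr.
  exists (if o.1 is Some p then rcons st.1 p else st.1, st.2 ++ o.2).
    by apply/mapP; exists o.
  split=> /=; last by move=> f; rewrite mem_cat => /orP[/hf|/of_].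
  case: o.1 op => [p rp|_] q; last exact: hr.
  by rewrite mem_rcons inE => /orP[/eqP->|/hr].
case/andP=> cs kp [hr hf]; have [l lin hl] := relabel_realized cs kp hr.
by exists (relabel st.1 c k l, st.2) => //; apply/mapP; exists l.
Qed.

Lemma entries_sound prev es :
  (forall s, s \in prev -> refuted s /\ wf_state d s) ->
  check_entries d viol1 reqs perms lperms cores unp prev es -> forall X, ~ P X.
Proof.
elim: es prev => [|[[[codes fl] b] rs] es IH] prev prevP /=.
  case/hasP=> -[ps fl] sin /andP[/= /eqP psE /eqP flE] X pX.
  have [bad _] := prevP _ sin; apply: (bad X pX).
  by rewrite psE flE; split.
set st := (_, fl); case/and4P=> wf bok refs; apply: IH => s.
rewrite mem_rcons inE => /orP[/eqP->|/prevP] //; split=> // X pX hst.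
have [st' st'in hst'] := children_sound pX bok hst.
move: refs; rewrite all2E => /andP[/eqP szr /(all_nthP (([::], [::]), E)) ok].
have im : index st' (children reqs st b) < size (children reqs st b) by rewrite index_mem.
have := ok (index st' (children reqs st b)); rewrite size_zip -szr minnn => /(_ im).
rewrite nth_zip //= nth_index // => /(check_ref_sound prevP) bad.
exact: bad pX hst'.
Qed.

End Table.

(** * Arcs of a longest cycle *)

Lemma mem_words n k w : size w = k -> all (fun i => i < n) w -> w \in words n k.
Proof.
elim: k w => [|k IH] [|i w] //= [szw] /andP[i_lt w_lt].
by apply/allpairsP; exists (i, w); rewrite mem_iota IH.
Qed.

Section Decompose.
Variables (V : eqType) (e : rel V) (d : dom) (X : ctx V).
Hypotheses (e_sym : symmetric e) (vX : valid e d X).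

Lemma split_terms (r : seq V) (u : nat) : u < nterm d ->
  exists ts : seq (nat * seq V), [/\ trm X u :: r = flatten [seq trm X t.1 :: t.2 | t <- ts],
    head 0 [seq t.1 | t <- ts] = u, ts != [::],
    all (fun t => t.1 < nterm d) ts & all (fun t => all (offt d X) t.2) ts].
Proof.
elim: r u => [|v r IH] u un; first by exists [:: (u, [::])]; split; rewrite //= ?un.
have [ov|] := boolP (offt d X v).
  have [ts0 []] := IH u un; case: ts0 => [|[u' s] ts] //= E hu _.
  case/andP=> un' hts /andP[os ots].
  exists ((u, v :: s) :: ts); rewrite /= un ov os ots hts; split=> //.
  by case: E => _ ->.
rewrite /= negbK => /mapP[j]; rewrite mem_iota => jn ->.
have [ts [E hu tn hts ots]] := IH j jn.
by exists ((u, [::]) :: ts); rewrite /= -E un hts ots.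
Qed.

Lemma cycle_arcs (ts : seq (nat * seq V)) :
  ts != [::] -> all (fun t => all (offt d X) t.2) ts ->
  cycle e (flatten [seq trm X t.1 :: t.2 | t <- ts]) ->
  uniq (flatten [seq trm X t.1 :: t.2 | t <- ts]) ->
  let o := [seq t.1 | t <- ts] in
  forall k, k < size ts ->
    apath e (offt d X) (trm X) (nth 0 o k) (nth [::] [seq t.2 | t <- ts] k) (nth 0 (rot 1 o) k).
Proof.
have key w : forall (l : seq (nat * seq V)) u s,
    path e (trm X u) (rcons (s ++ flatten [seq trm X t.1 :: t.2 | t <- l]) (trm X w)) ->
    uniq (s ++ flatten [seq trm X t.1 :: t.2 | t <- l]) ->
    all (offt d X) s -> all (fun t => all (offt d X) t.2) l ->
    forall k, k < (size l).+1 -> apath e (offt d X) (trm X) (nth 0 (u :: [seq t.1 | t <- l]) k)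
      (nth [::] (s :: [seq t.2 | t <- l]) k) (nth 0 (rcons [seq t.1 | t <- l] w) k).
  elim=> [|[u' s'] l IH] u s /=.
    by rewrite cats0 => pc us os _ [|//] _; rewrite /apath pc us.
  rewrite rcons_cat cat_path rcons_cons /= => /and3P[p1 e1 p2].
  rewrite cat_uniq /= => /and3P[us _ /andP[_ us']] os /andP[os' ots] [_ /=|k kts].
    by rewrite /apath us os rcons_path p1 e1.
  exact: IH.
case: ts => [//|[u s] ts] _ /= /andP[os ots] pc /andP[_ uc].
by rewrite rot1_cons => k kts; apply: key.
Qed.

Lemma apath_label (Q : pred nat) i s j : i < nterm d -> j < nterm d ->
  has Q (allowed d i j) -> all (fun v => Q (lbl X v)) s ->
  apath e (offt d X) (trm X) i s j ->
  exists2 l, l \in [seq l <- allowed d i j | Q l] & all (fun v => lbl X v == l) s.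
Proof.
move=> id jd /hasP[l0 l0a Ql0] Qs; case: s Qs => [|v s] Qs /and3P[].
  by move=> _ _ _; exists l0 => //; rewrite mem_filter; apply/andP; split.
rewrite rcons_cons /= => /andP[ev pv] _ /andP[ov os].
have mono l1 (t : seq V) (w : V) : lbl X w = l1 -> offt d X w -> all (offt d X) t ->
    path e w (rcons t (trm X j)) ->
    all (fun w' => lbl X w' == l1) (w :: t) && e (last w t) (trm X j) && offt d X (last w t).
  elim: t w => [|w' t IH] w wl ow /=; first by rewrite wl eqxx !andbT => _ ->.
  case/andP=> ow' ot /andP[eww' pw]; rewrite wl eqxx /=.
  by apply: (IH w') => //; rewrite -wl; apply/esym/(v_mono vX).
have {}mono := mono _ s v erefl ov os pv.
case/andP: mono => /andP[mono el] ol.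
have ll : lbl X (last v s) = lbl X v by apply/eqP/(allP mono)/mem_last.
exists (lbl X v) => //; rewrite mem_filter; case/andP: Qs => -> _ /=.
rewrite mem_filter mem_iota /= (v_lab vX ov) andbT.
rewrite (v_att vX id ov ev) -ll; apply: (v_att vX jd ol).
by rewrite e_sym.
Qed.

Lemma cycle_realizes (Q : pred nat) c : cycle e c -> uniq c ->
  1 < count (fun i => trm X i \in c) (iota 0 (nterm d)) ->
  (forall i j, i < nterm d -> j < nterm d -> i != j -> has Q (allowed d i j)) ->
  (forall v, v \in c -> offt d X v -> Q (lbl X v)) ->
  exists o, [/\ 1 < size o, uniq o, all (fun i => i < nterm d) o,
    forall i, i < nterm d -> (i \in o) = (trm X i \in c)
    & realizes e d X c (restricted d Q o)].
Proof.
move=> cc uc two hQ Qc.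
have /hasP[u] : has (fun i => trm X i \in c) (iota 0 (nterm d)) by rewrite has_count ltnW.
rewrite mem_iota add0n /= => un uin.
have [m r cE] := rot_to uin.
have [ts [tsE hu tn hts ots]] := split_terms r un.
have c'E : rot m c = flatten [seq trm X t.1 :: t.2 | t <- ts] by rewrite cE.
have cc' : cycle e (flatten [seq trm X t.1 :: t.2 | t <- ts]) by rewrite -c'E rot_cycle.
have uc' : uniq (flatten [seq trm X t.1 :: t.2 | t <- ts]) by rewrite -c'E rot_uniq.
have arcs := cycle_arcs tn ots cc' uc'.
set o := [seq t.1 | t <- ts] in arcs.
have pc : perm_eq c ([seq trm X i | i <- o] ++ flatten [seq t.2 | t <- ts]).
  have: perm_eq c (rot m c) by rewrite perm_sym perm_rot.
  move/perm_trans; apply; rewrite c'E /o; elim: (ts) => //= t r' IH.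
  by rewrite perm_cons perm_sym perm_catCA perm_cat2l perm_sym.
have onT : all (fun i => i < nterm d) o by rewrite all_map.
have uo : uniq o.
  by move: uc; rewrite (perm_uniq pc) cat_uniq => /and3P[/map_uniq].
have memo i : i < nterm d -> (i \in o) = (trm X i \in c).
  move=> id; rewrite (perm_mem pc) mem_cat; apply/idP/orP => [io|[/mapP[j jo E]|]].
  - by left; apply: map_f.
  - by rewrite (v_inj vX id (allP onT j jo) E).
  - case/flattenP=> _ /mapP[t tin ->] it.
    by have := allP (allP ots t tin) _ it; rewrite (negPf (offt_trm X id)).
have szo : 1 < size o.
  apply: leq_trans two _; rewrite -size_filter; apply: uniq_leq_size.
    by rewrite filter_uniq ?iota_uniq.
  by move=> i; rewrite mem_filter mem_iota => /andP[ic /andP[_ id]]; rewrite memo.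
exists o; split=> //; have sze : size (ends o) = size o by rewrite size_zip size_rot minnn.
have nthe k : k < size o -> nth (0, 0) (ends o) k = (nth 0 o k, nth 0 (rot 1 o) k).
  by move=> ko; rewrite nth_zip // size_rot.
split=> //=; first by rewrite [RHS]size_map sze.
exists [seq t.2 | t <- ts]; split => //; first by rewrite !size_map sze size_map.
rewrite size_map sze => k ko; rewrite (nth_map (0, 0)) ?sze // nthe //=.
have id : nth 0 o k < nterm d by apply/(allP onT)/mem_nth.
have jd : nth 0 (rot 1 o) k < nterm d.
  by apply: (allP onT); rewrite -(mem_rot 1) mem_nth // size_rot.
have ts_k : k < size ts by rewrite -(size_map (fun t => t.1)).
have ap := arcs k ts_k.
split=> //; first by exists (nth [::] [seq t.2 | t <- ts] k).
have ap2 := ap; apply: apath_label ap2 => //.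
  apply: hQ => //; apply/eqP => E.
  have [k1|k1] := ltnP k.+1 (size o).
    have : nth 0 (rot 1 o) k = nth 0 o k.+1 by rewrite nth_cat size_drop ltn_subRL k1 nth_drop.
    by rewrite -E => /eqP; rewrite nth_uniq // eqn_leq ltnn andbF.
  have : nth 0 (rot 1 o) k = nth 0 o 0.
    rewrite nth_cat size_drop; case: ltnP => [|ok]; first by move: k1; clear; lia.
    have -> : k - (size o - 1) = 0.
      by move: ko; clear; lia.
    by rewrite nth_take.
  rewrite -E => /eqP; rewrite nth_uniq ?(ltnW szo) // => /eqP k0.
  by move: k1; rewrite k0 leqNgt szo.
apply/allP => v vs; apply: Qc.
  rewrite (perm_mem pc) mem_cat; apply/orP; right; apply/flattenP.
  by exists (nth [::] [seq t.2 | t <- ts] k) => //; rewrite mem_nth ?size_map.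
by have /and3P[_ _ /allP] := ap; apply.
Qed.

End Decompose.

Section Sides.
Variables (V : eqType) (e : rel V) (d : dom) (long : seq V -> Prop).
Hypothesis nl0 : 0 < nlab d.

Definition inside (X : ctx V) (l : nat) (c : seq V) : bool :=
  all (fun v => offt d X v ==> (lbl X v == l)) c
  && all (fun i => (trm X i \in c) ==> att d i l) (iota 0 (nterm d)).

Definition avoids (X : ctx V) (l : nat) (c : seq V) : bool :=
  all (fun v => offt d X v ==> (lbl X v != l)) c.

Definition touch (X : ctx V) (l : nat) (c : seq V) : nat :=
  count (fun i => att d i l && (trm X i \in c)) (iota 0 (nterm d)).

Let z := (nlab d).-1.

Record problem (X : ctx V) : Prop := Problem {
  pr_valid : valid e d X;
  pr_two : forall c, long c -> 1 < count (fun i => trm X i \in c) (iota 0 (nterm d));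
  pr_miss : forall i, i < nterm d -> exists2 c, long c & trm X i \notin c;
  pr_out : forall c, long c -> inside X z c -> touch X z c = 2;
  pr_in : (forall c, long c -> ~~ inside X z c) \/ exists2 c, long c & avoids X z c;
  pr_side : forall w, w < z -> exists c, [/\ long c, avoids X w c
    & touch X w c <> 2 \/ forall c', long c' -> ~~ inside X w c'] }.

Section Perm.
Variables (pi : perm2) (X : ctx V).
Hypotheses (pi_ok : perm_ok d pi) (vX : valid e d X).

Lemma att_perm i l : i < nterm d -> l < nlab d ->
  att d (nth 0 pi.1 i) (nth 0 pi.2 l) = att d i l.
Proof.
move=> id ld; case/and3P: pi_ok => _ _ /allP/(_ i); rewrite mem_iota => /(_ id)/allP.
by move/(_ l); rewrite mem_iota => /(_ ld)/eqP.
Qed.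

Lemma pi2_nth_lt l : l < nlab d -> nth 0 pi.2 l < nlab d.
Proof.
case/and3P: pi_ok => _ p2 _ ld.
have : nth 0 pi.2 l \in iota 0 (nlab d).
  by rewrite -(perm_mem p2) mem_nth // (perm_size p2) size_iota.
by rewrite mem_iota.
Qed.

Lemma lbl_perm l v : l < nlab d -> offt d X v ->
  (lbl (pctx pi X) v == l) = (lbl X v == nth 0 pi.2 l).
Proof.
move=> ld ov; apply/eqP/eqP => /= [<-|->]; last exact: (pi2I pi_ok).
by rewrite (pi2K pi_ok) // (v_lab vX).
Qed.

Lemma all_perm (Q : nat -> bool) :
  all (fun i => Q (nth 0 pi.1 i)) (iota 0 (nterm d)) = all Q (iota 0 (nterm d)).
Proof.
case/and3P: (pi_ok) => p1 _ _.
by rewrite -[RHS](perm_all _ p1) -{2}(pi1_map pi_ok) all_map.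
Qed.

Lemma inside_perm l c : l < nlab d -> inside (pctx pi X) l c = inside X (nth 0 pi.2 l) c.
Proof.
move=> ld; congr (_ && _).
  apply: eq_all => v; rewrite (pctx_off X pi_ok); case ov: (offt d X v) => //=.
  exact: lbl_perm.
rewrite -(all_perm (fun i => (trm X i \in c) ==> att d i (nth 0 pi.2 l))).
by apply: eq_in_all => i; rewrite mem_iota => id; rewrite att_perm.
Qed.

Lemma avoids_perm l c : l < nlab d -> avoids (pctx pi X) l c = avoids X (nth 0 pi.2 l) c.
Proof.
move=> ld; apply: eq_all => v; rewrite (pctx_off X pi_ok).
by case ov: (offt d X v) => //=; rewrite -(lbl_perm ld ov).
Qed.

Lemma touch_perm l c : l < nlab d -> touch (pctx pi X) l c = touch X (nth 0 pi.2 l) c.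
Proof.
move=> ld; case/and3P: (pi_ok) => p1 _ _.
rewrite /touch -[RHS](permP p1) -{1}(pi1_map pi_ok) count_map.
by apply: eq_in_count => i; rewrite mem_iota => id /=; rewrite att_perm.
Qed.

Lemma problem_perm : nth 0 pi.2 z = z -> problem X -> problem (pctx pi X).
Proof.
move=> piz [_ two miss out inn side]; case/and3P: (pi_ok) => p1 p2 _.
have zl : z < nlab d by rewrite /z ltn_predL.
split.
- exact: (pctx_valid pi_ok vX).
- move=> c lc; apply: leq_trans (two c lc) _.
  by rewrite -(permP p1) -{1}(pi1_map pi_ok) count_map.
- by move=> i id; apply: (miss _ (pi1_lt pi_ok id)).
- by move=> c lc; rewrite inside_perm // touch_perm // piz; apply: out.
- case: inn => [h|[c lc ac]]; [left=> c lc|right; exists c => //].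
    by rewrite inside_perm // piz; apply: h.
  by rewrite avoids_perm // piz.
- move=> w wz; have wl : w < nlab d := ltn_trans wz zl.
  have w'z : nth 0 pi.2 w < z.
    have := pi2_nth_lt wl; rewrite -(ltn_predK zl) ltnS leq_eqVlt => /orP[/eqP E|//].
    have : nth 0 pi.2 w == nth 0 pi.2 z by rewrite piz; apply/eqP.
    rewrite nth_uniq ?(perm_size p2) ?size_iota ?(perm_uniq p2) ?iota_uniq //.
    by rewrite (ltn_eqF wz).
  have [c [lc ac h]] := side _ w'z; exists c; rewrite avoids_perm // touch_perm //; split=> //.
  by case: h => h; [left|right=> c' lc'; rewrite inside_perm // h].
Qed.

End Perm.

Variable (L : nat).
Hypotheses (e_sym : symmetric e)
  (L_max : forall c : seq V, 2 < size c -> uniq c -> cycle e c -> size c <= L)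
  (L_gt1 : 1 < L)
  (longP : forall c, long c -> [/\ uniq c, cycle e c & size c = L])
  (long_share : forall c c', long c -> long c' -> 1 < count (mem c') c).
Variables (orders : seq (seq nat)) (expand : pattern -> seq pattern).
Hypothesis expandP : forall X c p, realizes e d X c p ->
  exists2 p', p' \in expand p & realizes e d X c p'.

Lemma mem_terms X c p i : valid e d X -> i < nterm d -> realizes e d X c p ->
  (trm X i \in c) = (i \in p.1).
Proof.
move=> vX id [_ _ /allP ap [ss [szs arcs pc]]].
rewrite (perm_mem pc) mem_cat; apply/orP/idP => [[/mapP[j jp E]|]|ip].
- by rewrite (v_inj vX id (ap j jp) E).
- case/flattenP=> s /(nthP [::])[k]; rewrite szs => kp <- vs.
  have [_ _ /uarc_off/allP/(_ _ vs)] := arcs k kp.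
  by rewrite (negPf (offt_trm X id)).
- by left; apply: map_f.
Qed.

Lemma confined_inside X c p l : valid e d X -> confined d l p -> realizes e d X c p ->
  inside X l c /\ touch X l c = size p.1.
Proof.
move=> vX /andP[/allP cl /allP ca] rc; have mt := mem_terms vX _ rc.
have [szp up /allP ap [ss [szs arcs pc]]] := rc.
split.
  apply/andP; split; last first.
    apply/allP => i.
    by rewrite mem_iota => id; rewrite mt //; apply/implyP => /ca.
  apply/allP => v vc; apply/implyP => ov; move: vc; rewrite (perm_mem pc) mem_cat => /orP[/mapP[i ip E]|].
    by move: ov; rewrite E (negPf (offt_trm X (ap i ip))).
  case/flattenP=> s /(nthP [::])[k]; rewrite szs => kp <- vs.
  have [_ _ _ [m ml /allP/(_ v vs)/eqP->]] := arcs k kp.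
  by have /allP/(_ m ml) := cl _ (mem_nth (0, 0, [::]) kp).
rewrite /touch -size_filter; apply: perm_size; apply: uniq_perm => //.
  by rewrite filter_uniq ?iota_uniq.
move=> i; rewrite mem_filter mem_iota add0n /=.
have [id|id] := boolP (i < nterm d); rewrite ?andbT ?andbF.
  by rewrite mt //; apply: andb_idl => /ca.
by apply/esym/negbTE; apply: contra id => /ap.
Qed.

Lemma canonical_order Q X c o : orders_ok d orders Q -> uniq o -> 1 < size o ->
  all (fun i => i < nterm d) o -> realizes e d X c (restricted d Q o) ->
  exists2 o', o' \in orders & perm_eq o' o /\ realizes e d X c (restricted d Q o').
Proof.
case/andP=> /allP ok _ uo o2 ao rc.
have szo : size o <= nterm d.
  rewrite -(size_iota 0 (nterm d)); apply: uniq_leq_size => // i /(allP ao).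
  by rewrite mem_iota.
have szin : size o \in iota 2 (nterm d).-1 by rewrite mem_iota; lia.
have /allP/(_ o (mem_words erefl ao))/implyP/(_ uo)/hasP[o' o'in cov] := ok _ szin.
exists o' => //; split.
  by case/and3P: cov.
exact: (covers_realizes e_sym cov rc).
Qed.

Lemma long_pattern Q X c : valid e d X -> orders_ok d orders Q -> long c ->
  1 < count (fun i => trm X i \in c) (iota 0 (nterm d)) ->
  (forall v, v \in c -> offt d X v -> Q (lbl X v)) ->
  exists o p, [/\ o \in orders, forall i, i < nterm d -> (i \in o) = (trm X i \in c),
    uniq o /\ all (fun i => i < nterm d) o,
    p \in expand (restricted d Q o) & realizes e d X c p].
Proof.
move=> vX ok lc two Qc; have [uc cc _] := longP lc.
have hQ i j : i < nterm d -> j < nterm d -> i != j -> has Q (allowed d i j).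
  move=> id jd ij; case/andP: ok => _ /allP/(_ i); rewrite mem_iota => /(_ id).
  by move/allP/(_ j); rewrite mem_iota (negPf ij) => /(_ jd).
have [o [o2 uo ao memo rc]] := cycle_realizes e_sym vX cc uc two hQ Qc.
have [o' o'in [po rc']] := canonical_order ok uo o2 ao rc.
have [p pin rp] := expandP rc'.
exists o', p; split=> //; first by move=> i id; rewrite (perm_mem po) memo.
by rewrite (perm_uniq po) (perm_all _ po).
Qed.

Let Fl (X : ctx V) (f : nat) : Prop := forall c, long c -> ~~ inside X f c.

Lemma side_req X r : problem X -> orders_ok d orders predT ->
  all (fun l => orders_ok d orders (predC1 l)) (iota 0 (nlab d)) ->
  r < size (side_reqs d orders expand) ->
  exists2 o, o \in nth [::] (side_reqs d orders expand) r & (forall f, f \in o.2 -> Fl X f)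
    /\ (if o.1 is Some p then realized e d long X p else True).
Proof.
case=> vX two miss out inn side okT /allP okC.
rewrite /side_reqs -/z !size_cat !size_map !size_iota /= !nth_cat !size_map !size_iota.
case: (ltnP r (nterm d)) => [rn _|nr].
  have [c lc rc] := miss r rn; have [o [p [oin memo _ pin rp]]] := long_pattern vX okT lc (two c lc) (fun _ _ _ => isT).
  exists (Some p, [::]); last by split=> //; exists c.
  rewrite (nth_map 0) ?size_iota // nth_iota // add0n.
  apply/flattenP; exists [seq (Some p, [::]) | p <- expand (restricted d predT o)].
    by apply/mapP; exists o => //; rewrite mem_filter memo // rc.
  by apply/mapP; exists p.
case: (ltnP (r - nterm d) z) => [rz _|zr rs].
  have [c [lc ac h]] := side _ rz.
  have wl : r - nterm d \in iota 0 (nlab d).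
    by rewrite mem_iota; apply: leq_trans rz (leq_pred _).
  have Qc v : v \in c -> offt d X v -> predC1 (r - nterm d) (lbl X v).
    by move=> vc ov; have := allP ac v vc; rewrite ov.
  have [o [p [oin memo [uo ao] pin rp]]] := long_pattern vX (okC _ wl) lc (two c lc) Qc.
  rewrite (nth_map 0) ?size_iota // nth_iota // add0n.
  set w := r - nterm d in h wl Qc pin *.
  have tE : touch X w c = count (fun i => att d i w) o.
    rewrite /touch -!size_filter; apply: perm_size; apply: uniq_perm; rewrite ?filter_uniq ?iota_uniq //.
    move=> i; rewrite !mem_filter mem_iota add0n /=.
    have [id|id] := boolP (i < nterm d); first by rewrite memo // andbT.
    rewrite andbF; apply/esym; apply: contraNF id => /andP[_]; exact: (allP ao).
  exists (Some p, if count (fun i => att d i w) o == 2 then [:: w] else [::]).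
    apply/flattenP; eexists; first by apply/mapP; exists o.
    by apply/mapP; exists p.
  split=> /=; last by exists c.
  move=> f; case: eqP => [t2|_] //; rewrite inE => /eqP->.
  by case: h => [|//]; rewrite tE.
have -> /= : r - nterm d - z = 0 by lia.
case: inn => [h|[c lc ac]].
  by exists (None, [:: z]); rewrite ?mem_head //; split=> // f; rewrite inE => /eqP->.
have zl : z \in iota 0 (nlab d) by rewrite mem_iota /= add0n /z ltn_predL.
have Qc v : v \in c -> offt d X v -> predC1 z (lbl X v).
  by move=> vc ov; have := allP ac v vc; rewrite ov.
have [o [p [oin memo _ pin rp]]] := long_pattern vX (okC _ zl) lc (two c lc) Qc.
exists (Some p, [::]); last by split=> //; exists c.
rewrite inE; apply/orP; right; apply/flattenP; eexists; first by apply/mapP; exists o.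
by apply/mapP; exists p.
Qed.

Theorem no_problem perms lperms tbl es X :
  check_all d orders expand perms lperms tbl es -> ~ problem X.
Proof.
rewrite /check_all; set cores := cores_of _ _ _.
case/and5P=> okT okC permsP lpermsP /and4P[/allP lz coresP coreok entok].
move: X; refine (entries_sound e_sym long_share (P := problem) (Fl := Fl) _ _ _ _ _
  permsP lpermsP coresP _ _ entok) => //.
- by move=> Y [].
- move=> Y pi pY pin; apply: problem_perm => //; first exact: (allP lpermsP).
    by case: pY.
  exact/eqP/lz.
- move=> Y pi f [vY _ _ _ _ _] pin fl h c lc; rewrite inside_perm ?h //.
  exact: (allP lpermsP).
- move=> Y fl p [vY two _ out _ _] hf /hasP[l].
  rewrite mem_iota => ll /andP[cl h] [c [lc rc]].
  have [ins tc] := confined_inside vY cl rc.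
  case/orP: h => [/andP[/eqP lz' /eqP]|/hf/(_ c lc)]; last by rewrite ins.
  by rewrite lz' in ins tc; rewrite -tc; case; apply: out.
- by move=> Y r pY; apply: side_req.
- move=> g Y gin vY h; suff [t tok] : exists t, check_core g t.
    apply: (core_sound e_sym L_max L_gt1 _ vY tok h) => c lc.
    by have [] := longP lc.
  move: gin coreok; rewrite /cores; elim: (tbl) => //= f fs IH.
  by rewrite inE => /orP[/eqP-> /andP[ok _]|/IH h' /andP[_ /h']] //; exists f.2.
Qed.

End Sides.

(** * Separating triangles and cliques in 3-trees *)

Definition triangle (G : sgraph) (a b c : G) : Prop :=
  [/\ edge a b, edge b c & edge a c].

Definition closed_off (G : sgraph) (S Z : {set G}) : Prop :=
  [disjoint Z & S] /\ forall u v, u \in Z -> v \notin S -> edge u v -> v \in Z.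

Lemma edge_neq (G : sgraph) (a b : G) : edge a b -> a != b.
Proof. by apply: contraTneq => ->; rewrite edge_irr. Qed.

Lemma triangle_rot (G : sgraph) (a b c : G) : triangle a b c -> triangle b c a.
Proof. by case=> ab bc ac; split=> //; rewrite edge_sym. Qed.

Lemma set3_rot (T : finType) (a b c : T) : [set a; b; c] = [set b; c; a].
Proof. by apply/setP => v; rewrite !inE orbAC -orbA orbC -orbA; do 3!case: (_ == _). Qed.

Lemma iso_inverse (G H : sgraph) : isomorphic G H ->
  exists f : H -> G, injective f /\ (forall x y, edge (f x) (f y) = edge x y) /\
    exists2 g : G -> H, cancel g f & cancel f g.
Proof.
case=> g [f gf fg] eg; exists f; split; first exact: can_inj fg.
split; last by exists g.
by move=> x y; rewrite -eg !fg.
Qed.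

Lemma apex (H : sgraph) : three_tree H -> forall (a b c : H) (Z : {set H}),
  triangle a b c -> closed_off [set a; b; c] Z -> Z != set0 ->
  exists2 v, v \in Z & [/\ edge a v, edge b v & edge c v].
Proof.
elim=> {H} [|G a b c tG IH ab bc ac|G H tG IH /iso_inverse[f [fI [ef [g gf fg]]]]].
- move=> a b c Z [ab bc ac] [dZ _] /set0Pn[v vZ].
  have : v \notin [set a; b; c] by rewrite (disjointFr dZ vZ).
  rewrite !inE !negb_or => /andP[/andP[va vb] vc].
  have : uniq [:: v; a; b; c] by rewrite /= !inE !negb_or va vb vc (edge_neq ab) (edge_neq ac) (edge_neq bc).
  by move/card_uniqP => u4; have := max_card [in [:: v; a; b; c]]; rewrite u4 card_ord.
- set H := add_vertex [set a; b; c].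
  have key (y z : G) (Z : {set H}) :
      @triangle H None (Some y) (Some z) ->
      @closed_off H [set (None : H); (Some y : H); (Some z : H)] Z -> Z != set0 ->
      exists2 v, v \in Z & [/\ @edge H None v,
         @edge H (Some y) v & @edge H (Some z) v].
    move=> [/= yN yz zN] [dZ cZ] /set0Pn[v0 v0Z].
    have [t tN [ty tz]] : exists2 t, t \in [set a; b; c] & edge y t /\ edge z t.
      have := edge_neq yz; move: yN zN; rewrite !inE -!orbA.
      case/or3P=> /eqP->; case/or3P=> /eqP->; rewrite ?eqxx // => _;
        [exists c|exists b|exists c|exists a|exists b|exists a]; rewrite ?inE ?eqxx ?orbT //;
        by split; rewrite // edge_sym.
    have [tZ|tZ] := boolP (Some t \in Z); first by exists (Some t).
    have NZ : None \notin Z by apply/negP => /(disjointFr dZ); rewrite !inE eqxx.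
    pose Z0 : {set G} := [set v | Some v \in Z].
    have cZ0 : closed_off [set y; z; t] Z0.
      split; last first.
        move=> u v; rewrite !inE !negb_or => uZ /andP[/andP[vy vz] vt] uv.
        by apply: (cZ (Some u)) => //; rewrite !inE !negb_or /= (inj_eq (@Some_inj _)) vy.
      apply/pred0P => v /=; rewrite !inE; apply/negP => /andP[vZ].
      rewrite -orbA => /or3P[] /eqP E; move: vZ; rewrite E; last exact/negP.
        by move/(disjointFr dZ); rewrite !inE eqxx orbT.
      by move/(disjointFr dZ); rewrite !inE eqxx orbT.
    have [||v] := IH y z t Z0 _ cZ0; first by split.
      by apply/set0Pn; case: v0 v0Z => [v|]; [exists v; rewrite inE|rewrite (negPf NZ)].
    rewrite inE => vZ [_ _ tv]; case/negP: tZ; apply: (cZ (Some v)) => //=.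
      by rewrite !inE /= !(inj_eq (@Some_inj _)) eq_sym (negPf (edge_neq ty)) eq_sym (negPf (edge_neq tz)).
    by rewrite edge_sym.
  move=> [x|] [y|] [z|] Z tr cZ Z0 //.
  + case: cZ => dZ cZ.
    pose Z1 : {set G} := [set v | Some v \in Z].
    have cZ1 : closed_off [set x; y; z] Z1.
      split; last first.
        move=> u v; rewrite !inE => uZ vS uv; apply: (cZ (Some u)) => //.
        by rewrite !inE /= !(inj_eq (@Some_inj _)).
      apply/pred0P => v /=; rewrite !inE; apply/negP => /andP[vZ vS].
      by have := disjointFr dZ vZ; rewrite !inE /= !(inj_eq (@Some_inj _)) vS.
    have [Z1E|Z1n] := eqVneq Z1 set0; last first.
      have [v vZ [? ? ?]] := IH x y z Z1 tr cZ1 Z1n.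
      by exists (Some v) => //; rewrite inE in vZ.
    have NZ : None \in Z.
      case/set0Pn: Z0 => -[v vZ|//]; have : v \in Z1 by rewrite inE.
      by rewrite Z1E inE.
    have sub : {subset [set a; b; c] <= [set x; y; z]}.
      move=> v vN; apply: contraT => vS; have : v \in Z1.
        rewrite inE; apply: (cZ None) => //.
        by move: vS; rewrite !inE /= !(inj_eq (@Some_inj _)).
      by rewrite Z1E inE.
    have card3 (p q r : G) : edge p q -> edge q r -> edge p r -> #|[set p; q; r]| = 3.
      move=> pq qr pr; rewrite -setUA cardsU1 cards2 !inE negb_or.
      by rewrite (edge_neq pq) (edge_neq pr) (edge_neq qr).
    have E : [set a; b; c] = [set x; y; z].
      apply/eqP; rewrite eqEcard; apply/andP; split; first exact/subsetP.
      by case: tr => /= ? ? ?; rewrite !card3.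
    by exists None => //=; rewrite E !inE !eqxx !orbT.
  + have [|v vZ [? ? ?]] := key x y Z (triangle_rot (triangle_rot tr)) _ Z0; last by exists v.
    by rewrite set3_rot.
  + have [|v vZ [? ? ?]] := key z x Z (triangle_rot tr) _ Z0; last by exists v.
    by rewrite -set3_rot.
  + by case: tr.
  + by have [v vZ [? ? ?]] := key y z Z tr cZ Z0; exists v.
  + by case: tr.
  + by case: tr.
  + by case: tr.
- move=> a b c Z [ab bc ac] [dZ cZ] /set0Pn[v0 v0Z].
  have [|||v] := IH (f a) (f b) (f c) [set f v | v in Z].
  + by split; rewrite ef.
  + split.
      apply/pred0P => v /=; apply/negP => /andP[/imsetP[w wZ ->]].
      rewrite !inE !(inj_eq fI) => wS; have := disjointFr dZ wZ.
      by rewrite !inE wS.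
    move=> _ v /imsetP[u uZ ->] vS uv; rewrite -(gf v); apply: imset_f; apply: (cZ u) => //.
      by move: vS; rewrite !inE -(gf v) !(inj_eq fI) gf.
    by rewrite -ef gf.
  + by apply/set0Pn; exists (f v0); apply: imset_f.
  case/imsetP=> w wZ ->; rewrite !ef => h; by exists w.
Qed.

Definition clique4 (G : sgraph) (x : nat -> G) : Prop :=
  forall i j, i < 4 -> j < 4 -> i != j -> edge (x i) (x j).

Lemma clique4_inj (G : sgraph) (x : nat -> G) : clique4 x -> {in gtn 4 &, injective x}.
Proof.
move=> cx i j i4 j4 E; apply/eqP; apply: contraT => ij.
by have := cx i j i4 j4 ij; rewrite E edge_irr.
Qed.

Lemma sides (H : sgraph) : three_tree H -> forall x : nat -> H, clique4 x ->
  exists chi : H -> nat, valid edge tetra (Ctx x chi).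
Proof.
elim=> {H} [|G a b c tG IH ab bc ac|G H tG IH /iso_inverse[f [fI [ef [g gf fg]]]]] x cx.
- have : uniq [seq x i | i <- iota 0 4].
    rewrite map_inj_in_uniq ?iota_uniq // => i j; rewrite !mem_iota => i4 j4.
    exact: clique4_inj cx i j i4 j4.
  by move/card_uniqP => u4; have := max_card [in [seq x i | i <- iota 0 4]]; rewrite u4 card_ord.
- set H := add_vertex [set a; b; c] in x cx *.
  have xI := clique4_inj cx.
  have triN (u v : G) : u \in [set a; b; c] -> v \in [set a; b; c] -> u != v -> edge u v.
    by rewrite !inE -!orbA => /or3P[] /eqP-> /or3P[] /eqP->; rewrite ?eqxx // edge_sym.
  have offP (v : H) chi : reflect (forall i, i < 4 -> v != x i) (offt tetra (Ctx x chi) v).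
    apply: (iffP idP) => [|h].
      move=> vn i i4; by apply: contraNneq vn => vE; rewrite vE map_f // mem_iota.
    by apply/mapP => -[i]; rewrite mem_iota => i4 E; move: (h i i4); rewrite E eqxx.
  have [/existsP[i0 /eqP xN]|noN] := boolP [exists i : 'I_4, x i == None].
    exists (fun=> i0 : nat); split => //=.
    move=> i v i4 vo0; have vo := elimT (offP _ _) vo0; move: {vo0} v vo => v vo.
    apply: contraTneq => ->; rewrite xN.
    case: v vo => [v|] // vo; apply/negP => /= vN.
    have nth_lift (j : 'I_3) : exists2 w, x (lift i0 j) = Some w & w \in [set a; b; c] :\ v.
      have := cx i0 (lift i0 j) (ltn_ord _) (ltn_ord _) (neq_lift i0 j); rewrite xN.
      have := vo (lift i0 j) (ltn_ord _).
      case: (x (lift i0 j)) => [w|] //= vw wN; exists w => //.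
      by rewrite !inE in wN *; rewrite wN andbT; apply: contra vw => /eqP->.
    have : #|[set x (lift i0 j) | j : 'I_3]| = 3.
      rewrite card_imset ?card_ord // => j k E; apply: (@lift_inj _ i0); apply: val_inj.
      by apply: xI E; rewrite inE ltn_ord.
    have sub : [set x (lift i0 j) | j : 'I_3] \subset [set Some w | w in [set a; b; c] :\ v].
      by apply/subsetP => _ /imsetP[j _ ->]; have [w -> wN] := nth_lift j; apply: imset_f.
    move=> c3; have := subset_leq_card sub; rewrite c3 card_imset; last exact: Some_inj.
    have := cardsD1 v [set a; b; c]; rewrite vN => E.
    have : #|[set a; b; c]| <= 3.
      by rewrite -setUA cardsU1 cards2; case: (a \notin _); case: (b != c).
    by rewrite E add1n ltnS => le2 le3; have := leq_trans le3 le2.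
  have xS i : i < 4 -> exists y, x i = Some y.
    move=> i4; case E: (x i) => [y|]; first by exists y.
    by case/negP: noN; apply/existsP; exists (Ordinal i4); rewrite /= E.
  pose y i := odflt a (x i).
  have xy i : i < 4 -> x i = Some (y i) by rewrite /y => /xS[w ->].
  have cy : clique4 y by move=> i j i4 j4 ij; have := cx i j i4 j4 ij; rewrite !xy.
  have [chi [_ clt cmono catt]] := IH y cy.
  have offS (v : G) chi' : offt tetra (Ctx x chi') (Some v) = offt tetra (Ctx y chi) v.
    apply/offP/idP => [h|vn i i4].
      apply/mapP => -[i]; rewrite mem_iota => i4 /= E.
      by move: (h i i4); rewrite xy // E eqxx.
    by rewrite xy //; apply: contraNneq vn => -[->]; rewrite (map_f y) // mem_iota.
  have glue (cN : nat) : cN < 4 ->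
      (forall v, v \in [set a; b; c] -> offt tetra (Ctx y chi) v -> chi v = cN) ->
      (forall i, i < 4 -> y i \in [set a; b; c] -> i != cN) ->
      exists chi' : H -> nat, valid edge tetra (Ctx x chi').
    move=> cN4 h1 h2; exists (fun v : H => if v is Some w then chi w else cN); split=> //=.
    - by case=> [v|] //; rewrite offS; apply: clt.
    - case=> [u|] [v|] //; rewrite ?offS.
      + by move=> ou ov; apply: cmono.
      + by move=> ou _ uN; apply: h1.
      + by move=> _ ov vN; apply/esym/h1.
    - move=> i [v|] i4; rewrite ?offS xy //=; last by move=> _; apply: h2.
      by move=> ov; apply: catt.
  have [/existsP[w /andP[wN wo]]|none] :=
      boolP [exists w : G, (w \in [set a; b; c]) && offt tetra (Ctx y chi) w].
    apply: (glue (chi w)) => [|v vN ov|i i4 yN]; first exact: clt.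
      by have [->|vw] := eqVneq v w; last by apply: cmono => //; apply: triN.
    apply: (catt i w i4 wo); apply: triN => //.
    by apply: contraNneq wo => <-; rewrite (map_f y) // mem_iota.
  have [/existsP[i0 i0N]|alli] := boolP [exists i : 'I_4, y i \notin [set a; b; c]].
    apply: (glue i0) => [|v vN ov|i i4 yN]; first exact: ltn_ord.
      by case/negP: none; apply/existsP; exists v; rewrite vN.
    by apply: contraNneq i0N => <-.
  have : #|[set y i | i : 'I_4]| = 4.
    rewrite card_imset ?card_ord // => i j E; apply: val_inj.
    by apply: (clique4_inj cy) E; rewrite inE ltn_ord.
  have sub : [set y i | i : 'I_4] \subset [set a; b; c].
    apply/subsetP => _ /imsetP[i _ ->]; apply: contraT => yN.
    by case/negP: alli; apply/existsP; exists i.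
  move=> c4; have := subset_leq_card sub; rewrite c4.
  by rewrite -setUA cardsU1 cards2; case: (a \notin _); case: (b != c).
- have [chi [_ h1 h2 h3]] := IH (f \o x) (fun i j i4 j4 ij => etrans (ef _ _) (cx i j i4 j4 ij)).
  have offE v : offt tetra (Ctx x (chi \o f)) v = offt tetra (Ctx (f \o x) chi) (f v).
    by rewrite /offt /= !inE !(inj_eq fI).
  exists (chi \o f); split=> /=; first exact: clique4_inj.
  + by move=> v; rewrite offE; apply: h1.
  + by move=> u v; rewrite !offE => ou ov uv; apply: h2; rewrite ?ef.
  + by move=> i v i4; rewrite offE => ov xv; apply: h3; rewrite //= ef.
Qed.

(** * Good pairs *)

Lemma singles_realizes (V : eqType) (e : rel V) d X c p : realizes e d X c p ->
  exists2 p', p' \in singles p & realizes e d X c p'.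
Proof.
case=> szp up ap [ss [szs arcs pc]].
have [ls [lsin szl lsP]] : exists ls : seq nat, [/\
    ls \in foldr (fun (a : larc) r => [seq l :: ls | l <- a.2, ls <- r]) [:: [::]] p.2,
    size ls = size p.2 & forall k, k < size p.2 -> arc_real e d X
      ((nth (0, 0, [::]) p.2 k).1, [:: nth 0 ls k]) (nth [::] ss k)].
  elim: (p.2) (ss) szs arcs => [|a as_ IH] [|s ss'] //=; first by exists [::].
  case=> szs arcs; have [ls [lsin szl lsP]] := IH ss' szs (fun k => arcs k.+1).
  have [i_lt j_lt ua [l la ls0]] := arcs 0 isT.
  exists (l :: ls); split=> /=; last 1 first.
  - case=> [_|k /lsP] //=; split=> //; exists l => //; exact: mem_head.
  - by apply/allpairsP; exists (l, ls).
  - by rewrite szl.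
exists (p.1, [seq (al.1.1, [:: al.2]) | al <- zip p.2 ls]); first by apply/mapP; exists ls.
have szz : size [seq (al.1.1, [:: al.2]) | al <- zip p.2 ls] = size p.2.
  by rewrite size_map size_zip szl minnn.
split; rewrite /= ?szz //; exists ss; split; rewrite ?szz // => k kp.
by rewrite (nth_map ((0, 0, [::]), 0)) ?size_zip ?szl ?minnn // nth_zip //=; apply: lsP.
Qed.

Section Good.
Variables (V : finType) (e : rel V) (L : nat).
Hypotheses (e_sym : symmetric e)
  (L_max : forall c : seq V, 2 < size c -> uniq c -> cycle e c -> size c <= L)
  (L_gt2 : 2 < L).

Definition long (c : seq V) : bool := [&& uniq c, cycle e c & size c == L].

Hypothesis long_share : forall c c', long c -> long c' -> 1 < count (mem c') c.
Hypothesis miss : forall v, exists2 c, long c & v \notin c.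

Lemma long_dec (P : pred (seq V)) :
  (forall c, long c -> P c) \/ exists2 c, long c & ~~ P c.
Proof.
have [/forallP h|/forallPn[c]] := boolP [forall c : L.-tuple V, long c ==> P c].
  left=> c lc; have /and3P[_ _ szc] := lc.
  exact: implyP (h (Tuple szc)) lc.
by rewrite negb_imply => /andP[lc nP]; right; exists (c : seq V).
Qed.

Definition hits (D : {set V}) (c : seq V) : bool := has (mem D) c.

Definition good (S D : {set V}) : Prop :=
  (forall c, long c -> hits D c) \/
  ((forall c, long c -> count (mem S) c <> 2 -> hits D c)
   /\ exists2 c, long c & all (mem (S :|: D)) c).

Definition bad (S D : {set V}) : Prop :=
  exists c, [/\ long c, ~~ hits D c
    & count (mem S) c <> 2 \/ forall c', long c' -> ~~ all (mem (S :|: D)) c'].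

Lemma good_or_bad S D : good S D \/ bad S D.
Proof.
have [h|[N lN nN]] := long_dec (hits D); first by left; left.
have [h1|[c lc]] := long_dec (fun c => (count (mem S) c != 2) ==> hits D c); last first.
  by rewrite negb_imply => /andP[/eqP c2 nc]; right; exists c; split=> //; left.
have [h2|[c lc /negPn ac]] := long_dec (fun c => ~~ all (mem (S :|: D)) c).
  by right; exists N; split=> //; right.
left; right; split; last by exists c.
by move=> c' lc' /eqP c2; apply: implyP (h1 c' lc') c2.
Qed.

Section Context.
Variables (d : dom) (X : ctx V).
Hypotheses (nl0 : 0 < nlab d) (vX : valid e d X).
Let z := (nlab d).-1.

Definition near (l : nat) : {set V} :=
  [set v | has (fun i => att d i l && (v == trm X i)) (iota 0 (nterm d))].
Definition side (l : nat) : {set V} := [set v | offt d X v && (lbl X v == l)].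

Lemma offtPn v : ~~ offt d X v -> exists2 i, i < nterm d & v = trm X i.
Proof. by rewrite negbK => /mapP[i]; rewrite mem_iota => id ->; exists i. Qed.

Lemma near_trm l i : i < nterm d -> (trm X i \in near l) = att d i l.
Proof.
move=> id; rewrite inE; apply/hasP/idP => [[j]|ai]; last first.
  by exists i; rewrite ?mem_iota // ai eqxx.
by rewrite mem_iota => jd /andP[aj /eqP/(v_inj vX id jd)->].
Qed.

Lemma near_off l v : offt d X v -> v \notin near l.
Proof.
move=> ov; rewrite inE; apply/hasPn => i; rewrite mem_iota => id.
by apply: contraL ov => /andP[_ /eqP->]; apply: offt_trm.
Qed.

Lemma inside_near l c : inside d X l c = all (mem (near l :|: side l)) c.
Proof.
apply/andP/allP => [[/allP h1 /allP h2] v vc|h].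
  rewrite /= in_setU; have [ov|] := boolP (offt d X v).
    by rewrite [v \in side l]inE ov; have := h1 v vc; rewrite ov /= => ->; rewrite orbT.
  case/offtPn=> i id E; move: vc; rewrite E => vc; rewrite near_trm //.
  by have := h2 i; rewrite mem_iota vc => /(_ id) /= ->.
split; [apply/allP => v vc|apply/allP => i].
  apply/implyP => ov; have := h v vc; rewrite /= in_setU (negPf (near_off _ ov)) /=.
  by rewrite inE ov.
rewrite mem_iota => id; apply/implyP => /h; rewrite /= in_setU near_trm //.
by rewrite [_ \in side l]inE (negPf (offt_trm X id)) orbF.
Qed.

Lemma avoids_side l c : avoids d X l c = ~~ hits (side l) c.
Proof.
rewrite /hits -all_predC; apply: eq_all => v /=; rewrite inE negb_and.
by case: (offt d X v).
Qed.

Lemma touch_near l c : uniq c -> touch d X l c = count (mem (near l)) c.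
Proof.
move=> uc; rewrite /touch -!size_filter -(size_map (trm X)); apply: perm_size.
apply: uniq_perm; rewrite ?filter_uniq //.
  rewrite map_inj_in_uniq ?filter_uniq ?iota_uniq // => i j; rewrite !mem_filter !mem_iota.
  by case/andP=> _ id /andP[_ jd]; apply: (v_inj vX).
move=> v; rewrite mem_filter /=; apply/mapP/andP => [[i]|[vl vc]].
  by rewrite mem_filter mem_iota => /andP[/andP[ai ic] id] ->; rewrite near_trm.
move: vl; rewrite inE => /hasP[i]; rewrite mem_iota => id /andP[ai /eqP E].
by exists i => //; rewrite mem_filter mem_iota ai -E vc.
Qed.

Lemma path_side u p : path e u p -> all (offt d X) (u :: p) ->
  all (fun v => lbl X v == lbl X u) (u :: p).
Proof.
elim: p u => [|v p IH] u /=; first by rewrite eqxx.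
case/andP=> uv pv /and3P[ou ov op]; rewrite eqxx /=.
by rewrite (v_mono vX ou ov uv); apply: IH => //=; rewrite ov.
Qed.

Lemma one_side c : long c -> count (fun i => trm X i \in c) (iota 0 (nterm d)) <= 1 ->
  exists2 l, l < nlab d & inside d X l c.
Proof.
case/and3P=> uc cc /eqP szc le1.
have offc i v : i < nterm d -> trm X i \in c -> v \in c -> v != trm X i -> offt d X v.
  move=> id ic vc; apply: contraR => /offtPn[j jd E]; move: vc; rewrite E => vc.
  apply/eqP; congr trm; apply/eqP; apply: contraT => ij.
  suff : 1 < count (fun i => trm X i \in c) (iota 0 (nterm d)) by rewrite ltnNge le1.
  rewrite -size_filter; apply: (@uniq_leq_size _ [:: i; j]).
    by rewrite /= inE eq_sym ij.
  by move=> k; rewrite !inE mem_filter mem_iota => /orP[] /eqP->; rewrite ?ic ?vc.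
have [/hasP[t tc nt]|] := boolP (has (fun v => ~~ offt d X v) c).
  have [i id tE] := offtPn nt; have [m r cE] := rot_to tc.
  have memc : c =i t :: r by move=> v; rewrite -cE mem_rot.
  have : cycle e (t :: r) by rewrite -cE rot_cycle.
  have : uniq (t :: r) by rewrite -cE rot_uniq.
  have : size (t :: r) = L by rewrite -cE size_rot.
  case: r cE memc => [|v r] cE memc; first by move: L_gt2 => + E; rewrite -E.
  move=> _ /= /andP[tr _] /andP[tv]; rewrite rcons_path => /andP[pr _].
  have orr : all (offt d X) (v :: r).
    apply/allP => w wr; apply: (offc i w id); rewrite -?tE //; first by rewrite memc inE wr orbT.
    by apply: contraNneq tr => <-.
  have sl := path_side pr orr; have ov : offt d X v by have /andP[] := orr.
  exists (lbl X v); first exact: (v_lab vX).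
  apply/andP; split; [apply/allP => w|apply/allP => j].
    rewrite memc inE => /orP[/eqP->|wr]; first by rewrite (negPf nt).
    by rewrite (allP sl w wr) implybT.
  rewrite mem_iota => jd; apply/implyP; rewrite memc inE => /orP[/eqP E|jr].
    by apply: (v_att vX) => //; rewrite E.
  by have := allP orr _ jr; rewrite (negPf (offt_trm X jd)).
rewrite -all_predC => /allP allo; have {}allo : all (offt d X) c.
  by apply/allP => v /allo /=; rewrite negbK.
case: c uc cc szc {le1 offc} allo => [|v r] uc cc szc allo; first by move: L_gt2; rewrite -szc.
have pr : path e v r by move: cc => /=; rewrite rcons_path => /andP[].
exists (lbl X v); first by apply: (v_lab vX); have /andP[] := allo.
have sl := path_side pr allo.
apply/andP; split; [apply/allP => w wr|apply/allP => j]; first by rewrite (allP sl w wr) implybT.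
rewrite mem_iota => jd; apply/implyP => jr.
by have := allP allo _ jr; rewrite (negPf (offt_trm X jd)).
Qed.

Lemma good_problem : good (near z) (~: (near z :|: side z)) ->
  (forall w, w < z -> bad (near w) (side w)) -> problem e d long X.
Proof.
move=> gz bw.
have hitsE c : hits (~: (near z :|: side z)) c = ~~ inside d X z c.
  rewrite inside_near /hits -has_predC; apply: eq_has => v /=; by rewrite inE.
have out c : long c -> inside d X z c -> touch d X z c = 2.
  move=> lc ic; have /and3P[uc _ _] := lc; rewrite touch_near //.
  have nh : ~~ hits (~: (near z :|: side z)) c by rewrite hitsE negbK.
  case: gz => [/(_ c lc)|[/(_ c lc) h _]]; first by rewrite (negPf nh).
  by apply/eqP; apply: contraNT nh => /eqP; apply: h.
split=> //.
- move=> c lc; rewrite ltnNge; apply/negP => le1.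
  have [l lnl ic] := one_side lc le1; have /and3P[uc _ _] := lc.
  have [E|lz] := eqVneq l z.
    have := out c lc; rewrite -E ic => /(_ isT) t2.
    have : touch d X l c <= count (fun i => trm X i \in c) (iota 0 (nterm d)).
      by apply: sub_count => i /andP[].
    by rewrite t2 => /leq_trans/(_ le1).
  have lltz : l < z by rewrite ltn_neqAle lz /z -ltnS prednK.
  have [N [lN nN _]] := bw l lltz.
  have := long_share lN lc; rewrite ltnNge => /negP; apply; apply: leq_trans le1.
  rewrite -!size_filter -(size_map (trm X)); apply: uniq_leq_size.
    by apply: filter_uniq; have /and3P[] := lN.
  move=> v; rewrite mem_filter => /andP[/= vc vN].
  have [ov|/offtPn[i id E]] := boolP (offt d X v).
    case/negP: nN; apply/hasP; exists v => //=; rewrite inE ov /=.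
    by case/andP: ic => /allP/(_ v vc); rewrite ov.
  by rewrite E map_f // mem_filter mem_iota -E vc.
- case: gz => [h|[_ [c lc ac]]]; [left=> c lc|right; exists c => //].
    by rewrite -hitsE; apply: h.
  rewrite avoids_side; apply/hasPn => v vc; apply/negP => /= vs.
  have := allP ac v vc; rewrite /= in_setU in_setC in_setU vs orbT orbF => vn.
  by move: vs; rewrite inE => /andP[/(near_off z)]; rewrite vn.
- move=> w /bw[c [lc nc h]]; exists c; rewrite avoids_side; split=> //.
  have /and3P[uc _ _] := lc.
  case: h => [h|h]; [left; rewrite touch_near // | right=> c' lc'].
  by rewrite inside_near h.
Qed.

End Context.

Lemma long_props c : long c -> [/\ uniq c, cycle e c & size c = L].
Proof. by case/and3P=> uc cc /eqP. Qed.

Lemma no_tri X : ~ problem e tri long X.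
Proof.
apply: (no_problem _ e_sym L_max (ltnW L_gt2) long_props long_share _ tri_checked) => //.
exact: singles_realizes.
Qed.

Lemma no_tetra X : ~ problem e tetra long X.
Proof.
apply: (no_problem _ e_sym L_max (ltnW L_gt2) long_props long_share _ tetra_checked) => //.
by move=> Y c p rp; exists p; rewrite ?mem_head.
Qed.

End Good.

Lemma triangle_exists (H : sgraph) : three_tree H -> exists a b c : H, triangle a b c.
Proof.
elim=> {H} [|G a b c tG _ ab bc ac|G H tG [a [b [c [ab bc ac]]]] [f _ ef]].
- by exists (@Ordinal 3 0 isT), (@Ordinal 3 1 isT), (@Ordinal 3 2 isT).
- by exists (Some a), (Some b), (Some c).
- by exists (f a), (f b), (f c); split; rewrite ef.
Qed.

Lemma closed_offP (G : sgraph) (S Z : {set G}) :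
  reflect (closed_off S Z) ([disjoint Z & S]
    && [forall u in Z, forall v, (v \notin S) && edge u v ==> (v \in Z)]).
Proof.
apply: (iffP andP) => [[dZ /forall_inP h]|[dZ h]]; split=> //.
  by move=> u v uZ vS uv; have /forallP/(_ v) := h u uZ; rewrite vS uv.
by apply/forall_inP => u uZ; apply/forallP => v; apply/implyP => /andP[vS uv]; apply: (h u).
Qed.

Section Descent.
Variables (H : sgraph) (e : rel H) (L : nat).
Hypotheses (tH : three_tree H) (e_sym : symmetric e)
  (e_sub : forall u v, e u v -> edge u v)
  (L_max : forall c : seq H, 2 < size c -> uniq c -> cycle e c -> size c <= L)
  (L_gt2 : 2 < L)
  (long_share : forall c c', long e L c -> long e L c' -> 1 < count (mem c') c)
  (miss : forall v, exists2 c, long e L c & v \notin c).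

Lemma valid_sub d X : valid edge d X -> valid e d X.
Proof.
case=> h1 h2 h3 h4; split=> //; first by move=> u v ou ov /e_sub; apply: h3.
by move=> i v id ov /e_sub; apply: h4.
Qed.

Lemma split_bad (a b c : H) (A D : {set H}) : triangle a b c ->
  closed_off [set a; b; c] D -> closed_off [set a; b; c] A -> A \subset D ->
  good e L [set a; b; c] D -> bad e L [set a; b; c] A -> bad e L [set a; b; c] (D :\: A) ->
  False.
Proof.
move=> [ab bc ac] [dD cD] [dA cA] /subsetP AD gD bA bB.
pose X := Ctx (fun i => nth a [:: a; b; c] i)
              (fun v => if v \in A then 0 else if v \in D then 1 else 2).
have offE v : offt tri X v = (v \notin [set a; b; c]) by rewrite /offt /= !inE -orbA.
have nearE l : near tri X l = [set a; b; c].
  by apply/setP => v; rewrite !inE /= orbF orbA.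
have vX : valid e tri X.
  split=> //.
  - move=> i j; rewrite !inE /= => i3 j3 E; apply/eqP.
    by rewrite -(nth_uniq a (s := [:: a; b; c])) ?E //= !inE negb_or !edge_neq.
  - by move=> v _ /=; case: ifP => // _; case: ifP.
  - move=> u v; rewrite !offE => ou ov /= uv.
    have cl (Z : {set H}) : closed_off [set a; b; c] Z -> (u \in Z) = (v \in Z).
      case=> _ cZ; apply/idP/idP => [uZ|vZ]; first exact: cZ uZ ov (e_sub uv).
      by apply: cZ vZ ou _; rewrite edge_sym e_sub.
    by rewrite !cl.
apply: (@no_tri _ e L e_sym L_max L_gt2 long_share X).
apply: good_problem => //.
- rewrite nearE (_ : ~: _ = D) //; apply/setP => v; rewrite in_setC in_setU [v \in side _ _ _]inE offE.
  have [vS|_] := boolP (v \in [set a; b; c]); first by rewrite /= (disjointFl dD vS).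
  rewrite /=; have [vA|_] := boolP (v \in A); first by rewrite AD.
  by case: (v \in D).
- have sideE w : w < 2 -> side tri X w = if w == 0 then A else D :\: A.
    move=> w2; apply/setP => v; rewrite [LHS]inE offE /=.
    have [vA|vA] := boolP (v \in A).
      rewrite (disjointFr dA vA) /=; case: w w2 => [|[|]] //= _; rewrite ?vA //.
      by rewrite inE vA.
    have [vD|vD] := boolP (v \in D).
      rewrite (disjointFr dD vD) /=; case: w w2 => [|[|]] //= _; rewrite ?(negPf vA) //.
      by rewrite inE vA vD.
    rewrite andbC; case: w w2 => [|[|]] //= _; rewrite ?(negPf vA) // inE (negPf vD).
    by rewrite andbF.
  by case=> [|[|]] //= _; rewrite nearE sideE.
Qed.

Lemma no_good n (a b c : H) (D : {set H}) : #|D| < n -> triangle a b c ->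
  closed_off [set a; b; c] D -> ~ good e L [set a; b; c] D.
Proof.
elim: n a b c D => // n IH a b c D; rewrite ltnS => szD tr clD gD.
have IHb (a' b' c' : H) (D' : {set H}) : #|D'| < #|D| -> triangle a' b' c' ->
    closed_off [set a'; b'; c'] D' -> bad e L [set a'; b'; c'] D'.
  move=> szD' tr' cl'; case: (good_or_bad e L [set a'; b'; c'] D') => // g'.
  by case: (IH _ _ _ _ (leq_trans szD' szD) tr' cl' g').
have [/existsP[A /and3P[/closed_offP clA A0 AD]]|conn] := boolP [exists A : {set H},
    [&& ([disjoint A & [set a; b; c]]
    && [forall u in A, forall v, (v \notin [set a; b; c]) && edge u v ==> (v \in A)]),
      A != set0 & A \proper D]].
  have subAD := proper_sub AD.
  have clB : closed_off [set a; b; c] (D :\: A).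
    case: clD clA => dD cD [dA cA]; split; first by apply: disjointWl dD; apply: subsetDl.
    move=> u v /setDP[uD uA] vS uv; rewrite inE (cD u) // andbT.
    apply: contra uA => vA; apply: (cA v) => //; last by rewrite edge_sym.
    by rewrite (disjointFr dD uD).
  apply: (split_bad tr clD clA subAD gD).
    by apply: IHb => //; apply: proper_card.
  apply: IHb => //; apply: proper_card; apply/properP; split; first exact: subsetDl.
  case/set0Pn: A0 => v vA; exists v; first exact: (subsetP subAD).
  by rewrite inE vA.
have {}conn A : closed_off [set a; b; c] A -> A \subset D -> A != set0 -> A = D.
  move=> /closed_offP clA AD A0; apply/eqP; move: conn; rewrite negb_exists => /forallP/(_ A).
  rewrite A0 clA /= properE AD /= negbK => DA.
  by rewrite eqEsubset AD.
have D0 : D != set0.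
  apply/eqP => DE; have [c0 lc0 _] := miss a.
  have nh c1 : ~~ hits D c1 by rewrite /hits DE; apply/hasPn => v _ /=; rewrite inE.
  case: gD => [/(_ c0 lc0)|[h [c1 lc1 ac1]]]; first by rewrite (negPf (nh _)).
  have : hits D c1; last by rewrite (negPf (nh _)).
  apply: h => //; rewrite DE setU0 all_count in ac1; rewrite (eqP ac1).
  by case/and3P: lc1 => _ _ /eqP ->; move: L_gt2; lia.
have [x3 x3D [ax bx cx]] := apex tH tr clD D0.
have [ab bc ac] := tr; have [dD cD] := clD.
pose x i := nth a [:: a; b; c; x3] i.
have cl4 : clique4 x.
  by case=> [|[|[|[|i]]]] [|[|[|[|j]]]] //= _ _ _; rewrite /x //= edge_sym.
have [chi vH] := sides tH cl4; set X := Ctx x chi in vH.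
have vX := valid_sub vH.
have near3 : near tetra X 3 = [set a; b; c] by apply/setP => v; rewrite !inE /= orbF orbA.
have offS v : offt tetra X v -> v \notin [set a; b; c] by rewrite -near3; apply: near_off.
have clside w : closed_off (near tetra X w) (side tetra X w).
  split.
    apply/pred0P => v /=; apply/negP => /andP[]; rewrite inE => /andP[ov _].
    by apply/negP/near_off.
  move=> u v; rewrite inE => /andP[ou /eqP uw] vn uv; rewrite inE.
  have [ov|/offtPn[i id E]] := boolP (offt tetra X v).
    by rewrite -(v_mono vH ou ov uv) uw eqxx.
  case/negP: vn; rewrite E (near_trm vX) // -uw; apply: (v_att vH) => //.
  by rewrite -E edge_sym.
have side3 v : v \in D -> v \notin side tetra X 3.
  move=> vD; apply/negP => vs; pose Z := D :&: side tetra X 3.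
  suff ZD : Z = D.
    have : x3 \in Z by rewrite ZD.
    by rewrite !inE /offt /= !inE eqxx !orbT /= andbF.
  apply: conn; rewrite ?subsetIl //; last by apply/set0Pn; exists v; rewrite inE vD.
  split; first by apply: disjointWl dD; apply: subsetIl.
  move=> u w /setIP[uD us] wS uw; rewrite inE (cD u) //=.
  by have [_ h] := clside 3; apply: (h u) => //; rewrite near3.
have sideD w : w < 3 -> triangle (x (nth 0 [:: 1; 0; 0] w)) (x (nth 0 [:: 2; 2; 1] w)) x3
    /\ near tetra X w = [set x (nth 0 [:: 1; 0; 0] w); x (nth 0 [:: 2; 2; 1] w); x3].
  case: w => [|[|[|]]] //= _; (split; first by split);
  by apply/setP => v; rewrite !inE /= ?orbF ?orbA.
have sub_side w : w < 3 -> side tetra X w \proper D.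
  move=> w3; have [trw nE] := sideD w w3; have [dw cw] := clside w.
  apply/properP; split; last by exists x3 => //; rewrite inE /offt /= !inE eqxx !orbT.
  apply/subsetP => v vs; apply: contraT => vD; pose Z := side tetra X w :\: D.
  have clZ : closed_off (near tetra X w) Z.
    split; first by apply: disjointWl dw; apply: subsetDl.
    move=> u y /setDP[us uD] yn uy; rewrite inE (cw u) // andbT.
    apply: contra uD => yD; apply: (cD y) => //; last by rewrite edge_sym.
    by apply: offS; move: us; rewrite inE => /andP[].
  rewrite nE in clZ; have [|y /setDP[ys /negP yD] [_ _ xy]] := apex tH trw clZ.
    by apply/set0Pn; exists v; rewrite inE vD.
  case: yD; apply: (cD x3) => //; apply: offS.
  by move: ys; rewrite inE => /andP[].
apply: (@no_tetra _ e L e_sym L_max L_gt2 long_share X).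
apply: good_problem => //.
- rewrite near3 (_ : ~: _ = D) //; apply/setP => v; rewrite in_setC in_setU.
  have [vS|vS] := boolP (v \in [set a; b; c]); first by rewrite (disjointFl dD vS).
  have [vD|vD] := boolP (v \in D); first exact: side3.
  apply/negbTE; rewrite /= negbK; apply: contraR vD => vs.
  have [ov|/offtPn[i i4 E]] := boolP (offt tetra X v).
    have lv := v_lab vX ov.
    have l3 : lbl X v < 3.
      rewrite ltn_neqAle -ltnS lv andbT; apply: contra vs => /eqP l3.
      by rewrite inE ov l3 eqxx.
    by apply: (subsetP (proper_sub (sub_side _ l3))); rewrite inE ov eqxx.
  move: E vS; case: i i4 => [|[|[|[|]]]] //= _ ->; rewrite ?inE ?eqxx ?orbT //.
- move=> w w3; have [trw nE] := sideD w w3; have := clside w; rewrite nE => clw.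
  by apply: IHb => //; apply: proper_card; apply: sub_side.
Qed.

Lemma triangle_long : L <> 3.
Proof.
move=> L3.
have adj c u v : long e L c -> u \in c -> v \in c -> u != v -> e u v.
  case/and3P=> _ cc /eqP szc; case: c cc szc => [|p [|q [|r [|]]]]; rewrite L3 //=.
  case/and4P=> pq qr rp _ _; rewrite !inE.
  by case/or3P=> /eqP->; case/or3P=> /eqP->; rewrite ?eqxx // => _; rewrite // e_sym.
have [a _] := triangle_exists tH.
have [c lc _] := miss a.
have /and3P[uc _ /eqP szc] := lc.
case E: c szc => [|v r]; first by rewrite L3.
move=> _; have vc : v \in c by rewrite E mem_head.
have [c' lc' vc'] := miss v; have /and3P[uc' _ /eqP szc'] := lc'.
have := long_share lc lc'; rewrite -size_filter.
have : uniq [seq y <- c | mem c' y] by rewrite filter_uniq.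
have : {subset [seq y <- c | mem c' y] <= c} by apply: mem_subseq; apply: filter_subseq.
have : all (mem c') [seq y <- c | mem c' y] by apply: filter_all.
case: [seq y <- c | mem c' y] => [|p [|q s]] //= /and3P[pc' qc' _] sub.
rewrite inE negb_or -!andbA => /and3P[pq _ _] _.
have pc : p \in c by apply: sub; rewrite mem_head.
have qc : q \in c by apply: sub; rewrite !inE eqxx orbT.
have : ~~ all (mem [:: p; q]) c'.
  apply/negP => /allP h; have := uniq_leq_size uc' h; rewrite szc' L3.
  by [].
case/allPn=> w wc'; rewrite /= !inE negb_or => /andP[wp wq].
have vp : v != p by apply: contraNneq vc' => ->.
have vq : v != q by apply: contraNneq vc' => ->.
have vw : v != w by apply: contraNneq vc' => ->.
suff : size [:: v; p; w; q] <= L by rewrite L3.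
apply: L_max => //.
  by rewrite /= !inE !negb_or vp vw vq (eq_sym p w) wp pq wq.
rewrite /= andbT (adj c) //= (adj c') //; last by rewrite eq_sym.
by rewrite (adj c' w q) //= (adj c) // eq_sym.
Qed.

Lemma no_miss : False.
Proof.
have [a [b [c tr]]] := triangle_exists tH.
have L4 : 3 < L by have := triangle_long; move: L_gt2; lia.
apply: (@no_good #|~: [set a; b; c]|.+1 a b c (~: [set a; b; c]) _ tr) => //.
  split; first by rewrite -setI_eq0 setIC setICr.
  by move=> u v _ vS _; rewrite inE.
left=> d /and3P[ud _ /eqP szd]; rewrite /hits; apply: contraLR L4 => /hasPn h.
rewrite -leqNgt -szd -(card_uniqP ud).
apply: leq_trans (_ : #|[set a; b; c]| <= 3).
  by apply: subset_leq_card; apply/subsetP => v /h; rewrite /= inE negbK.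
by rewrite -setUA cardsU1 cards2; case: (a \notin _); case: (b != c).
Qed.

End Descent.

(** * Longest cycles in 2-connected graphs *)

Lemma perm_ear (T : eqType) (w y : T) (s t r : seq T) :
  perm_eq (w :: (s ++ y :: t) ++ r) (s ++ y :: t ++ w :: r).
Proof. by apply/permP => a; rewrite /= !count_cat /= !count_cat /=; lia. Qed.

Section Linkage.
Variables (V : finType) (e : rel V).
Hypothesis e_sym : symmetric e.

Definition link_path (A B : pred V) (y : V) (q : seq V) : Prop :=
  [/\ path e y q, uniq (y :: q), A y && B (last y q),
      forall v, v \in y :: q -> A v -> v = y
    & forall v, v \in y :: q -> B v -> v = last y q].

Lemma trim (A B : pred V) x p : path e x p -> A x -> B (last x p) ->
  exists y q, link_path A B y q /\ {subset y :: q <= x :: p}.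
Proof.
have [n] := ubnP (size p); elim: n x p => // n IH x p; rewrite ltnS => szp.
case/shortenP=> p' pp' up' sub Ax Bp.
have szp' : size p' <= n.
  have [_ s1] : uniq (x :: p') /\ uniq p' by split=> //; have /andP[] := up'.
  by apply: leq_trans szp; apply: uniq_leq_size.
have subx : {subset x :: p' <= x :: p}.
  by move=> v; rewrite !inE => /orP[->//|/sub ->]; rewrite orbT.
have [/hasP[z zp Az]|/hasPn nA] := boolP (has A p').
  case/splitPr: p' / zp pp' up' sub Bp szp' subx => p1 p2.
  rewrite cat_path last_cat => /andP[_ /= /andP[_ pz]] _ _ Bp szp' subx.
  have [|y [q [lq sq]]] := IH z p2 _ pz Az Bp.
    by move: szp'; rewrite size_cat /=; lia.
  exists y, q; split=> // v /sq vz; apply: subx.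
  by rewrite inE mem_cat vz !orbT.
have [/hasP[z zp /andP[Bz zl]]|/hasPn nB] := boolP (has (fun z => B z && (z != last x p')) (x :: p')).
  move: zp; rewrite inE => /orP[/eqP zx|zp].
    exists x, [::]; split; last by move=> v; rewrite !inE => /eqP->; rewrite eqxx.
    by split=> //=; rewrite ?Ax -?zx ?Bz // => v; rewrite !inE => /eqP.
  case/splitPr: p' / zp pp' up' zl Bp sub szp' subx nA => p1 p2.
  rewrite -cat_rcons cat_path => /andP[pz _] _ zl _ _ szp' subx _.
  have [||y [q [lq sq]]] := IH x (rcons p1 z) _ pz Ax; rewrite ?last_rcons //.
    move: szp' zl; rewrite size_cat size_rcons; case: (p2) => [|? ?] /=; last by lia.
    by rewrite cats0 last_rcons eqxx.
  exists y, q; split=> // v /sq; rewrite inE => /orP[/eqP->|vz].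
    by apply: subx; rewrite mem_head.
  by apply: subx; rewrite inE mem_cat vz orbT.
exists x, p'; split=> //; split=> //; first by rewrite Ax.
  by move=> v; rewrite inE => /orP[/eqP->//|/nA /negP].
by move=> v vp Bv; have := nB v vp; rewrite Bv /= negbK => /eqP.
Qed.

Hypothesis conn1 : forall w a b, a != w -> b != w ->
  connect [rel x y | [&& x != w, y != w & e x y]] a b.

Lemma avoiding_path (A B : pred V) w a b : A a -> a != w -> B b -> b != w ->
  exists y q, link_path [pred v | A v && (v != w)] [pred v | B v && (v != w)] y q
    /\ w \notin y :: q.
Proof.
move=> Aa aw Bb bw; case/connectP: (conn1 aw bw) => p pp bE.
have pe : path e a p by apply: sub_path pp => x y /and3P[].
have wp : w \notin a :: p.
  rewrite inE eq_sym negb_or aw /=; elim: p a {aw Aa bE pe} pp => //= x p IH a.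
  by case/andP=> /and3P[_ xw _] /IH; rewrite inE negb_or eq_sym xw.
have [||y [q [lq sq]]] := trim (A := [pred v | A v && (v != w)])
  (B := [pred v | B v && (v != w)]) pe; rewrite /= ?Aa ?aw // -?bE ?Bb ?bw //.
exists y, q; split=> //; by apply: contra wp => /sq.
Qed.

Section Fan.
Variable B : pred V.
Hypothesis B2 : exists b b', [/\ B b, B b' & b != b'].

Lemma B_neq w : exists2 b, B b & b != w.
Proof.
have [b [b' [Bb Bb' bb']]] := B2; have [E|] := eqVneq b w; last by exists b.
by exists b' => //; rewrite -E eq_sym.
Qed.

(* For [w] in [B], both sides of the ear are empty. *)
Definition ear (w : V) (s1 s2 : seq V) : Prop :=
  [/\ path e w s1, path e w s2, uniq (w :: s1 ++ s2),
      B (last w s1) /\ (forall v, v \in w :: s1 -> B v -> v = last w s1)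
    & B (last w s2) /\ (forall v, v \in w :: s2 -> B v -> v = last w s2)].

Lemma ear_sym w s1 s2 : ear w s1 s2 -> ear w s2 s1.
Proof.
case=> p1 p2 u b1 b2; split=> //.
by rewrite -(perm_uniq (_ : perm_eq (w :: s1 ++ s2) _)) // perm_cons perm_catC.
Qed.

Lemma ear_nil w s1 s2 : ear w s1 s2 -> B w -> s1 = [::] /\ s2 = [::].
Proof.
case=> _ _ u [_ h1] [_ h2] Bw.
have /andP[] := u; rewrite mem_cat negb_or => /andP[w1 w2] _.
split.
  case: s1 h1 w1 {u} => // a s h1; rewrite (h1 w (mem_head _ _) Bw) /= mem_last //.
by case: s2 h2 w2 {u} => // a s h2; rewrite (h2 w (mem_head _ _) Bw) /= mem_last.
Qed.

Definition linked (A : pred V) (w : V) : Prop :=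
  exists y q y' q', [/\ link_path A B y q, link_path A B y' q',
    ~~ has (mem (y :: q)) (y' :: q') & B w -> y' = w /\ q' = [::]].

Lemma link_tail (A : pred V) w s1 s2 z s : A w -> ear w s1 s2 ->
  (forall v, v \in s1 ++ s2 -> ~~ A v) ->
  path e z s -> uniq (z :: s) -> A z -> w \notin z :: s ->
  (forall v, v \in z :: s -> A v -> v = z) ->
  (forall v, v \in z :: s -> (v \in s1 ++ s2) || B v -> v = last z s) ->
  last z s \in s1 -> linked A w.
Proof.
move=> Aw ea nA pz uz Az wz zA zT ys1.
have [p1 p2 u [b1 b1'] [b2 b2']] := ea.
have Bwn : ~ B w by move=> /(ear_nil ea)[E _]; rewrite E in ys1.
move: {ea} p1 p2 u b1 b1' b2 b2' nA zT => p1 p2 u b1 b1' b2 b2' nA zT.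
case/splitPr: s1 / ys1 p1 u b1 b1' nA zT => s1a s1b.
rewrite cat_path => /andP[_ /= /andP[_ p1b]] u b1 b1' nA zT.
have {}b1 : B (last (last z s) s1b) by rewrite last_cat /= in b1.
exists z, (s ++ s1b), w, s2.
have us : uniq (s1a ++ (last z s :: s1b ++ w :: s2)).
  by rewrite -(perm_uniq (perm_ear w (last z s) s1a s1b s2)).
have {us} : uniq (last z s :: s1b ++ w :: s2) by move: us; rewrite cat_uniq => /and3P[].
rewrite /= mem_cat negb_or => /andP[/andP[ls1b lws2]]; rewrite cat_uniq => /and3P[us1b dis us2].
have sT v : v \in s1b -> v \in (s1a ++ last z s :: s1b) ++ s2.
  by move=> vs; rewrite !mem_cat inE vs !orbT.
have s1b_z v : v \in s1b -> v \notin z :: s.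
  move=> vs; apply/negP => vz; have E := zT v vz; move: E; rewrite (sT v vs) => /(_ isT) E.
  by move: ls1b; rewrite -E vs.
split.
- split.
  + by rewrite cat_path pz.
  + rewrite -cat_cons cat_uniq uz us1b andbT; apply/hasPn => v; exact: s1b_z.
  + by rewrite Az last_cat.
  + move=> v; rewrite -cat_cons mem_cat => /orP[/zA//|vs Av].
    by have := nA v (sT v vs); rewrite Av.
  + move=> v; rewrite -cat_cons mem_cat last_cat => /orP[vz Bv|vs Bv].
      have E : v = last z s by apply: zT; rewrite ?Bv ?orbT.
      have := b1' v _ Bv; rewrite last_cat /=; apply.
      by rewrite E inE mem_cat mem_head !orbT.
    have := b1' v _ Bv; rewrite last_cat /=; apply.
    by rewrite inE mem_cat inE vs !orbT.
- split=> //; first by rewrite Aw.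
  move=> v; rewrite inE => /orP[/eqP//|vs Av].
  by have := nA v _; rewrite mem_cat vs orbT Av => /(_ isT).
- change (~~ has (mem (z :: s ++ s1b)) (w :: s2)); apply/hasPn => v vw; change (v \notin (z :: s) ++ s1b); rewrite mem_cat negb_or.
  apply/andP; split; last exact: (hasPn dis v vw).
  move: vw; rewrite inE => /orP[/eqP->//|vs2]; apply/negP => vz.
  have := zT v vz; rewrite mem_cat vs2 orbT => /(_ isT) E.
  by move: lws2; rewrite inE -E vs2 orbT.
- by move/Bwn.
Qed.

Lemma ear_linked (A : pred V) w s1 s2 : A w -> (exists2 a, A a & a != w) ->
  ear w s1 s2 -> linked A w.
Proof.
move=> Aw [a Aa aw] ea; have [p1 p2 u [b1 b1'] [b2 b2']] := ea.
have [y [q [l1 sub1]]] := trim p1 Aw b1.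
have [y' [q' [l2 sub2]]] := trim p2 Aw b2.
have disj12 v : v \in s1 -> v \notin s2.
  by move: u; rewrite /= cat_uniq => /and4P[_ _ /hasPn h _] v1; apply: contraL v1 => /h.
have w12 : w \notin s1 ++ s2 by have /andP[] := u.
have [E|ne] := boolP ((y == w) && (y' == w)); last first.
  have wq : ~~ ((w \in y :: q) && (w \in y' :: q')).
    apply: contra ne => /andP[wy wy']; case: l1 l2 => [_ _ _ h1 _] [_ _ _ h2 _].
    by rewrite -(h1 w wy Aw) -(h2 w wy' Aw) eqxx.
  exists y, q, y', q'; split=> //; last first.
    move=> Bw; have [E1 E2] := ear_nil ea Bw; case/negP: ne.
    have := sub1 y (mem_head _ _); have := sub2 y' (mem_head _ _).
    by rewrite E1 E2 !inE => -> ->.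
  apply/hasPn => v /= v2; apply/negP => v1.
  have := sub1 v v1; have := sub2 v v2; rewrite !inE => /orP[/eqP E|vs2].
    by move=> _; case/negP: wq; rewrite -E v1.
  case/orP => [/eqP E|/disj12]; last by rewrite vs2.
  by move: w12; rewrite mem_cat -E vs2 orbT.
case/andP: E => /eqP yw /eqP yw'; subst y y'.
have ea' : ear w q q'.
  case: l1 l2 => [p1' u1 /andP[_ B1] _ h1] [p2' u2 /andP[_ B2'] _ h2]; split=> //.
  have uq' : uniq q' by have /andP[] := u2.
  rewrite -cat_cons cat_uniq u1 uq' andbT.
  apply/hasPn => v v2; apply/negP; rewrite /= => v1.
  have := sub2 v _; rewrite inE v2 orbT => /(_ isT); rewrite inE => /orP[/eqP E|vs2].
    by move: u2; rewrite /= -E v2.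
  have := sub1 v v1; rewrite inE => /orP[/eqP E|/disj12]; last by rewrite vs2.
  by move: w12; rewrite mem_cat -E vs2 orbT.
have nA v : v \in q ++ q' -> ~~ A v.
  rewrite mem_cat => vq; apply/negP => Av.
  case: l1 l2 => [_ u1 _ h1 _] [_ u2 _ h2 _]; case/orP: vq => vq.
    have E : v = w by apply: h1; rewrite // inE vq orbT.
    by move: u1; rewrite /= -E vq.
  have E : v = w by apply: h2; rewrite // inE vq orbT.
  by move: u2; rewrite /= -E vq.
have [b Bb bw] := B_neq w.
have [z [s [[pz uz /andP[/andP[Az _] /andP[Tz zw]] hA hT] wz]]] :=
  avoiding_path (A := A) (B := [pred v | (v \in q ++ q') || B v]) Aa aw
    (b := b) (introT orP (or_intror Bb)) bw.
have zA v : v \in z :: s -> A v -> v = z.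
  by move=> vz Av; apply: hA; rewrite //= Av; apply: contraNneq wz => <-.
have zT v : v \in z :: s -> (v \in q ++ q') || B v -> v = last z s.
  by move=> vz Tv; apply: hT; rewrite //= Tv; apply: contraNneq wz => <-.
move: Tz; rewrite /= mem_cat -orbA => /or3P[zq|zq|Bz].
- exact: (link_tail Aw ea' nA pz uz Az wz zA zT zq).
- apply: (link_tail Aw (ear_sym ea') _ pz uz Az wz zA _ zq) => v.
    by rewrite mem_cat orbC -mem_cat; apply: nA.
  by move=> vz; rewrite mem_cat orbC [X in _ || X]orbC -mem_cat orbC; apply: zT.
have [zq|zq] := boolP (last z s \in q ++ q').
  move: zq; rewrite mem_cat => /orP[] zq.
    exact: (link_tail Aw ea' nA pz uz Az wz zA zT zq).
  apply: (link_tail Aw (ear_sym ea') _ pz uz Az wz zA _ zq) => v.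
    by rewrite mem_cat orbC -mem_cat; apply: nA.
  by move=> vz; rewrite mem_cat orbC [X in _ || X]orbC -mem_cat orbC; apply: zT.
exists z, s, w, q; split=> //; last by move=> Bw; have [-> _] := ear_nil ea' Bw.
  by split=> //; [rewrite Az | move=> v vz Bv; apply: zT; rewrite ?Bv ?orbT].
apply/hasPn => v vq; apply/negP => vz; move: vq; rewrite inE => /orP[/eqP E|vq].
  by move/negP: wz; rewrite -E; apply.
have vqq : v \in q ++ q' by rewrite mem_cat vq.
have E := zT v vz; move: zq; rewrite -E vqq //; exact.
Qed.

Lemma ear_step w v s1 s2 : ear w s1 s2 -> e w v -> v != w -> exists t1 t2, ear v t1 t2.
Proof.
move=> ea wv vw.
have [Bv|Bv] := boolP (B v).
  by exists [::], [::]; split=> //=; split=> // u; rewrite inE => /eqP.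
have Aw : [pred u | (u == w) || (u == v)] w by rewrite /= eqxx.
have A2 : exists2 a, [pred u | (u == w) || (u == v)] a & a != w.
  by exists v; rewrite //= eqxx orbT.
have [y [q [y' [q' [[p1 u1 /andP[A1 B1] a1 b1] [p2 u2 /andP[A2' B2'] a2 b2] dis _]]]]] :=
  ear_linked Aw A2 ea.
have yy : y != y'.
  by apply: contra dis => /eqP <-; apply/hasP; exists y; apply: mem_head.
have ear_v z t z' t' : path e z t -> path e z' t' -> uniq (z :: t) -> uniq (z' :: t') ->
    ~~ has (mem (z :: t)) (z' :: t') -> z = v -> z' = w -> B (last z t) -> B (last z' t') ->
    (forall u, u \in z :: t -> B u -> u = last z t) ->
    (forall u, u \in z' :: t' -> B u -> u = last z' t') -> exists t1 t2, ear v t1 t2.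
  move=> pt pt' ut ut' d zv zw' Bl Bl' h h'; subst z z'.
  exists t, (w :: t'); split=> //=.
  - by rewrite e_sym wv.
  - by rewrite -/(uniq (v :: t ++ w :: t')) -cat_cons cat_uniq ut d.
  - split=> // u; rewrite inE => /orP[/eqP->|]; last exact: h'.
    by rewrite (negPf Bv).
case/orP: A1 => /eqP E1; case/orP: A2' => /eqP E2.
- by move: yy; rewrite E1 E2 eqxx.
- by apply: (ear_v y' q' y q) => //; rewrite has_sym.
- exact: (ear_v y q y' q').
- by move: yy; rewrite E1 E2 eqxx.
Qed.

Lemma ear_all w : (forall a, connect e a w) -> exists s1 s2, ear w s1 s2.
Proof.
move=> cw; have [b [_ [Bb _ _]]] := B2; case/connectP: (cw b) => p pp ->.
have : exists s1 s2, ear b s1 s2.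
  by exists [::], [::]; split=> //=; split=> // u; rewrite inE => /eqP.
elim: p b {Bb} pp => //= v p IH b /andP[bv pv] [s1 [s2 ea]]; apply: IH pv _.
have [->|vb] := eqVneq v b; first by exists s1, s2.
exact: ear_step ea bv vb.
Qed.

End Fan.

Lemma cycle_arc c b b' : uniq c -> cycle e c -> b \in c -> b' \in c -> b != b' ->
  exists t, [/\ path e b (rcons t b'), uniq (b :: b' :: t), {subset t <= c}
    & size c <= 2 * size t + 2].
Proof.
move=> uc cc bc; have [m r cE] := rot_to bc.
have : cycle e (b :: r) by rewrite -cE rot_cycle.
have : uniq (b :: r) by rewrite -cE rot_uniq.
have : size (b :: r) = size c by rewrite -cE size_rot.
have memc : c =i b :: r by move=> v; rewrite -cE mem_rot.
rewrite memc inE => szc ur cr /orP[/eqP->|b'r] bb'; first by rewrite eqxx in bb'.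
case/splitPr: r / b'r szc ur cr memc {cE} => r1 r2 szc ur cr memc.
have sub t : {subset t <= r1 ++ r2} -> {subset t <= c}.
  move=> h v /h; rewrite memc inE !mem_cat inE => /orP[->|->]; by rewrite !orbT.
have uu : uniq (b :: b' :: r1 ++ r2).
  by rewrite -(perm_uniq (_ : perm_eq (b :: r1 ++ b' :: r2) _)) // perm_cons -cat1s perm_catCA.
have [le|lt] := leqP (size r2) (size r1).
  exists r1; split.
  - by rewrite rcons_path; move: cr; rewrite /= rcons_cat cat_path /= => /and3P[-> ->].
  - by move: uu; rewrite -!cat_cons cat_uniq => /andP[].
  - by apply: sub => v; rewrite mem_cat => ->.
  - by rewrite -szc /= size_cat /=; move: (size r1) (size r2) le => m1 m2; clear; lia.
exists (rev r2); split.
- move: cr; rewrite /= rcons_cat cat_path /= => /and3P[_ _ p2].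
  have := p2; rewrite -rev_path last_rcons belast_rcons rev_cons.
  by rewrite (@eq_path _ (fun z => e^~ z) e) // => x y; rewrite e_sym.
- move: uu; rewrite /= !inE !negb_or !mem_cat !negb_or cat_uniq rev_uniq !mem_rev.
  by case/and3P=> /and3P[-> _ ->] /andP[_ ->] /and3P[_ _ ->].
- by apply: sub => v; rewrite mem_rev mem_cat => ->; rewrite orbT.
- by rewrite -szc size_rev /= size_cat /=; move: (size r1) (size r2) lt => m1 m2; clear; lia.
Qed.

(* Two cycles with at most one common vertex are joined by two disjoint paths, and these
   with the longer of the two arcs on each cycle form a cycle longer than the average. *)
Lemma longest_share c c' : (forall a b, connect e a b) ->
  (forall d, 2 < size d -> uniq d -> cycle e d -> size d <= size c) ->
  uniq c -> cycle e c -> uniq c' -> cycle e c' -> size c' = size c -> 2 < size c ->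
  1 < count (mem c') c.
Proof.
move=> conn maxc uc cc uc' cc' szc c2; rewrite ltnNge; apply/negP => le1.
have two (d : seq V) : 1 < size d -> uniq d -> exists b b', [/\ b \in d, b' \in d & b != b'].
  case: d => [|x [|y d]] //= _ /andP[]; rewrite inE negb_or => /andP[xy _] _.
  by exists x, y; rewrite !inE !eqxx orbT.
have B2 := two c (ltnW c2) uc.
have A2 : exists b b', [/\ b \in c', b' \in c' & b != b'] by apply: two; rewrite // szc ltnW.
have [w wc' wP] : exists2 w, w \in c' & has (mem c') c -> w \in c.
  have [/hasP[v vc vc']|_] := boolP (has (mem c') c); first by exists v.
  by have [b [_ [bc' _ _]]] := A2; exists b.
have only v : v \in c -> v \in c' -> w \in c /\ v = w.
  move=> vc vc'; have wc : w \in c by apply: wP; apply/hasP; exists v.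
  split=> //; apply/eqP; apply: contraT => vw; move: le1; rewrite leqNgt => /negP; case.
  rewrite -size_filter; apply: (@uniq_leq_size _ [:: v; w]); first by rewrite /= inE vw.
  by move=> u; rewrite !inE mem_filter => /orP[] /eqP->; rewrite /= ?vc ?vc' ?wc ?wc'.
have [s1 [s2 ea]] := ear_all B2 (fun a => conn a w).
have A2w : exists2 a, a \in c' & a != w.
  have [b [b' [Ab Ab' bb']]] := A2; have [E|] := eqVneq b w; last by exists b.
  by exists b' => //; rewrite -E eq_sym.
have [y [q [y' [q' [l1 l2 dis nil]]]]] := ear_linked B2 (A := mem c') wc' A2w ea.
case: l1 l2 => [p1 u1 /andP[A1 B1] a1 b1] [p2 u2 /andP[A2' B2'] a2 b2].
set b := last y q in B1 b1; set b' := last y' q' in B2' b2.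
have bb' : b != b'.
  apply: contra dis => /eqP E; apply/hasP; exists b; last exact: mem_last.
  by rewrite E mem_last.
have yy' : y' != y.
  by apply: contra dis => /eqP->; apply/hasP; exists y; apply: mem_head.
have [s [ps us subs szs]] := cycle_arc uc cc B1 B2' bb'.
have [t [pt ut subt szt]] := cycle_arc uc' cc' A2' A1 yy'.
have disj_s v : v \in s -> [/\ v \notin y :: q, v \notin y' :: q' & v \notin t].
  move=> vs; have vc := subs v vs; have /and3P[] := us; rewrite inE negb_or => /andP[_ bs] b's _.
  split.
  - by apply/negP => /b1/(_ vc) E; move: bs; rewrite -E vs.
  - by apply/negP => /b2/(_ vc) E; move: b's; rewrite -E vs.
  - apply/negP => vt; have [wc E] := only v vc (subt v vt).
    have [y'w q'n] := nil wc; move: b's; rewrite /b' q'n /= y'w -E vs //.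
have disj_t v : v \in t -> v \notin y :: q /\ v \notin y' :: q'.
  move=> vt; have vc' := subt v vt; have /and3P[] := ut; rewrite inE negb_or => /andP[_ y't] yt _.
  split.
  - by apply/negP => /a1/(_ vc') E; move: yt; rewrite -E vt.
  - by apply/negP => /a2/(_ vc') E; move: y't; rewrite -E vt.
pose d := (y :: q) ++ s ++ rev (y' :: q') ++ t.
have ud : uniq d.
  have us' : uniq s by have /and3P[] := us.
  have ut' : uniq t by have /and3P[] := ut.
  rewrite /d !cat_uniq u1 us' ut' rev_uniq u2 !andbT /=; apply/and3P; split.
  - apply/hasPn => v; rewrite !mem_cat mem_rev => /or3P[/disj_s[]//|vy'|/disj_t[]//].
    exact: (hasPn dis).
  - apply/hasPn => v; rewrite mem_cat mem_rev => /orP[vy'|vt]; apply/negP => /disj_s[_ h1 h2].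
      by rewrite vy' in h1.
    by rewrite vt in h2.
  - by apply/hasPn => v /disj_t[_ h]; rewrite /= mem_rev.
have cd : cycle e d.
  pose r := rev (belast y' q').
  have rE : rev (y' :: q') = b' :: r by rewrite lastI rev_rcons.
  have lr : last b' r = y' by rewrite -(last_cons y b' r) -rE rev_cons last_rcons.
  have pr : path e b' r.
    have := p2; rewrite -rev_path -/b' -/r (@eq_path _ (fun z => e^~ z) e) //.
  rewrite /d rE /= rcons_cat cat_path p1 -/b /= rcons_cat /= rcons_cat -cat_rcons.
  by rewrite cat_path ps last_rcons cat_path pr lr pt.
have szd : size d = size q + size q' + size s + size t + 2.
  rewrite /d !size_cat size_rev /=.
  by move: (size q) (size q') (size s) (size t) => ? ? ? ?; clear; lia.
have qq : 0 < size q + size q'.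
  rewrite addn_gt0; apply/orP; case: (q) (q') @b @b' {u1 a1 b1 p1 disj_s disj_t d ud cd szd u2 p2 a2 b2 ps us} B1 B2' dis nil bb' => [|? ?] [|? ?] /=; [|by right|by left|by left].
  move=> yc y'c _ _ _; have [_ E1] := only y yc A1; have [_ E2] := only y' y'c A2'.
  by move: yy'; rewrite E1 E2 eqxx.
have szlt : size c < size d.
  rewrite szd.
  move: (size c) (size c') (size q) (size q') (size s) (size t) szs szt szc qq.
  by clear; lia.
by have := maxc d (ltn_trans c2 szlt) ud cd; rewrite leqNgt szlt.
Qed.

End Linkage.

Lemma is_cycleP (G : sgraph) (c : seq G) :
  reflect [/\ 2 < size c, uniq c & cycle edge c] (is_cycle c).
Proof. by apply: (iffP and3P) => -[]; split. Qed.

Section TwoConnected.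
Variable G : sgraph.
Hypothesis G2 : kconnected 2 G.

Lemma kconn_connect (w a b : G) : a != w -> b != w ->
  connect [rel x y | [&& x != w, y != w & edge x y]] a b.
Proof.
move=> aw bw; have /andP[_ /forallP/(_ [set w])] := G2; rewrite cards1 /=.
move=> /forall_inP/(_ a); rewrite !inE => /(_ aw)/forall_inP/(_ b); rewrite !inE => /(_ bw).
by apply: connect_sub => x y /and3P[]; rewrite !inE => xw yw xy; apply: connect1; rewrite /= xw yw.
Qed.

Lemma conn_connect (a b : G) : connect edge a b.
Proof.
have /andP[_ /forallP/(_ set0)] := G2; rewrite cards0 /=.
move=> /forall_inP/(_ a); rewrite !inE => /(_ isT)/forall_inP/(_ b); rewrite !inE => /(_ isT).
by apply: connect_sub => x y /and3P[_ _ xy]; apply: connect1.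
Qed.

Lemma cycle_exists : exists c : seq G, is_cycle c.
Proof.
have /andP[G3 _] := G2.
have [a [b ab]] : exists a b : G, edge a b.
  have /card_gt0P[a _] : 0 < #|G| by lia.
  have : 0 < #|predC1 a| by rewrite cardC1; lia.
  case/card_gt0P=> b; rewrite inE => ba.
  case/connectP: (conn_connect a b) => -[|v p] /=; first by move=> _ E; rewrite E eqxx in ba.
  by case/andP=> av _ _; exists a, v.
have abn := edge_neq ab.
have [w] : exists w, w \notin [set a; b].
  have : 0 < #|~: [set a; b]| by rewrite cardsCs setCK cards2 abn; lia.
  by case/card_gt0P=> w; rewrite inE; exists w.
rewrite !inE negb_or => /andP[wa wb].
have B2 : exists u v, [/\ u \in [set a; b], v \in [set a; b] & u != v].
  by exists a, b; rewrite !inE !eqxx orbT.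
have [s1 [s2 [p1 p2 u12 [b1 _] [b2 _]]]] :=
  ear_all (@edge_sym G) kconn_connect B2 (fun v => conn_connect v w).
have wB : w \notin [set a; b] by rewrite !inE negb_or wa.
case: s1 p1 u12 b1 => [|x1 s1] p1 u12 b1; first by rewrite /= (negPf wB) in b1.
case: s2 p2 u12 b2 => [|x2 s2] p2 u12 b2; first by rewrite /= (negPf wB) in b2.
have ll : edge (last x1 s1) (last x2 s2).
  have : last x1 s1 != last x2 s2.
    have := u12; rewrite cons_uniq cat_uniq => /and4P[_ _ dis _].
    apply: contra dis => /eqP E; apply/hasP; exists (last x2 s2); first exact: mem_last.
    by rewrite -E; apply: mem_last.
  move: b1 b2; rewrite /= !inE; case/orP=> /eqP->; case/orP=> /eqP->; rewrite ?eqxx // => _ //.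
  by rewrite edge_sym.
exists (w :: (x1 :: s1) ++ rev (x2 :: s2)); apply/is_cycleP; split.
- by rewrite /= size_cat size_rev /= addnS.
- rewrite -(perm_uniq (_ : perm_eq (w :: (x1 :: s1) ++ x2 :: s2) _)) //.
  by rewrite perm_cons perm_cat2l perm_sym perm_rev.
- pose r := rev (belast x2 s2).
  have rE : rev (x2 :: s2) = last x2 s2 :: r by rewrite lastI rev_rcons.
  have pr : path edge (last x2 s2) (rcons r w).
    have := p2; rewrite -rev_path [belast _ _]/= rev_cons.
    by rewrite (@eq_path _ (fun z => edge^~ z) edge) // => x y; rewrite edge_sym.
  have /= /andP[wx1 px1] := p1.
  by rewrite rE /= rcons_cat /= cat_path /= wx1 px1 ll pr.
Qed.

End TwoConnected.

Theorem theorem1 (G : sgraph) (G_2conn : kconnected 2 G)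
    (G_p3t : partial_three_tree G) :
  lct G = 1 /\
  exists v : G, forall c : seq G, longest_cycle c -> v \in c.
Proof.
have G2 := G_2conn; case: G_p3t => H tH [f fI ef].
have [c0 lc0] : exists c : seq G, longest_cycle c.
  have [c cc] := cycle_exists G2.
  have := @arg_maxnP {bseq #|G| of G} (Bseq (is_cycle_size cc)) (@is_cycle G) size cc.
  move=> [d cd max_d]; exists (d : seq G); apply/longest_cycleP; split=> // c' cc'.
  exact: (max_d (Bseq (is_cycle_size cc'))).
have [cc0 max0] := elimT (longest_cycleP _) lc0.
have [c0_gt2 _ _] := elimT (is_cycleP _) cc0.
have longE (c : seq G) : longest_cycle c -> [/\ uniq c, cycle edge c & size c = size c0].
  move=> lc; have [cc maxc] := elimT (longest_cycleP _) lc.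
  have [_ uc cy] := elimT (is_cycleP _) cc.
  by split=> //;  apply/eqP; rewrite eqn_leq; apply/andP; split; auto.
suff [v vP] : exists v : G, forall c : seq G, longest_cycle c -> v \in c.
  split; last by exists v.
  have [[S tS tS'] minS] := lctP G; apply/eqP; rewrite eqn_leq; apply/andP; split.
    rewrite -(cards1 v); apply: minS; apply/lc_transversalP => c lc.
    by exists v; [rewrite inE | apply: vP].
  rewrite -tS' card_gt0; apply/set0Pn.
  by have [x xS _] := elimT (lc_transversalP S) tS c0 lc0; exists x.
have [/existsP[v /forallP vP]|] :=
    boolP [exists v : G, [forall c : {bseq #|G| of G}, longest_cycle c ==> (v \in (c : seq G))]].
  exists v => c lc; have /andP[cc _] := lc.
  exact: (implyP (vP (Bseq (is_cycle_size cc)))).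
rewrite negb_exists => /forallP nov; exfalso.
have missG v : exists2 c : seq G, longest_cycle c & v \notin c.
  have /forallPn[c] := nov v; rewrite negb_imply => /andP[lc vc].
  by exists (c : seq G).
pose e : rel H := [rel u v | [exists x : G, [exists y : G, [&& f x == u, f y == v & edge x y]]]].
have eP u v : reflect (exists x y, [/\ f x = u, f y = v & edge x y]) (e u v).
  apply: (iffP existsP) => [[x /existsP[y /and3P[/eqP fx /eqP fy xy]]]|[x [y [fx fy xy]]]].
    by exists x, y.
  by exists x; apply/existsP; exists y; rewrite fx fy !eqxx.
have efE x y : e (f x) (f y) = edge x y.
  by apply/eP/idP => [[x' [y' [/fI-> /fI->]]]|xy] //; exists x, y.
have e_sym : symmetric e.
  by move=> u v; apply/eP/eP => -[x [y [fx fy xy]]]; exists y, x; rewrite edge_sym.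
have e_sub u v : e u v -> edge u v by case/eP=> x [y [<- <- /ef]].
have liftE d : uniq d -> cycle e d -> exists c, [/\ d = map f c, uniq c & cycle edge c].
  move=> ud cd; have [c dE] : exists c, d = map f c.
    have : {subset d <= codom f}.
      by move=> u ud'; have /eP[x [y [<- _ _]]] := next_cycle cd ud'; apply: codom_f.
    elim: (d) => [|u d' IH] h; first by exists [::].
    have [c ->] := IH (fun v vd => h v (@mem_behead _ (u :: d') v vd)).
    by have /codomP[x ->] := h u (mem_head _ _); exists (x :: c).
  exists c; rewrite dE in ud cd *; split=> //; first by rewrite (map_inj_uniq fI) in ud.
  move: cd; rewrite cycle_map; rewrite (@eq_cycle _ (relpre f e) (@edge G)) //.
have L_max d : 2 < size d -> uniq d -> cycle e d -> size d <= size c0.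
  move=> d2 ud /(liftE d ud)[c [dE uc cc]]; rewrite dE size_map in d2 *.
  by apply: max0; apply/is_cycleP.
have lift_long d : long e (size c0) d -> exists2 c, d = map f c & longest_cycle c.
  case/and3P=> ud cd /eqP szd; have [c [dE uc cc]] := liftE d ud cd.
  rewrite dE size_map in szd; exists c => //; apply/longest_cycleP; split.
    by apply/is_cycleP; rewrite szd.
  by rewrite szd.
have map_long (c : seq G) : longest_cycle c -> long e (size c0) (map f c).
  move=> /longE[uc cc szc]; apply/and3P; split; rewrite ?size_map ?szc //.
    by rewrite map_inj_uniq.
  by rewrite cycle_map (@eq_cycle _ (relpre f e) (@edge G)).
apply: (@no_miss H e (size c0) tH e_sym e_sub L_max c0_gt2).
- move=> d d' /lift_long[c -> lc] /lift_long[c' -> lc'].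
  have [uc cc szc] := longE c lc; have [uc' cc' szc'] := longE c' lc'.
  rewrite count_map (@eq_count _ _ (mem c')); last by move=> x /=; rewrite mem_map.
  apply: (longest_share (@edge_sym G) (kconn_connect G2) (conn_connect G2)) => //;
    rewrite ?szc ?szc' //.
  by move=> d0 d2 ud cd; apply: max0; apply/is_cycleP.
- move=> u; have [/codomP[v ->]|nu] := boolP (u \in codom f).
    have [c lc vc] := missG v; exists (map f c); first exact: map_long.
    by rewrite mem_map.
  exists (map f c0); first exact: map_long.
  by apply: contra nu => /mapP[x _ ->]; apply: codom_f.
Qed.
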